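(* Let $p\ge 1$, $\beta>1/p$, and let $\xi=(\check{\mathcal T}_0,\check\mu_0)$ be a random string of beads of length $L$ with $\mathbb E[L^p]<\infty$. For $n\ge 0$, to obtain $(\check{\mathcal T}_{n+1},\check\mu_{n+1})$ conditionally given $(\check{\mathcal T}_k,\check\mu_k)$, $0\le k\le n$, attach to each atom $x\in\check{\mathcal T}_n$ of $\check\mu_n$ an independent isometric copy of $\xi$ with metric rescaled by $\check\mu_n(x)^\beta$ and mass measure rescaled by $\check\mu_n(x)$ (the rescaled mass measure of the copy replacing the atom at $x$). Then there exists a compact CRT $(\check{\mathcal T},\check\mu)$ such that $$\lim_{n\to\infty}(\check{\mathcal T}_n,\check\mu_n)=(\check{\mathcal T},\check\mu)\quad\text{a.s. in the Gromov-Hausdorff-Prokhorov topology on }\mathbb T_{\rm w}.$$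
   Context: Trees. An $\mathbb R$-tree is a separable metric space $(T,d)$ in which any two points $x,y$ are joined by a unique injective path $[[x,y]]$ (up to reparametrisation), this path being isometric to $[0,d(x,y)]$. All trees are rooted at a distinguished point $\rho$. A weighted $\mathbb R$-tree $(T,d,\rho,\mu)$ carries in addition a Borel probability measure $\mu$ on $T$. $\mathbb T_{\rm w}$ is the set of equivalence classes of compact weighted rooted $\mathbb R$-trees under root- and measure-preserving isometries, with the Gromov-Hausdorff-Prokhorov metric $$d_{\rm GHP}((T,d,\rho,\mu),(T',d',\rho',\mu'))=\inf_{\varphi,\varphi'}\max\{\delta(\varphi(\rho),\varphi'(\rho')),\delta_{\rm H}(\varphi(T),\varphi'(T')),\delta_{\rm P}(\varphi_*\mu,\varphi'_*\mu')\},$$ the infimum being over all isometric embeddings $\varphi,\varphi'$ of $T,T'$ into a common metric space $(\mathcal M,\delta)$; $\delta_{\rm H}$ and $\delta_{\rm P}$ are the Hausdorff and Prokhorov distances. Continuum trees. A leaf of $T$ is a point $x\in T\setminus\{\rho\}$ such that $T\setminus\{x\}$ is connected; ${\rm Lf}(T)$ is the set of leaves. A weighted $\mathbb R$-tree is a continuum tree if (i) $\mu$ is supported by ${\rm Lf}(T)$ (i.e. $\mu(T\setminus {\rm Lf}(T))=0$), (ii) $\mu$ has no atoms, (iii) $\mu(T_x)>0$ for every $x\in T\setminus{\rm Lf}(T)$, where $T_x=\{\sigma\in T: x\in[[\rho,\sigma]]\}$. A continuum random tree (CRT) is a random weighted $\mathbb R$-tree that is almost surely a continuum tree. Strings of beads.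 A string of beads is a weighted interval $([0,\ell],\sum_{i\ge1}p_i\delta_{x_i})$, rooted at $0$, with $\ell>0$, distinct $x_i\in[0,\ell]$, $\ell=\sup\{x_i:p_i>0\}$, and $1>p_1\ge p_2\ge\cdots\ge0$, $\sum_i p_i=1$. Its length is $\ell$. A random string of beads is a random variable valued in such strings. Attaching. ''Attaching a copy of $\xi$ at $x$'' means taking the disjoint union and identifying the left endpoint $0$ (root) of the copy with $x$, using the resulting path metric; the root of each $\check{\mathcal T}_n$ is the left endpoint of $\check{\mathcal T}_0$. The copies used in all steps are independent of each other and of the past, and $\check{\mathcal T}_n\subset\check{\mathcal T}_{n+1}$. *)

(* Defs.v *)
From HB Require Import structures.
From mathcomp Require Import all_boot all_order all_algebra finmap.
From mathcomp Require Import all_classical all_reals all_analysis.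
From mathcomp Require Import lra.
Set Implicit Arguments.
Unset Strict Implicit.
Unset Printing Implicit Defensive.
Import Order.TTheory GRing.Theory Num.Theory.
Import numFieldNormedType.Exports.
Local Open Scope classical_set_scope.
Local Open Scope ring_scope.

(* The distinguished [point] of a pointed metric space is its root. *)
#[short(type="rootedMetricType")]
HB.structure Definition RootedMetric (R : numDomainType) :=
  {T of Metric R T & isPointed T}.

Definition root {R : numDomainType} (T : rootedMetricType R) : T := point.

Section Rtree.
Context {R : realType}.

Definition separable (T : topologicalType) :=
  exists D : set T, countable D /\ dense D.

Definition injective_path (T : metricType R) (x y : T) (a : R) (g : R -> T) :=
  [/\ 0 <= a, {within `[0, a], continuous g}, {in `[0, a] &, injective g},
      g 0 = x & g a = y].

Definition geodesic (T : metricType R) (x y : T) (f : R -> T) :=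
  injective_path x y (mdist x y) f /\
  {in `[0, mdist x y] &, forall s t, mdist (f s) (f t) = `|s - t|}.

(* [g], defined on [0, a], is an increasing reparametrisation of [f], defined
   on [0, b] *)
Definition reparametrises (T : metricType R) (a b : R) (g f : R -> T) :=
  exists phi : R -> R,
    [/\ {within `[0, a], continuous phi},
        {in `[0, a] &, {homo phi : s t / s < t}},
        phi 0 = 0, phi a = b &
        {in `[0, a], forall t, g t = f (phi t)}].

Definition Rtree (T : metricType R) :=
  separable T /\
  forall x y : T, exists f : R -> T, geodesic x y f /\
    forall a g, injective_path x y a g -> reparametrises a (mdist x y) g f.

(* The range of the injective path from [x] to [y], unique in an R-tree. *)
Definition segment (T : metricType R) (x y : T) : set T :=
  [set z | exists a g, injective_path x y a g /\ (g @` `[0, a]) z].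

Definition leaves (T : rootedMetricType R) : set T :=
  [set x | x <> root T /\ connected (~` [set x])].

Definition subtree_above (T : rootedMetricType R) (x : T) : set T :=
  [set s | segment (root T) s x].

End Rtree.

Arguments leaves {R} T.
Arguments subtree_above {R} T x.

Definition borelType {R : numDomainType} (T : rootedMetricType R) :=
  g_sigma_algebraType (@open T).

Record weighted_space (R : realType) := WeightedSpace {
  space :> rootedMetricType R ;
  mass : {measure set (borelType space) -> \bar R} }.

Section GHP.
Context {R : realType}.

Definition compact_weighted_Rtree (X : weighted_space R) :=
  [/\ Rtree X, compact [set: X] & mass X [set: X] = 1%E].

Definition continuum_tree (X : weighted_space R) :=
  [/\ mass X (~` leaves X) = 0%E,
      (forall x : X, mass X [set x] = 0%E) &
      (forall x : X, ~ leaves X x -> (0 < mass X (subtree_above X x))%E)].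

Definition isometric (X Y : metricType R) (f : X -> Y) :=
  forall x y, mdist (f x) (f y) = mdist x y.

Section distances.
Variable M : metricType R.

Definition thickening (A : set M) (e : R) : set M :=
  [set x | exists2 a, A a & mdist a x < e].

Definition hausdorff_dist (A B : set M) : \bar R :=
  ereal_inf [set e%:E | e in [set e : R |
    [/\ 0 < e, A `<=` thickening B e & B `<=` thickening A e]]].

Definition prokhorov_dist (mu nu : set M -> \bar R) : \bar R :=
  ereal_inf [set e%:E | e in [set e : R | 0 < e /\
    forall A : set M, <<s @open M >> A ->
      (mu A <= nu (thickening A e) + e%:E)%E /\
      (nu A <= mu (thickening A e) + e%:E)%E]].

End distances.

Definition ghp_dist (X Y : weighted_space R) : \bar R :=
  ereal_inf [set r | exists (M : metricType R) (f : X -> M) (g : Y -> M),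
    [/\ isometric f, isometric g &
      r = maxe (mdist (f (root X)) (g (root Y)))%:E
         (maxe (hausdorff_dist (range f) (range g))
               (prokhorov_dist (fun A => mass X (f @^-1` A))
                               (fun A => mass Y (g @^-1` A))))]].

End GHP.

(* Elements of this type are representatives of the points of T_w; [ghp_dist]
   vanishes exactly on pairs of equivalent trees, so GHP-open and GHP-Borel sets
   are unions of equivalence classes. *)
Record Tw (R : realType) := MkTw {
  Tw_space :> weighted_space R ;
  _ : compact_weighted_Rtree Tw_space }.

Section random_trees.
Context {R : realType}.

Definition ghp_open (U : Tw R -> Prop) :=
  forall X, U X -> exists2 e : R, 0 < e &
    forall Y : Tw R, (ghp_dist X Y < e%:E)%E -> U Y.

(* [T] is Borel measurable: the open sets generate the Borel sigma-algebra. *)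
Definition random_tree d (Omega : measurableType d) (T : Omega -> Tw R) :=
  forall U, ghp_open U -> measurable [set w | U (T w)].

Definition compact_CRT d (Omega : measurableType d) (P : probability Omega R)
    (T : Omega -> Tw R) :=
  random_tree T /\ {ae P, forall w, continuum_tree (T w)}.

End random_trees.

(* Finitely many atoms are allowed: [bead_mass] may vanish from some index on,
   and then the corresponding [bead_pos] are irrelevant. *)
Record string_of_beads (R : realType) := StringOfBeads {
  string_length : R ;
  bead_pos : nat -> R ;
  bead_mass : nat -> R ;
  string_length_gt0 : 0 < string_length ;
  bead_pos_inj : injective bead_pos ;
  bead_pos_itv : forall i, 0 <= bead_pos i <= string_length ;
  string_length_sup : string_length = sup [set bead_pos i | i in
                                             [set i | 0 < bead_mass i]] ;
  bead_mass_ge0 : forall i, 0 <= bead_mass i ;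
  bead_mass_lt1 : bead_mass 0%N < 1 ;
  bead_mass_noninc : {homo bead_mass : i j / (i <= j)%N >-> j <= i} ;
  bead_mass_sum : (\sum_(0 <= i < n) bead_mass i) @[n --> \oo] --> (1 : R) }.

Section string_measurable.
Variable R : realType.
Local Notation S := (string_of_beads R).

HB.instance Definition _ := gen_eqMixin S.
HB.instance Definition _ := gen_choiceMixin S.

Let pos0 (i : nat) : R := i.+1%:R^-1.
Let mass0 (i : nat) : R := (if (i < 2)%N then 2^-1 else 0).

Let inj0 : injective pos0.
Proof. by move=> i j /invr_inj/eqP; rewrite eqr_nat eqSS => /eqP. Qed.

Let itv0 i : 0 <= pos0 i <= 1.
Proof. by rewrite invr_ge0 ler0n/= invf_le1 ?ltr0n// ler1n. Qed.

Let sup0 : 1 = sup [set pos0 i | i in [set i | 0 < mass0 i]].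
Proof.
have ub1 : ubound [set pos0 i | i in [set i | 0 < mass0 i]] 1.
  by move=> _ [i _ <-]; case/andP: (itv0 i).
have m1 : [set pos0 i | i in [set i | 0 < mass0 i]] 1.
  by exists 0%N; rewrite /pos0 ?invr1//= /mass0/= invr_gt0.
by apply/eqP; rewrite eq_le ge_sup ?ub_le_sup//; exists 1.
Qed.

Let ge00 i : 0 <= mass0 i. Proof. by rewrite /mass0; case: ifP. Qed.

Let lt10 : mass0 0%N < 1. Proof. by rewrite /mass0/= invf_lt1// ltr1n. Qed.

Let noninc0 : {homo mass0 : i j / (i <= j)%N >-> j <= i}.
Proof.
by move=> [|[|i]] [|[|j]] //= _; rewrite /mass0/= ?lexx// invr_ge0.
Qed.

Let sum0 : (\sum_(0 <= i < n) mass0 i) @[n --> \oo] --> (1 : R).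
Proof.
apply: cvg_near_cst; exists 2%N => // -[|[|n]] //= _.
rewrite big_ltn// big_ltn// big_nat big1 ?addr0 /mass0/=; first lra.
by case=> [|[|i]].
Qed.

HB.instance Definition _ := isPointed.Build S
  (StringOfBeads ltr01 inj0 itv0 sup0 ge00 lt10 noninc0 sum0).


(* Events may depend on the enumeration of the atoms, which the weighted interval
   determines up to reordering atoms of equal mass. Any random weighted interval
   that is a string of beads has a measurable enumeration. *)
Definition string_cylinders : set (set S) :=
  [set A | exists (f : S -> R) (B : set R),
    [/\ [\/ f = @string_length R,
            exists i, f = (fun s => bead_pos s i) |
            exists i, f = (fun s => bead_mass s i)],
        measurable B & A = f @^-1` B]].

HB.instance Definition _ := @isMeasurable.Build
  (sigma_display string_cylinders) S <<s string_cylinders >>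
  (@sigma_algebra0 _ setT string_cylinders)
  (@sigma_algebraC S string_cylinders)
  (@sigma_algebra_bigcup _ setT string_cylinders).

End string_measurable.

Definition attach_mem {R : realType} {T : Type} (len : seq nat -> R)
    (z : T + seq nat * R) : bool :=
  if z is inr (i, t) then 0 < t <= len i else true.

(* [T] with a copy of the interval [0, len i] attached at [loc i], for every
   [i]: since the endpoint 0 of the copy is identified with [loc i], the points
   that are added are the [inr (i, t)] with [0 < t <= len i]. The argument
   [loc] only matters for the metric. *)
Definition attach {R : realType} {T : rootedMetricType R}
    (loc : seq nat -> T) (len : seq nat -> R) :=
  {z : T + seq nat * R | attach_mem len z}.

Section attach.
Context {R : realType} {T : rootedMetricType R}.
Variables (loc : seq nat -> T) (len : seq nat -> R).
Local Notation attach := (attach loc len).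

HB.instance Definition _ := Choice.on attach.

Definition attach_base (x : T) : attach := exist _ (inl x) isT.

(* The point at distance [t] from the left endpoint of the [i]-th copy; it is
   [loc i] for [t = 0], as [inr (i, 0)] is not in [attach]. *)
Definition attach_point (i : seq nat) (t : R) : attach :=
  insubd (attach_base (loc i)) (inr (i, t)).

Definition attach_rawdist (y z : T + seq nat * R) : R :=
  match y, z with
  | inl a, inl b => mdist a b
  | inl a, inr (j, t) => mdist a (loc j) + t
  | inr (i, s), inl b => s + mdist (loc i) b
  | inr (i, s), inr (j, t) =>
      if i == j then `|s - t| else s + mdist (loc i) (loc j) + t
  end.

Definition attach_dist (y z : attach) : R := attach_rawdist (val y) (val z).

Fact attach_distxx y : attach_dist y y = 0.
Proof.
by case: y => -[a|[i s]] h; rewrite /attach_dist/= ?mdistxx// eqxx subrr normr0.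
Qed.

Fact attach_dist_pos y z : attach_dist y z = 0 -> y = z.
Proof.
move=> yz; apply: val_inj; move: y z yz.
move=> [[a|[i s]] hy] [[b|[j t]] hz]; rewrite /attach_dist/= => yz.
- by move/mdist_positivity: yz => ->.
- by move: hy hz => /= _ /andP[t0 _]; exfalso;
    have := mdist_ge0 a (loc j); lra.
- by move: hy hz => /= /andP[t0 _] _; exfalso;
    have := mdist_ge0 (loc i) b; lra.
- move: yz; case: eqVneq => [->|ij] yz.
    by move/normr0_eq0/eqP: yz; rewrite subr_eq0 => /eqP ->.
  move: hy hz => /= /andP[s0 _] /andP[t0 _]; exfalso.
  by have := mdist_ge0 (loc i) (loc j); lra.
Qed.

Fact attach_dist_sym y z : attach_dist y z = attach_dist z y.
Proof.
case: y z => [[a|[i s]] hy] [[b|[j t]] hz]; rewrite /attach_dist/=.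
- by rewrite metric_sym.
- by rewrite metric_sym addrC.
- by rewrite metric_sym addrC.
- rewrite eq_sym; case: eqVneq => _; first by rewrite distrC.
  by rewrite metric_sym; lra.
Qed.

Fact normB_le (s t : R) : 0 < s -> 0 < t -> `|s - t| <= s + t.
Proof. by move=> s0 t0; rewrite (le_trans (ler_normB _ _))// !gtr0_norm. Qed.

Fact normB_ge (s t : R) : s - t <= `|s - t| /\ t - s <= `|s - t|.
Proof. by split; [exact: ler_norm|rewrite distrC; exact: ler_norm]. Qed.

Fact attach_dist_triangle y x z : attach_dist x z <= attach_dist x y + attach_dist y z.
Proof.
case: x y z => [[a|[i s]] hx] [[b|[j t]] hy] [[c|[k u]] hz];
  rewrite /attach_dist/=; move: hx hy hz => /=.
- by move=> *; exact: metric_triangle.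
- by move=> *; rewrite addrA lerD2r metric_triangle.
- move=> _ /andP[t0 _] _; have := metric_triangle a (loc j) c; lra.
- move=> _ /andP[t0 _] /andP[u0 _]; case: eqVneq => [<-|_].
    have [] := normB_ge t u; lra.
  have := metric_triangle a (loc j) (loc k); lra.
- by move=> *; rewrite -addrA lerD2l metric_triangle.
- move=> /andP[s0 _] _ /andP[u0 _]; case: eqVneq => [<-|_].
    have := normB_le s0 u0; have := mdist_ge0 (loc i) b.
    have := mdist_ge0 b (loc i); lra.
  have := metric_triangle (loc i) b (loc k); lra.
- move=> /andP[s0 _] /andP[t0 _] _; case: eqVneq => [<-|_].
    have [] := normB_ge s t; lra.
  have := metric_triangle (loc i) (loc j) c; lra.
- move=> /andP[s0 _] /andP[t0 _] /andP[u0 _].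
  have [ij|ij] := eqVneq i j; have [jk|jk] := eqVneq j k.
  + by subst j k; rewrite eqxx; exact: ler_distD.
  + subst j; rewrite (negbTE jk); have [] := normB_ge s t; lra.
  + subst k; rewrite (negbTE ij); have [] := normB_ge t u; lra.
  + have [ik|ik] := eqVneq i k.
      have := normB_le s0 u0; have := mdist_ge0 (loc i) (loc j).
      have := mdist_ge0 (loc j) (loc k); lra.
    have := metric_triangle (loc i) (loc j) (loc k); lra.
Qed.

HB.instance Definition _ := @isMetric.Build R attach attach_dist
  attach_distxx attach_dist_pos attach_dist_sym attach_dist_triangle.
HB.instance Definition _ := isPointed.Build attach (attach_base (root T)).

End attach.

Section string_interval.
Context {R : realType} (s : string_of_beads R).

Definition string_interval := {t : R | 0 <= t <= string_length s}.

HB.instance Definition _ := Choice.on string_interval.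

Let zero_itv : 0 <= (0 : R) <= string_length s.
Proof. by rewrite lexx ltW// string_length_gt0. Qed.

HB.instance Definition _ :=
  isPointed.Build string_interval (exist _ 0 zero_itv).

Definition interval_dist (x y : string_interval) : R := `|val x - val y|.

Let distxx x : interval_dist x x = 0.
Proof. by rewrite /interval_dist subrr normr0. Qed.

Let dist_pos x y : interval_dist x y = 0 -> x = y.
Proof. by move=> /normr0_eq0/eqP; rewrite subr_eq0 => /eqP/val_inj. Qed.

Let dist_sym x y : interval_dist x y = interval_dist y x.
Proof. exact: distrC. Qed.

Let dist_triangle y x z :
  interval_dist x z <= interval_dist x y + interval_dist y z.
Proof. exact: ler_distD. Qed.

HB.instance Definition _ := @isMetric.Build R string_interval interval_dist
  distxx dist_pos dist_sym dist_triangle.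

End string_interval.

(* A rooted space with point masses labelled by words; labels of mass 0 are
   not atoms. *)
Record beaded_space (R : realType) := BeadedSpace {
  beaded_base : rootedMetricType R ;
  atom_pos : seq nat -> beaded_base ;
  atom_mass : seq nat -> R ;
  atom_mass_ge0 : forall u, 0 <= atom_mass u }.

Section atomic_measure.
Context {R : realType} (X : beaded_space R).

Definition atomic_measure (A : set (borelType (beaded_base X))) : \bar R :=
  \esum_(u in atom_pos X @^-1` A) (atom_mass X u)%:E.

Let atomic0 : atomic_measure set0 = 0%E.
Proof. by rewrite /atomic_measure preimage_set0 esum_set0. Qed.

Let atomic_ge0 A : (0 <= atomic_measure A)%E.
Proof. by apply: esum_ge0 => u _; rewrite lee_fin atom_mass_ge0. Qed.

Let atomic_sigma_additive : semi_sigma_additive atomic_measure.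
Proof.
move=> F _ tF _.
have -> : atomic_measure (\bigcup_n F n) = (\sum_(n <oo) atomic_measure (F n))%E.
  rewrite /atomic_measure preimage_bigcup esum_bigcupT.
  - by rewrite nneseries_esumT// => n; exact: (atomic_ge0 (F n)).
  - by apply/trivIsetP => i j _ _ ij; rewrite -preimage_setI;
      move/trivIsetP: tF => ->//; rewrite preimage_set0.
  - by move=> u; rewrite lee_fin atom_mass_ge0.
by apply: is_cvg_nneseries => n _ _; exact: atomic_ge0.
Qed.

HB.instance Definition _ := isMeasure.Build _ _ _ atomic_measure
  atomic0 atomic_ge0 atomic_sigma_additive.

Definition weighted : weighted_space R := WeightedSpace atomic_measure.

End atomic_measure.

Section construction.
Context {R : realType} (beta : R) (xi : seq nat -> string_of_beads R).

(* Words are read from right to left: [i :: u] is the [i]-th atom of the copy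
   of the string attached to the atom [u]. *)

Definition first_pos (u : seq nat) : string_interval (xi [::]) :=
  if u is [:: i] then exist _ (bead_pos (xi [::]) i) (bead_pos_itv (xi [::]) i)
  else point.

Definition first_mass (u : seq nat) : R :=
  if u is [:: i] then bead_mass (xi [::]) i else 0.

Lemma first_mass_ge0 u : 0 <= first_mass u.
Proof. by case: u => [|i []]//=; exact: bead_mass_ge0. Qed.

Definition first_tree : beaded_space R := BeadedSpace first_pos first_mass_ge0.

Section next_tree.
Variable X : beaded_space R.

(* The copy [xi u] is attached at the atom [u]; if [u] has mass 0 its rescaled
   length is 0 when [beta != 0], so that nothing is attached there. *)
Definition copy_length (u : seq nat) : R :=
  atom_mass X u `^ beta * string_length (xi u).

Definition next_pos (v : seq nat) : attach (atom_pos X) copy_length :=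
  if v is i :: u then
    attach_point (atom_pos X) copy_length u
      (atom_mass X u `^ beta * bead_pos (xi u) i)
  else point.

Definition next_mass (v : seq nat) : R :=
  if v is i :: u then atom_mass X u * bead_mass (xi u) i else 0.

Lemma next_mass_ge0 v : 0 <= next_mass v.
Proof.
by case: v => //= i u; rewrite mulr_ge0 ?atom_mass_ge0 ?bead_mass_ge0.
Qed.

Definition next_tree : beaded_space R := BeadedSpace next_pos next_mass_ge0.

End next_tree.

(* The atoms of the [n]-th tree are its labels of length [n.+1] and positive
   mass. *)
Definition beaded_tree (n : nat) : beaded_space R := iter n next_tree first_tree.

Definition string_tree (n : nat) : weighted_space R := weighted (beaded_tree n).

End construction.

Section iid.
Context {R : realType} d (Omega : measurableType d) (P : probability Omega R).
Context d' (S : measurableType d') (I : choiceType).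

Definition independent (X : I -> Omega -> S) :=
  forall (J : {fset I}) (A : I -> set S), (forall i, measurable (A i)) ->
    P (\bigcap_(i in [set` J]) X i @^-1` A i) =
    (\big[*%E/1]_(i <- J) P (X i @^-1` A i))%E.

Definition same_law (X Y : Omega -> S) :=
  forall A, measurable A -> P (X @^-1` A) = P (Y @^-1` A).

Definition iid (X : I -> Omega -> S) :=
  independent X /\ forall i j, same_law (X i) (X j).

End iid.

(* Main.v *)
(* All the trees live in the space l1 of summable families indexed by words: a
   point is encoded by the heights at which the geodesic from the root to it runs
   along the segments that are attached at the various words. The four-point
   condition and explicit geodesics from the root make these sets R-trees.
   If W is the product of the bead masses along a word u, then the segment
   attached at u has length W^beta L; since beta p > 1, the expectation of
   sum_i p_i^(beta p) is less than 1, hence so is that of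
   rho^(-p) sum_i p_i^(beta p) for some rho < 1, and summing p-th powers over all
   words shows that a.s. all but finitely many segments have length at most
   e rho^|u|, for every e > 0. This gives compactness of the limit and
   Hausdorff convergence.
   The interval [0, 1[ is split into nested cells according to the bead masses,
   so that Lebesgue measure is pushed forward to the mass measures of all trees at
   once; this coupling controls the Prokhorov distance. The limit mass has no atom
   because the masses of words tend to 0, and it sits on the leaves because an
   interior point of a branch would sit at the root of all later strings,
   which is a null event as the mass at the root of a string is
   at most p_1 < 1.
   The limit is Borel measurable because, up to e, it depends on finitely many
   lengths, positions and masses: the good event is a countable union of events
   on which all trees are within e of each other. *)
Require Import Defs.
From HB Require Import structures.
From mathcomp Require Import all_boot all_order all_algebra finmap.
From mathcomp Require Import all_classical all_reals all_analysis.
From mathcomp Require Import measurable_realfun.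
From mathcomp Require Import lra zify ring.
Set Implicit Arguments.
Unset Strict Implicit.
Unset Printing Implicit Defensive.
Import Order.TTheory GRing.Theory Num.Theory.
Import numFieldNormedType.Exports.
Local Open Scope classical_set_scope.
Local Open Scope ring_scope.

(** * Summable families indexed by words *)

(** Lengths that merely tend to 0 would not bound the height of the limit, as a branch may cross
    infinitely many segments. The factor rho^|u| cures this: a branch crosses at most one segment
    per level, so outside finitely many words its length is at most e / (1 - rho), uniformly over
    all branches. Compactness, convergence and the comparison of two trees all reduce to a finite
    sum plus this tail. Moments can be summed over words because the mass of a word depends only on
    the strings at its proper suffixes, hence is independent of the string attached at the word
    itself. The limit is built deterministically from any family of strings whose lengths decay.
    Probability enters only to show that three conditions hold almost surely: decay of the lengths,
    decay of the masses, and rarity of long runs of beads at position 0. No completion is taken: the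
    limit is the set of all admissible height functions, and the n-th tree is the part supported by
    words of at most n letters. *)

Section nonnegative_sums.
Context {R : realType} {U : choiceType}.
Implicit Types (f g : U -> R) (J : seq U).

Definition summable0 f :=
  (forall u, 0 <= f u) /\ (\esum_(u in setT) (f u)%:E < +oo)%E.

Definition nsum f : R := fine (\esum_(u in setT) (f u)%:E).

Lemma nsumE f : summable0 f -> (nsum f)%:E = (\esum_(u in setT) (f u)%:E)%E.
Proof.
move=> [f0 foo]; rewrite fineK// ge0_fin_numE//.
by apply: esum_ge0 => u _; rewrite lee_fin.
Qed.

(** Only lists on which [f] is positive are tested: the support of a point of a tree is a chain of
    words, and it is along chains that sums can be bounded. *)
Lemma nsum_ub f (c : R) : (forall u, 0 <= f u) ->
  (forall J, uniq J -> (forall u, u \in J -> 0 < f u) ->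
     \sum_(u <- J) f u <= c) ->
  summable0 f /\ nsum f <= c.
Proof.
move=> f0 fc.
have le : (\esum_(u in setT) (f u)%:E <= c%:E)%E.
  apply: ge_ereal_sup => _ [A [finA _] <-].
  rewrite fsbig_finite//= sumEFin lee_fin.
  rewrite (bigID (fun u => 0 < f u))/= [X in _ + X]big1 ?addr0.
    rewrite -big_filter; apply: fc; first by rewrite filter_uniq// fset_uniq.
    by move=> u; rewrite mem_filter => /andP[].
  by move=> u; rewrite -leNgt => fu; apply/eqP; rewrite eq_le fu f0.
have S : summable0 f by split=> //; exact: le_lt_trans le (ltry _).
by split=> //; rewrite -lee_fin nsumE.
Qed.

Lemma nsum_ge f J : summable0 f -> uniq J -> \sum_(u <- J) f u <= nsum f.
Proof.
move=> S uJ; rewrite -lee_fin nsumE//; apply: esum_ge.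
exists [set` J]; first by split=> //; exact: finite_seq.
by rewrite -sumEFin fsbig_seq.
Qed.

Lemma nsum_ge1 f u : summable0 f -> f u <= nsum f.
Proof. by move=> Sf; have := @nsum_ge f [:: u] Sf isT; rewrite big_seq1. Qed.

Lemma nsum_ge0 f : summable0 f -> 0 <= nsum f.
Proof. by move=> Sf; have := @nsum_ge f [::] Sf isT; rewrite big_nil. Qed.

Lemma nsum_eq0 f u : summable0 f -> nsum f = 0 -> f u = 0.
Proof.
by move=> S f0; apply/eqP; rewrite eq_le -{1}f0 nsum_ge1//; case: S => ->.
Qed.

Lemma summable0D f g : summable0 f -> summable0 g -> summable0 (f \+ g).
Proof.
move=> [f0 fs] [g0 gs]; split=> [u|]; first by rewrite addr_ge0.
rewrite (eq_esum (b := fun u => ((f u)%:E + (g u)%:E)%E))//.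
by rewrite esumD ?lte_add_pinfty// => u _; rewrite lee_fin.
Qed.

Lemma nsumD f g : summable0 f -> summable0 g ->
  nsum (f \+ g) = nsum f + nsum g.
Proof.
move=> Sf Sg; apply: EFin_inj; rewrite EFinD !nsumE//; last exact: summable0D.
by case: Sf Sg => ? _ [? _]; rewrite -esumD// => u _; rewrite lee_fin.
Qed.

Lemma summable0_le f g : (forall u, 0 <= f u <= g u) -> summable0 g ->
  summable0 f.
Proof.
move=> fg [g0 gs]; split=> [u|]; first by case/andP: (fg u).
by apply: le_lt_trans gs; apply: le_esum => u _; rewrite lee_fin; case/andP: (fg u).
Qed.

Lemma nsum_le f g : (forall u, 0 <= f u <= g u) -> summable0 g ->
  nsum f <= nsum g.
Proof.
move=> fg Sg; rewrite -lee_fin !nsumE//; last exact: summable0_le Sg.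
by apply: le_esum => u _; rewrite lee_fin; case/andP: (fg u).
Qed.

Lemma nsum_finite_support f J : uniq J -> (forall u, 0 <= f u) ->
  (forall u, u \notin J -> f u = 0) ->
  summable0 f /\ nsum f = \sum_(u <- J) f u.
Proof.
move=> uJ f0 fJ.
have [Sf le] : summable0 f /\ nsum f <= \sum_(u <- J) f u.
  apply: nsum_ub => // J' uJ' J'0.
  rewrite [leRHS](bigID (mem J'))/= -[leLHS]addr0 lerD ?sumr_ge0//.
  rewrite (perm_big [seq u <- J | u \in J'])/= ?big_filter//.
  apply: uniq_perm; rewrite ?filter_uniq// => u; rewrite mem_filter.
  apply/idP/andP => [uJ''|[]//]; split=> //; apply/negPn/negP => /fJ fu0.
  by have := J'0 _ uJ''; rewrite fu0 ltxx.
by split=> //; apply/eqP; rewrite eq_le le nsum_ge.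
Qed.

End nonnegative_sums.

(** * The ambient space of summable families *)

Section l1_space.
Context {R : realType} {U : choiceType}.

Definition l1 := {f : U -> R | `[< summable0 (fun u => `|f u|) >]}.

HB.instance Definition _ := Choice.on l1.

Definition coord (x : l1) : U -> R := val x.

Lemma l1P (x : l1) : summable0 (fun u => `|coord x u|).
Proof. by apply/asboolP; exact: (valP x). Qed.

Definition mkl1 (f : U -> R) (h : summable0 (fun u => `|f u|)) : l1 :=
  exist _ f (asboolT h).

Lemma l1_ext (x y : l1) : coord x =1 coord y -> x = y.
Proof. by move=> xy; apply: val_inj; apply/funext. Qed.

Definition l1_dist (x y : l1) : R := nsum (fun u => `|coord x u - coord y u|).

Lemma summable_dist (x y : l1) : summable0 (fun u => `|coord x u - coord y u|).
Proof.
apply: (summable0_le _ (summable0D (l1P x) (l1P y))) => u /=.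
by rewrite normr_ge0/= ler_normB.
Qed.

Let distxx x : l1_dist x x = 0.
Proof.
have [] := @nsum_finite_support R U (fun u => `|coord x u - coord x u|) [::] => //.
  by move=> u _; rewrite subrr normr0.
by rewrite big_nil.
Qed.

Let dist_pos x y : l1_dist x y = 0 -> x = y.
Proof.
move=> xy; apply: l1_ext => u; apply/eqP; rewrite -subr_eq0 -normr_eq0.
by rewrite (nsum_eq0 u (summable_dist x y) xy).
Qed.

Let dist_sym x y : l1_dist x y = l1_dist y x.
Proof. by rewrite /l1_dist; congr nsum; apply/funext => u; rewrite distrC. Qed.

Let dist_triangle y x z : l1_dist x z <= l1_dist x y + l1_dist y z.
Proof.
rewrite /l1_dist -nsumD; try exact: summable_dist.
apply: nsum_le => [u|]; last by apply: summable0D; exact: summable_dist.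
by rewrite normr_ge0/= ler_distD.
Qed.

HB.instance Definition _ := @isMetric.Build R l1 l1_dist
  distxx dist_pos dist_sym dist_triangle.

Lemma l1_mdistE (x y : l1) :
  mdist x y = nsum (fun u => `|coord x u - coord y u|).
Proof. by []. Qed.

End l1_space.
Arguments l1 : clear implicits.

(** * Zero-hyperbolic spaces with geodesics from the root are R-trees *)

Section metric_topology.
Context {R : realType} {T : metricType R}.
Implicit Types (x y z : T) (A : set T).

Lemma mdist_open A :
  (forall z, A z -> exists2 e : R, 0 < e & forall z', mdist z z' < e -> A z') ->
  open A.
Proof.
move=> h; rewrite openE => z /h[e e0 ze]; apply/nbhs_ballP; exists e => //= z'.
by rewrite ballEmdist/=; exact: ze.
Qed.

Lemma open_mdist A z : open A -> A z ->
  exists2 e : R, 0 < e & forall z', mdist z z' < e -> A z'.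
Proof.
rewrite openE => oA /oA /nbhs_ballP[e /= e0 ze]; exists e => // z' zz'.
by apply: ze; rewrite ballEmdist.
Qed.

Lemma thickening_open A (e : R) : open (thickening A e).
Proof.
apply: mdist_open => z [a Aa az]; exists (e - mdist a z); first by rewrite subr_gt0.
move=> z' zz'; exists a => //.
by have := metric_triangle a z z'; lra.
Qed.

Lemma within_continuous_mdist (D : set R) (f : R -> T) :
  {within D, continuous f} <->
  forall t, D t -> forall e, 0 < e -> exists2 h, 0 < h &
    forall s, D s -> `|t - s| < h -> mdist (f t) (f s) < e.
Proof.
split=> [/subspace_continuousP cf t Dt e e0|cf].
  have := cf t Dt; move/metricType_numDomainType.cvgrPdist_lt => /(_ e e0).
  rewrite near_withinE => /nbhs_ballP[h /= h0 hP]; exists h => // s Ds ts.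
  exact: hP.
apply/subspace_continuousP => t Dt; apply/metricType_numDomainType.cvgrPdist_lt.
move=> e e0; have [h h0 hP] := cf t Dt e e0.
rewrite near_withinE; apply/nbhs_ballP; exists h => //= s ts Ds; exact: hP.
Qed.

End metric_topology.

Lemma compact_separable {R : realType} (T : rootedMetricType R) :
  compact [set: T] -> separable T.
Proof.
rewrite compact_cover => cT.
have net n : exists D : {fset T}, forall x, exists2 c, c \in D & mdist c x < n.+1%:R^-1 :> R.
  have [|x _|D _ cD] := cT T setT (fun c => [set x | mdist c x < n.+1%:R^-1]).
  - move=> c _; apply: mdist_open => z /= cz; exists (n.+1%:R^-1 - mdist c z).
      by rewrite subr_gt0.
    move=> z' zz' /=; apply: le_lt_trans (metric_triangle c z z') _.
    by rewrite -ltrBrDl.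
  - by exists x => //=; rewrite mdistxx invr_gt0.
  - by exists D => x; have [c cDc cx] := cD x I; exists c.
have [D DP] := choice net.
exists (\bigcup_n [set` D n]); split.
  by apply: bigcup_countable => // n _; exact/finite_set_countable/finite_fset.
move=> O [x Ox] oO; have [e e0 xe] := open_mdist oO Ox.
have [n ne] : exists n, n.+1%:R^-1 < e :> R.
  by near \oo => n; exists n; near: n; exact: near_infty_natSinv_lt (PosNum e0).
have [c cD cx] := DP n x; exists c; split; last by exists n.
by apply: xe; rewrite metric_sym; exact: lt_trans cx ne.
Unshelve. all: by end_near. Qed.

Section zero_hyperbolic.
Context {R : realType} {T : metricType R}.
Implicit Types (x y z o : T) (f g : R -> T).

Definition four_point := forall x y z w : T,
  mdist x y + mdist z w <=
  Num.max (mdist x z + mdist y w) (mdist x w + mdist y z).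

(** Continuity and injectivity are left out, as the isometry property implies them. *)
Definition unit_speed x y f :=
  [/\ f 0 = x, f (mdist x y) = y &
      {in `[0, mdist x y] &, forall s t, mdist (f s) (f t) = `|s - t|}].

Lemma unit_speed_geodesic x y f : unit_speed x y f -> geodesic x y f.
Proof.
move=> [f0 f1 fi]; split=> //; split=> //; first exact: mdist_ge0.
  apply/within_continuous_mdist => t Dt e e0; exists e => // s Ds ts.
  by rewrite fi ?inE.
move=> s t sD tD fst; apply/eqP; rewrite -subr_eq0 -normr_eq0 -fi//.
by rewrite fst mdistxx.
Qed.

Lemma unit_speed_dist0 x y f s : unit_speed x y f -> 0 <= s <= mdist x y ->
  mdist x (f s) = s.
Proof.
move=> [<- _ fi] sD; rewrite fi ?sub0r ?normrN ?ger0_norm//; first by case/andP: sD.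
by rewrite in_itv/= lexx mdist_ge0.
Qed.

Lemma unit_speed_dist1 x y f s : unit_speed x y f -> 0 <= s <= mdist x y ->
  mdist y (f s) = mdist x y - s.
Proof.
move=> [_ f1 fi] sD; rewrite -{1}f1 fi.
- by rewrite ger0_norm// subr_ge0; case/andP: sD.
- by rewrite in_itv/= lexx mdist_ge0.
- by rewrite in_itv/=.
Qed.

Section projection.
Variables (x y : T) (f : R -> T).
Hypotheses (fp : four_point) (uf : unit_speed x y f).

(** In terms of Gromov products, [proj z] is (y|z) based at [x] and [excess z] is (x|y) based at
    [z]: the distance from [x] to the point where [z] branches off the segment, and the distance
    from [z] to the segment. *)
Definition proj z : R := (mdist x z + mdist x y - mdist y z) / 2.
Definition excess z : R := (mdist x z + mdist y z - mdist x y) / 2.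

Let le_max3 (a b c : R) : a <= Num.max b c -> a <= b \/ a <= c.
Proof. by rewrite le_max => /orP[]; [left|right]. Qed.

Lemma proj_itv z : 0 <= proj z <= mdist x y.
Proof.
rewrite /proj; have := metric_triangle x z y; have := metric_triangle y x z.
have := metric_triangle x y z; rewrite [mdist y x]metric_sym [mdist z y]metric_sym.
lra.
Qed.

Lemma excess_ge0 z : 0 <= excess z.
Proof.
by have := metric_triangle x z y; rewrite /excess [mdist z y]metric_sym; lra.
Qed.

Lemma excess_x : excess x = 0.
Proof. by rewrite /excess mdistxx [mdist y x]metric_sym; lra. Qed.

Lemma excess_y : excess y = 0.
Proof. by rewrite /excess mdistxx; lra. Qed.

Lemma proj_x : proj x = 0.
Proof. by rewrite /proj mdistxx [mdist y x]metric_sym; lra. Qed.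

Lemma proj_y : proj y = mdist x y.
Proof. by rewrite /proj mdistxx; lra. Qed.

Lemma excess0 z : excess z = 0 -> z = f (proj z).
Proof.
move=> z0; apply: mdist_positivity; apply/eqP; rewrite eq_le mdist_ge0 andbT.
have := unit_speed_dist0 uf (proj_itv z); have := unit_speed_dist1 uf (proj_itv z).
have := le_max3 (fp x y z (f (proj z))).
by move: z0; rewrite /excess /proj => z0 [|] *; lra.
Qed.

Lemma proj_locally_constant z z' : mdist z z' < excess z -> proj z' = proj z.
Proof.
move=> zz'; apply/eqP/negPn/negP; rewrite neq_lt.
have := metric_triangle x z z'; have := metric_triangle y z z'.
have := metric_triangle x z' z; have := metric_triangle y z' z.
have := le_max3 (fp x z' z y); have := le_max3 (fp x z z' y).
have := excess_ge0 z'; move: zz'.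
rewrite /excess /proj [mdist z y]metric_sym [mdist z' y]metric_sym.
rewrite [mdist z' z]metric_sym.
by move=> ? ? [?|?] [?|?] ? ? ? ? /orP[?|?]; lra.
Qed.

Lemma mdist_proj z z' : `|proj z - proj z'| <= mdist z z'.
Proof.
have := metric_triangle x z z'; have := metric_triangle y z z'.
have := metric_triangle x z' z; have := metric_triangle y z' z.
rewrite [mdist z' z]metric_sym /proj => *.
by rewrite ler_norml; apply/andP; split; lra.
Qed.

(* The part of [Q] that projects to [proj z] is closed in [Q], and it is open
   unless it meets the segment. *)
Lemma connected_proj (Q : set T) z e : connected Q -> Q z -> Q e ->
  excess e = 0 -> Q (f (proj z)).
Proof.
move=> cQ Qz Qe e0.
have [//|NQ] := pselect (Q (f (proj z))).
have pos z' : Q z' -> proj z' = proj z -> 0 < excess z'.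
  move=> Qz' zz'; rewrite lt_neqAle excess_ge0 andbT eq_sym.
  by apply/negP => /eqP/excess0; rewrite zz' => z'E; apply: NQ; rewrite -z'E.
suff QE : [set z' | Q z' /\ proj z' = proj z] = Q.
  move: (Qe); rewrite -QE => -[_ /pos] => /(_ Qe).
  by rewrite e0 ltxx.
apply: cQ; first by exists z.
- exists [set z' | proj z' = proj z /\ 0 < excess z'].
    apply: mdist_open => z' [z'z z'0]; exists (excess z') => // w zw.
    split; first by rewrite (proj_locally_constant zw).
    have := metric_triangle x w z'; have := metric_triangle y w z'.
    by move: zw; rewrite /excess [mdist w _]metric_sym; lra.
  apply/seteqP; split=> w /= [Qw]; last by case.
  by move=> wz; split => //; split => //; exact: pos.
- exists [set z' | proj z' = proj z]; last by [].
  rewrite -openC; apply: mdist_open => z' /= /eqP zz'.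
  exists `|proj z' - proj z|; first by rewrite normr_gt0 subr_eq0.
  by move=> w z'w wz; have := mdist_proj z' w; rewrite wz leNgt z'w.
Qed.

(** Cut at time [t], the path gives two connected sets, each joining [g t] to one end of the
    segment, so both contain [f (proj (g t))]. Injectivity makes the two passage times coincide,
    hence equal to [t]. *)
Lemma path_on_segment a g t : injective_path x y a g -> 0 <= t <= a ->
  g t = f (proj (g t)).
Proof.
move=> [a0 cg gi g0 ga] ta; have [t0 t1] := andP ta.
have sub u v : 0 <= u -> v <= a -> connected (g @` `[u, v]).
  move=> u0 va; apply: connected_continuous_connected.
    exact: segment_connected.
  apply: continuous_subspaceW cg => r /=; rewrite !in_itv/= => /andP[ur rv].
  by rewrite (le_trans u0)// (le_trans rv).
have [r1 r1P r1E] : (g @` `[0, t]) (f (proj (g t))).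
  apply: (@connected_proj _ (g t) x).
  - exact: sub.
  - by exists t => //=; rewrite in_itv/= t0 lexx.
  - by exists 0 => //=; rewrite in_itv/= t0 lexx.
  - exact: excess_x.
have [r2 r2P r2E] : (g @` `[t, a]) (f (proj (g t))).
  apply: (@connected_proj _ (g t) y).
  - exact: sub.
  - by exists t => //=; rewrite in_itv/= t1 lexx.
  - by exists a => //=; rewrite in_itv/= t1 lexx.
  - exact: excess_y.
move: r1P r2P; rewrite /= !in_itv/= => /andP[r10 r1t] /andP[tr2 r2a].
have r12 : r1 = r2.
  apply: gi; rewrite ?in_itv/= ?r10 ?r2a ?(le_trans r1t) ?(le_trans t0)//.
  by rewrite r1E r2E.
by rewrite -r1E; congr g; lra.
Qed.

Lemma path_reparametrises a g : injective_path x y a g ->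
  reparametrises a (mdist x y) g f.
Proof.
move=> ip; have [a0 cg gi g0 ga] := ip.
have cphi : {within `[0, a], continuous (proj \o g)}.
  apply/(@within_continuous_mdist R (R^o)).
  move=> t Dt e e0; move/within_continuous_mdist : cg => /(_ t Dt e e0)[h h0 hP].
  exists h => // s Ds ts; apply: le_lt_trans (hP s Ds ts).
  by rewrite [leLHS]distrC; exact: mdist_proj.
have gE t : t \in `[0, a] -> g t = f (proj (g t)).
  by rewrite in_itv/= => ta; exact: path_on_segment ip ta.
exists (proj \o g); split=> //=.
(* [proj \o g] is injective because [g] factors through it by [gE]; a continuous injection of an
   interval is monotone, and its end values give the direction. *)
- have mono : {in `[0, a] &, {mono proj \o g : s t / s <= t}}.
    apply: segment_continuous_inj_le => //=.
      by rewrite g0 ga proj_x proj_y mdist_ge0.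
    move=> s t sa ta /= st; apply: gi => //.
    by rewrite (gE _ sa) (gE _ ta) st.
  by move=> s t sa ta; rewrite (leW_mono_in mono).
- by rewrite g0 proj_x.
- by rewrite ga proj_y.
Qed.

End projection.

Section geodesics_from_root.
Variable o : T.
Hypotheses (fp : four_point) (ro : forall x, exists f, unit_speed o x f).

(** Descend from [x] to the branch point of [x] and [y], then climb to [y]. The height of the branch
    point is the Gromov product [c] of [x] and [y] based at [o]. *)
Lemma unit_speed_exists x y : exists f, unit_speed x y f.
Proof.
have [f uf] := ro x; have [g ug] := ro y.
pose a := mdist o x; pose b := mdist o y; pose D := mdist x y.
pose c := (a + b - D) / 2.
have c0 : 0 <= c.
  by rewrite /c /a /b /D; have := metric_triangle x o y; rewrite [mdist x o]metric_sym; lra.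
have ca : c <= a.
  by rewrite /c /a /b /D; have := metric_triangle o x y; lra.
have cb : c <= b.
  rewrite /c /a /b /D; have := metric_triangle o y x.
  by rewrite [mdist y x]metric_sym; lra.
(* The four-point condition is used twice: it bounds the distance from [f c] to [y] by [b - c], and
   with this bound the distance from [f c] to [g c] by 0. *)
have fgc : f c = g c.
  have fc0 := @unit_speed_dist0 _ _ _ c uf; have fc1 := @unit_speed_dist1 _ _ _ c uf.
  have gc0 := @unit_speed_dist0 _ _ _ c ug; have gc1 := @unit_speed_dist1 _ _ _ c ug.
  move: fc0 fc1 gc0 gc1; rewrite c0 ca cb.
  move=> /(_ isT) + /(_ isT) + /(_ isT) + /(_ isT).
  have := fp (f c) y o x; have := fp (f c) (g c) o y.
  rewrite !le_max [mdist (f c) o]metric_sym [mdist (f c) x]metric_sym.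
  rewrite [mdist (g c) o]metric_sym [mdist (g c) y]metric_sym.
  rewrite [mdist y x]metric_sym [mdist y o]metric_sym.
  rewrite -/a -/b -/D => H1 H2 ? ? ? ?; apply: mdist_positivity; apply/eqP.
  rewrite eq_le mdist_ge0 andbT.
  have cE : c + c = a + b - D by rewrite /c; lra.
  by move: H1 H2 => /orP[?|?] /orP[?|?]; lra.
have cross s t : c <= s <= a -> c <= t <= b ->
    mdist (f s) (g t) = (s - c) + (t - c).
  move=> /andP[cs sa] /andP[ct tb].
  have s0 : 0 <= s by exact: le_trans cs.
  have t0 : 0 <= t by exact: le_trans ct.
  have [_ _ fi] := uf; have [_ _ gi] := ug.
  have fsc : mdist (f s) (f c) = s - c.
    rewrite fi ?ger0_norm ?subr_ge0// in_itv/= -/a ?s0//.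
    by rewrite c0 ca.
  have gct : mdist (g c) (g t) = t - c.
    rewrite metric_sym gi ?ger0_norm ?subr_ge0// in_itv/= -/b ?t0//.
    by rewrite c0 cb.
  have fs1 := unit_speed_dist1 uf (_ : 0 <= s <= mdist o x).
  have gt1 := unit_speed_dist1 ug (_ : 0 <= t <= mdist o y).
  have := metric_triangle (f s) (f c) (g t); have := metric_triangle x (f s) y.
  have := metric_triangle (f s) (g t) y.
  rewrite fs1 ?s0// [mdist (g t) y]metric_sym gt1 ?t0// {2}fgc fsc gct -/a -/b -/D.
  have cE : c + c = a + b - D by rewrite /c; lra.
  by lra.
have cE : c + c = a + b - D by rewrite /c; lra.
exists (fun s => if s <= a - c then f (a - s) else g (s - a + c + c)).
have [f0 f1 fi] := uf; have [g0 g1 gi] := ug.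
split.
- by rewrite subr_ge0 ca subr0.
- rewrite -/D; case: ifPn => Dac; last by rewrite -g1; congr g; rewrite -/b; lra.
  have cb' : b = c by apply/eqP; rewrite eq_le cb andbT; lra.
  have -> : a - D = c by lra.
  by rewrite fgc -[in RHS]g1 -/b cb'.
- move=> s t; rewrite !in_itv/= -/D => /andP[s0 sD] /andP[t0 tD].
  case: ifPn => sac; case: ifPn => tac.
  + rewrite fi ?in_itv/= -/a; last 2 first.
      by apply/andP; split; lra.
      by apply/andP; split; lra.
    by rewrite distrC; congr `|_|; lra.
  + rewrite -ltNge in tac; rewrite cross; last 2 first.
      by apply/andP; split; lra.
      by apply/andP; split; lra.
    by rewrite distrC ger0_norm; lra.
  + rewrite -ltNge in sac; rewrite metric_sym cross; last 2 first.
      by apply/andP; split; lra.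
      by apply/andP; split; lra.
    by rewrite ger0_norm; lra.
  + rewrite -!ltNge in sac tac; rewrite gi ?in_itv/= -/b; last 2 first.
      by apply/andP; split; lra.
      by apply/andP; split; lra.
    by congr `|_|; lra.
Qed.

Lemma zero_hyperbolic_Rtree : separable T -> Rtree T.
Proof.
move=> sT; split=> // x y; have [f uf] := unit_speed_exists x y.
by exists f; split=> [|a g]; [exact: unit_speed_geodesic|exact: path_reparametrises].
Qed.

End geodesics_from_root.

(** The complement of [x] is a union of arcs with common end [o]. This detects leaves: a point other
    than the root that is on no geodesic from the root to another point is a leaf. *)
Lemma connected_setC1 o x : o <> x ->
  (forall y, y <> x -> exists2 f, unit_speed o y f &
    forall s, 0 <= s <= mdist o y -> f s <> x) ->
  connected (~` [set x]).
Proof.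
move=> ox h.
have /choice[f fP] : forall y, exists f, y <> x -> unit_speed o y f /\
    forall s, 0 <= s <= mdist o y -> f s <> x.
  move=> y; have [->|yx] := pselect (y = x); first by exists (fun=> x).
  by have [f ? ?] := h y yx; exists f.
have -> : ~` [set x] = \bigcup_(y in ~` [set x]) (f y @` `[0, mdist o y]).
  apply/seteqP; split=> [y yx|y [z zx [s sD <-]]].
    have [[_ f1 _] _] := fP y yx; exists y => //; exists (mdist o y) => //.
    by rewrite /= in_itv/= lexx mdist_ge0.
  have [_ fx] := fP z zx; apply: fx.
  by move: sD; rewrite /= in_itv.
apply: bigcup_connected => [|y yx].
  exists o => y yx; have [[f0 _ _] _] := fP y yx; exists 0 => //.
  by rewrite /= in_itv/= lexx mdist_ge0.
have [uf _] := fP y yx; have [[_ cf _ _ _] _] := unit_speed_geodesic uf.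
exact: connected_continuous_connected (@segment_connected _ _ _) cf.
Qed.

End zero_hyperbolic.
Arguments four_point {R} T.

(** * Trees encoded by heights along the branches *)

Section words.
Implicit Types u v w : seq nat.

(** Words are read from right to left, so ancestors are suffixes, and two incomparable words split
    just above a common suffix. *)
Lemma words_fork u v : suffix u v \/ suffix v u \/
  exists w i j s s', [/\ i != j, u = s ++ i :: w & v = s' ++ j :: w].
Proof.
have prefix_fork p q : prefix p q \/ prefix q p \/
    exists w (i j : nat) s s', [/\ i != j, p = w ++ i :: s & q = w ++ j :: s'].
  elim: p q => [|i p IH] [|j q]; [by left|by left|by right; left|].
  have [<-|ij] := eqVneq i j; last first.
    by right; right; exists [::], i, j, p, q.
  rewrite /= eqxx /=; have [?|[?|[w [a [b [s [s' [ab -> ->]]]]]]]] := IH q.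
  - by left.
  - by right; left.
  - by right; right; exists (i :: w), a, b, s, s'.
have [?|[?|[w [i [j [s [s' [ij uE vE]]]]]]]] := prefix_fork (rev u) (rev v).
- by left.
- by right; left.
right; right; exists (rev w), i, j, (rev s), (rev s'); split => //.
  by apply: (can_inj revK); rewrite uE rev_cat rev_cons !revK -cats1 -catA.
by apply: (can_inj revK); rewrite vE rev_cat rev_cons !revK -cats1 -catA.
Qed.

Definition proper_suffixes u := [seq drop k u | k <- iota 1 (size u)].

Lemma proper_suffixes_uniq u : uniq (proper_suffixes u).
Proof.
have inj (k l : nat) : (0 < k < 1 + size u)%N -> (0 < l < 1 + size u)%N ->
    drop k u = drop l u -> k = l.
  by move=> kP lP /(congr1 size); rewrite !size_drop; lia.
by rewrite map_inj_in_uniq ?iota_uniq// => k l; rewrite !mem_iota; exact: inj.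
Qed.

Lemma proper_suffixesP v u :
  reflect (exists s i, u = s ++ i :: v) (v \in proper_suffixes u).
Proof.
apply: (iffP mapP) => [[k]|[s [i ->]]].
  rewrite mem_iota => kP ->.
  exists (take k.-1 u), (nth 0%N u k.-1).
  case: k kP => //= k kP; rewrite -drop_nth ?cat_take_drop//; lia.
exists (size s).+1; first by rewrite mem_iota size_cat/=; lia.
by rewrite -cat_rcons drop_size_cat// size_rcons.
Qed.

Lemma suffix_proper v u : suffix v u -> v != u -> v \in proper_suffixes u.
Proof.
move=> /suffixP[s uE] vu; apply/proper_suffixesP; move: vu; rewrite uE.
elim/last_ind: s {uE} => [|s i _]; first by rewrite eqxx.
by move=> _; exists s, i; rewrite cat_rcons.
Qed.

Lemma size_proper_suffix v u : v \in proper_suffixes u -> (size v < size u)%N.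
Proof. by move=> /proper_suffixesP[s [i ->]]; rewrite size_cat/=; lia. Qed.

Lemma proper_suffixes_trans w v u : w \in proper_suffixes v ->
  v \in proper_suffixes u -> w \in proper_suffixes u.
Proof.
move=> /proper_suffixesP[s [i ->]] /proper_suffixesP[s' [j ->]].
by apply/proper_suffixesP; exists (s' ++ j :: s), i; rewrite -catA.
Qed.

Lemma proper_suffixes_cat s i u : u \in proper_suffixes (s ++ i :: u).
Proof. by apply/proper_suffixesP; exists s, i. Qed.

Lemma seq_max_size (J : seq (seq nat)) : J != [::] ->
  exists2 u, u \in J & forall v, v \in J -> (size v <= size u)%N.
Proof.
elim: J => // u J IH _; have [->|/IH[w wJ wP]] := eqVneq J [::].
  by exists u; rewrite ?mem_head// => v; rewrite inE => /eqP ->.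
have [uw|wu] := leqP (size u) (size w).
  exists w; first by rewrite inE wJ orbT.
  by move=> v; rewrite inE => /predU1P[->|/wP].
exists u; first by rewrite mem_head.
move=> v; rewrite inE => /predU1P[->//|/wP vw].
by apply: leq_trans vw (ltnW _).
Qed.

Lemma seq_min_size (J : seq (seq nat)) : J != [::] ->
  exists2 u, u \in J & forall v, v \in J -> (size u <= size v)%N.
Proof.
elim: J => // u J IH _; have [->|/IH[w wJ wP]] := eqVneq J [::].
  by exists u; rewrite ?mem_head// => v; rewrite inE => /eqP ->.
have [wu|uw] := leqP (size w) (size u).
  exists w; first by rewrite inE wJ orbT.
  by move=> v; rewrite inE => /predU1P[->|/wP].
exists u; first by rewrite mem_head.
move=> v; rewrite inE => /predU1P[->//|/wP vw].
by apply: leq_trans (ltnW _) vw.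
Qed.

End words.

Lemma ler_sum_subset {R : realType} {U : eqType} (f : U -> R) (J J' : seq U) :
  uniq J -> uniq J' -> {subset J <= J'} -> (forall u, 0 <= f u) ->
  \sum_(u <- J) f u <= \sum_(u <- J') f u.
Proof.
move=> uJ uJ' JJ' f0.
rewrite [leRHS](bigID (mem J))/= -[leLHS]addr0 lerD ?sumr_ge0//.
rewrite (perm_big [seq u <- J' | u \in J])/= ?big_filter//.
apply: uniq_perm; rewrite ?filter_uniq// => u; rewrite mem_filter.
by apply/idP/andP => [uJ''|[]//]; split=> //; exact: JJ'.
Qed.

Lemma geometric_sum_le {R : realType} (rho : R) (J : seq nat) : 0 < rho < 1 -> uniq J ->
  \sum_(n <- J) rho ^+ n <= (1 - rho)^-1.
Proof.
move=> /andP[r0 r1] uJ.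
pose N := (\max_(n <- J) n).+1.
apply: (@le_trans _ _ (\sum_(n <- iota 0 N) rho ^+ n)).
  apply: ler_sum_subset; rewrite ?iota_uniq//; last by move=> n; rewrite exprn_ge0// ltW.
  by move=> n nJ; rewrite mem_iota/= add0n ltnS; exact: leq_bigmax_seq.
have -> : \sum_(n <- iota 0 N) rho ^+ n = (1 - rho ^+ N) / (1 - rho).
  apply: (canRL (mulfK _)); first by rewrite subr_eq0 gt_eqF.
  rewrite -[in iota 0 N](subn0 N) -/(index_iota 0 N) big_mkord.
  by rewrite -[RHS]opprB subrX1 -mulNr opprB mulrC.
rewrite ler_piMl ?invr_ge0 ?subr_ge0 ?(ltW r1)//.
by rewrite lerBlDr lerDl exprn_ge0// ltW.
Qed.

Section word_trees.
Context {R : realType}.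
Implicit Types (len : seq nat -> R) (pos : seq nat -> nat -> R) (f g : seq nat -> R).

(* A point of the tree is encoded by the heights at which the geodesic from the
   root to it runs along each of the attached segments, so that the tree metric
   is the l1 distance; [len u] is the length of the segment of the word [u] and
   [pos u i] the height at which the segment of [i :: u] is attached to it. *)
Definition word_tree len pos f : Prop :=
  (forall u, 0 <= f u <= len u) /\
  (forall s i u, f (s ++ i :: u) != 0 -> f u = pos u i).

(** Distinct branches leave a segment at distinct heights. Only branches that carry some length
    count: on a segment of mass 0 all attachment heights are 0. *)
Definition separating len pos : Prop := forall u i j s s',
  0 < len (s ++ i :: u) -> 0 < len (s' ++ j :: u) -> pos u i = pos u j -> i = j.

(** The code enumerates the words, so the bound holds for all but finitely many of them. The power
    of [rho] makes it summable along a branch, and the arbitrary [e] makes the sum small. *)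
Definition decaying (rho : R) len : Prop :=
  0 < rho < 1 /\ forall e, 0 < e ->
    exists K, forall u, (K <= CodeSeq.code u)%N -> len u <= e * rho ^+ size u.

Section one_tree.
Variables (len : seq nat -> R) (pos : seq nat -> nat -> R) (rho : R).
Hypotheses (sep : separating len pos) (dec : decaying rho len).
Local Notation W := (word_tree len pos).

Lemma word_tree_ge0 f u : W f -> 0 <= f u.
Proof. by move=> [fP _]; case/andP: (fP u). Qed.

(** The support is a chain: if two of its words forked above [w], both branches would be attached at
    the same height [f w], against separation. *)
Lemma word_tree_comparable f u v : W f -> 0 < f u -> 0 < f v ->
  suffix u v \/ suffix v u.
Proof.
move=> [fl fp] fu fv.
have [|[|[w [i [j [s [s' [ij uE vE]]]]]]]] := words_fork u v; [by left|by right|].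
have lenp z : 0 < f z -> 0 < len z.
  by move=> /lt_le_trans; apply; case/andP: (fl z).
exfalso; move/eqP : ij; apply; apply: (@sep w i j s s').
- by rewrite -uE lenp.
- by rewrite -vE lenp.
- rewrite -(fp s i w) -?(fp s' j w)//; first by rewrite -vE gt_eqF.
  by rewrite -uE gt_eqF.
Qed.

Lemma word_tree_lt_size f u v : W f -> 0 < f u -> 0 < f v ->
  (size v <= size u)%N -> v != u -> v \in proper_suffixes u.
Proof.
move=> Wf fu fv vu nvu; have [uv|vsu] := word_tree_comparable Wf fu fv.
  by have := size_suffix uv => uv'; have := suffix_proper uv;
    rewrite eq_sym nvu => /(_ isT)/size_proper_suffix; lia.
exact: suffix_proper.
Qed.

(** Words of the support are comparable, so they have distinct sizes and the sum is dominated by a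
    geometric series. The bound does not depend on [f]. *)
Lemma word_tree_tail f (A : pred (seq nat)) e : W f -> 0 <= e ->
  (forall u, A u -> len u <= e * rho ^+ size u) ->
  summable0 (fun u => if A u then f u else 0) /\
  nsum (fun u => if A u then f u else 0) <= e / (1 - rho).
Proof.
move=> Wf e0 Ae; have [/andP[r0 r1] _] := dec.
apply: nsum_ub => [u|J uJ Jpos]; first by case: ifP => // _; exact: word_tree_ge0.
apply: (@le_trans _ _ (\sum_(u <- J) e * rho ^+ size u)).
  rewrite big_seq [leRHS]big_seq; apply: ler_sum => u /Jpos; case: ifP.
    by move=> Au _; apply: le_trans (Ae _ Au); case: Wf => /(_ u)/andP[].
  by rewrite ltxx.
rewrite -mulr_sumr ler_wpM2l// -(big_map size xpredT (fun n => rho ^+ n)).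
apply: geometric_sum_le; first by rewrite r0.
rewrite map_inj_in_uniq// => u v uJ' vJ' uv.
have fpos w : w \in J -> 0 < f w by move=> /Jpos; case: ifP => //; rewrite ltxx.
apply/eqP/negPn/negP => nuv.
have := word_tree_lt_size Wf (fpos _ vJ') (fpos _ uJ'); rewrite uv.
by move=> /(_ (leqnn _) nuv)/size_proper_suffix; rewrite uv ltnn.
Qed.

Lemma word_tree_summable f : W f -> summable0 f.
Proof.
move=> Wf; have [_ /(_ 1 ltr01)[K KP]] := dec.
have [S1 _] := @word_tree_tail f (fun u => (K <= CodeSeq.code u)%N) 1 Wf ler01 KP.
have [S2 _] : summable0 (fun u => if (CodeSeq.code u < K)%N then f u else 0) /\
    nsum (fun u => if (CodeSeq.code u < K)%N then f u else 0) =
    \sum_(u <- [seq CodeSeq.decode k | k <- iota 0 K])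
      (if (CodeSeq.code u < K)%N then f u else 0).
  apply: nsum_finite_support.
  - rewrite map_inj_in_uniq ?iota_uniq// => k l _ _ /(congr1 CodeSeq.code).
    by rewrite !CodeSeq.decodeK.
  - by move=> u; case: ifP => // _; exact: word_tree_ge0.
  - move=> u /mapP uK; case: ifP => // uK'; exfalso; apply: uK.
    by exists (CodeSeq.code u); rewrite ?mem_iota// CodeSeq.codeK.
have -> : f = (fun u => if (K <= CodeSeq.code u)%N then f u else 0) \+
    (fun u => if (CodeSeq.code u < K)%N then f u else 0).
  by apply/funext => u /=; case: leqP; rewrite ?addr0 ?add0r.
exact: summable0D.
Qed.

(** Encodes the point where the geodesics from the root to [f] and to [g] separate. *)
Definition meet f g := fun u => Num.min (f u) (g u).

Lemma summable_meet f g : W f -> W g -> summable0 (meet f g).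
Proof.
move=> Wf Wg; apply: summable0_le (word_tree_summable Wf) => u.
by rewrite /meet le_min !word_tree_ge0//= ge_min lexx.
Qed.

(* Both meets are initial segments of the geodesic from the root to [g]. *)
Lemma meet_comparable f g h : W f -> W g -> W h ->
  (forall u, meet f g u <= meet g h u) \/ (forall u, meet g h u <= meet f g u).
Proof.
move=> Wf Wg Wh; apply: contrapT => /not_orP[/existsNP[u /negP fgu] /existsNP[v /negP fgv]].
move: fgu fgv; rewrite -!ltNge /meet => fgu fgv.
have gu : 0 < g u.
  apply: (@le_lt_trans _ _ (Num.min (g u) (h u))); first by rewrite le_min !word_tree_ge0.
  by apply: lt_le_trans fgu _; rewrite ge_min lexx orbT.
have fu : 0 < f u.
  apply: (@le_lt_trans _ _ (Num.min (g u) (h u))); first by rewrite le_min !word_tree_ge0.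
  by apply: lt_le_trans fgu _; rewrite ge_min lexx.
have gv : 0 < g v.
  apply: (@le_lt_trans _ _ (Num.min (f v) (g v))); first by rewrite le_min !word_tree_ge0.
  by apply: lt_le_trans fgv _; rewrite ge_min lexx.
have hv : 0 < h v.
  apply: (@le_lt_trans _ _ (Num.min (f v) (g v))); first by rewrite le_min !word_tree_ge0.
  by apply: lt_le_trans fgv _; rewrite ge_min lexx orbT.
have [uv|nuv] := eqVneq u v; first by move: fgv; rewrite -uv ltNge (ltW fgu).
have [/suffix_proper|/suffix_proper] := word_tree_comparable Wg gu gv.
  move=> /(_ nuv)/proper_suffixesP[s [i vE]].
  have [[_ gp] [_ hp]] := (Wg, Wh).
  move: fgu; rewrite (gp s i u) -?vE ?gt_eqF// (hp s i u) -?vE ?gt_eqF//.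
  by rewrite minxx ltNge ge_min lexx orbT.
rewrite eq_sym => /(_ nuv)/proper_suffixesP[s [i uE]].
have [[_ gp] [_ fp]] := (Wg, Wf).
move: fgv; rewrite (gp s i v) -?uE ?gt_eqF// (fp s i v) -?uE ?gt_eqF//.
by rewrite minxx ltNge ge_min lexx.
Qed.

(** [nsum (meet f g)] is the Gromov product of [f] and [g] based at the root, and this is its
    ultrametric inequality, from which the four-point condition follows by arithmetic. *)
Lemma nsum_meet_triple f g h : W f -> W g -> W h ->
  nsum (meet f g) <= nsum (meet f h) \/ nsum (meet g h) <= nsum (meet f h).
Proof.
move=> Wf Wg Wh; have [fg|gh] := meet_comparable Wf Wg Wh; [left|right].
  apply: nsum_le (summable_meet Wf Wh) => u; have := fg u.
  rewrite /meet => fgu; rewrite le_min !word_tree_ge0//= le_min ge_min lexx/=.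
  by apply: le_trans fgu _; rewrite ge_min lexx orbT.
apply: nsum_le (summable_meet Wf Wh) => u; have := gh u.
rewrite /meet => ghu; rewrite le_min !word_tree_ge0//=.
rewrite le_min [X in _ && X]ge_min lexx orbT andbT.
by apply: le_trans ghu _; rewrite ge_min lexx.
Qed.

Lemma summable_norm_dist f g : W f -> W g -> summable0 (fun u => `|f u - g u|).
Proof.
move=> Wf Wg; have Sf := word_tree_summable Wf; have Sg := word_tree_summable Wg.
apply: (summable0_le _ (summable0D Sf Sg)) => u /=.
rewrite normr_ge0/= (le_trans (ler_normB _ _))//.
by rewrite !ger0_norm ?word_tree_ge0.
Qed.

Lemma nsum_dist_meet f g : W f -> W g ->
  nsum (fun u => `|f u - g u|) = nsum f + nsum g - 2 * nsum (meet f g).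
Proof.
move=> Wf Wg; have Sf := word_tree_summable Wf; have Sg := word_tree_summable Wg.
have Sm := summable_meet Wf Wg.
have Sd := summable_norm_dist Wf Wg.
have := nsumD Sd (summable0D Sm Sm); have := nsumD Sf Sg; have := nsumD Sm Sm.
suff -> : (fun u => `|f u - g u|) \+ (meet f g \+ meet f g) = f \+ g by lra.
apply/funext => u /=; rewrite /meet.
by have [fg|gf] := lerP (f u) (g u); lra.
Qed.

Lemma word_tree_four_point f g h k : W f -> W g -> W h -> W k ->
  let d f g := nsum (fun u => `|f u - g u|) in
  d f g + d h k <= Num.max (d f h + d g k) (d f k + d g h).
Proof.
move=> Wf Wg Wh Wk /=.
have meetC a b : meet a b = meet b a by apply/funext => u; rewrite /meet minC.
have := nsum_meet_triple Wf Wh Wg; have := nsum_meet_triple Wf Wk Wg.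
have := nsum_meet_triple Wh Wf Wk; have := nsum_meet_triple Wh Wg Wk.
rewrite !nsum_dist_meet// le_max.
rewrite (meetC h g) (meetC h f) (meetC k g).
by move=> [?|?] [?|?] [?|?] [?|?]; apply/orP; 
  (have [?|?] := lerP (nsum (meet f g) + nsum (meet h k))
                      (nsum (meet f h) + nsum (meet g k))); 
  solve [left; lra | right; lra].
Qed.

End one_tree.
End word_trees.

Lemma nsum_dist_split {R : realType} (U : choiceType) (f g : U -> R)
    (J : seq U) (a b : R) : uniq J ->
  (forall u, 0 <= f u) -> (forall u, 0 <= g u) ->
  summable0 f -> summable0 g ->
  nsum (fun u => if u \notin J then f u else 0) <= a ->
  nsum (fun u => if u \notin J then g u else 0) <= b ->
  nsum (fun u => `|f u - g u|) <= \sum_(u <- J) `|f u - g u| + (a + b).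
Proof.
move=> uJ f0 g0 Sf Sg fa gb.
have Sc (h : U -> R) (A : pred U) : (forall u, 0 <= h u) -> summable0 h ->
    summable0 (fun u => if A u then h u else 0).
  by move=> h0 Sh; apply: summable0_le Sh => u; case: ifP; rewrite ?lexx ?h0.
pose h u := if u \in J then `|f u - g u| else 0.
have [Sh hE] : summable0 h /\ nsum h = \sum_(u <- J) h u.
  apply: nsum_finite_support => // [u|u /negbTE]; rewrite /h; first by case: ifP.
  by move=> ->.
have -> : \sum_(u <- J) `|f u - g u| = nsum h.
  by rewrite hE big_seq [RHS]big_seq; apply: eq_bigr => u uJ'; rewrite /h uJ'.
have Sfg : summable0 ((fun u => if u \notin J then f u else 0) \+
    (fun u => if u \notin J then g u else 0)) by apply: summable0D; exact: Sc.
apply: (@le_trans _ _ (nsum h + (nsum (fun u => if u \notin J then f u else 0) +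
    nsum (fun u => if u \notin J then g u else 0)))); last by rewrite !lerD.
rewrite -!nsumD//; try exact: Sc.
apply: nsum_le => [u|]; last exact: summable0D.
rewrite normr_ge0/= /h; case: ifPn => uJ' /=; first by rewrite !addr0.
by rewrite add0r (le_trans (ler_normB _ _))// !ger0_norm.
Qed.

(** * Geodesics from the root *)

Section initial_segments.
Context {R : realType}.
Variables (len : seq nat -> R) (pos : seq nat -> nat -> R) (rho : R).
Hypotheses (sep : separating len pos) (dec : decaying rho len).
Local Notation W := (word_tree len pos).
Implicit Types (f g : seq nat -> R).

Definition base f u : R := \sum_(v <- proper_suffixes u) f v.

(** The point at distance [t] from the root on the geodesic to [f]: for [u] on the branch of [f],
    the geodesic enters the segment of [u] at distance [base f u] and runs along it for [f u]. *)
Definition initial f (t : R) u : R := Num.min (f u) (Num.max 0 (t - base f u)).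

Lemma base_cons f u :
  base f u + f u = \sum_(v <- u :: proper_suffixes u) f v.
Proof. by rewrite big_cons addrC. Qed.

Lemma base_le f u v : W f -> u \in proper_suffixes v ->
  base f u + f u <= base f v.
Proof.
move=> Wf uv; rewrite base_cons; apply: ler_sum_subset.
- rewrite /= proper_suffixes_uniq andbT; apply/negP => /size_proper_suffix.
  by rewrite ltnn.
- exact: proper_suffixes_uniq.
- move=> w; rewrite inE => /predU1P[->//|wu]; exact: proper_suffixes_trans uv.
- by move=> w; exact: word_tree_ge0 Wf.
Qed.

Lemma base_ge0 f u : W f -> 0 <= base f u.
Proof. by move=> Wf; apply: sumr_ge0 => v _; exact: word_tree_ge0 Wf. Qed.

Lemma initial_itv f t u : W f -> 0 <= initial f t u <= f u.
Proof.
by move=> Wf; rewrite /initial le_min (word_tree_ge0 _ Wf) le_max lexx ge_min lexx.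
Qed.

Lemma initial_gt0 f t u : W f -> 0 < initial f t u -> 0 < f u /\ base f u < t.
Proof.
move=> Wf; rewrite /initial lt_min lt_max ltxx/= subr_gt0 => /andP[]; split => //.
Qed.

Lemma initial_full f t u : base f u + f u <= t -> initial f t u = f u.
Proof.
move=> h; apply/min_idPl; rewrite le_max; apply/orP; right; lra.
Qed.

Lemma initial_mono f s t u : s <= t -> initial f s u <= initial f t u.
Proof.
move=> st; rewrite /initial le_min ge_min lexx/= ge_min; apply/orP; right.
by rewrite ge_max le_max lexx/= le_max lerD2r st orbT.
Qed.

Lemma word_tree_initial f t : W f -> W (initial f t).
Proof.
move=> Wf; have [fl fp] := Wf; split=> [u|s i u].
  have /andP[-> /le_trans->//] := initial_itv t u Wf.
  by case/andP: (fl u).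
move=> h; have [fv vt] : 0 < f (s ++ i :: u) /\ base f (s ++ i :: u) < t.
  apply: initial_gt0 => //; rewrite lt_neqAle eq_sym h.
  by case/andP: (initial_itv t (s ++ i :: u) Wf).
rewrite initial_full; first by apply: (fp s); rewrite gt_eqF.
apply: le_trans (ltW vt); apply: base_le => //; exact: proper_suffixes_cat.
Qed.

Lemma base_nsum_le f u : W f -> base f u + f u <= nsum f.
Proof.
move=> Wf; rewrite base_cons; apply: nsum_ge.
  exact: (word_tree_summable sep dec).
rewrite /= proper_suffixes_uniq andbT; apply/negP => /size_proper_suffix.
by rewrite ltnn.
Qed.

Lemma initial_nsum f : W f -> initial f (nsum f) = f.
Proof.
by move=> Wf; apply/funext => u; apply: initial_full; exact: base_nsum_le.
Qed.

Lemma initial0 f : W f -> initial f 0 = fun=> 0.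
Proof.
move=> Wf; apply/funext => u; rewrite /initial max_l; last first.
  by rewrite sub0r oppr_le0 base_ge0.
by apply/min_idPr; exact: word_tree_ge0 Wf.
Qed.

(** Read off at the longest word [u] of a list in the support: the clamp leaves at most
    [t - base f u] there, and the other words are proper suffixes of [u], whose heights add up to at
    most [base f u]. *)
Lemma nsum_initial_le f t : W f -> 0 <= t -> nsum (initial f t) <= t.
Proof.
move=> Wf t0; suff [] : summable0 (initial f t) /\ nsum (initial f t) <= t by [].
apply: nsum_ub => [u|J uJ Jpos]; first by case/andP: (initial_itv t u Wf).
have [->|J0] := eqVneq J [::]; first by rewrite big_nil.
have [u uJ' umax] := seq_max_size J0.
rewrite (big_rem u)//=; have [fu ut] := initial_gt0 Wf (Jpos _ uJ').
apply: (@le_trans _ _ ((t - base f u) + base f u)); last by rewrite subrK.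
apply: lerD; first by rewrite /initial ge_min ge_max lexx subr_ge0 (ltW ut) orbT.
apply: (@le_trans _ _ (\sum_(v <- rem u J) f v)).
  by apply: ler_sum => v _; case/andP: (initial_itv t v Wf).
apply: ler_sum_subset; rewrite ?rem_uniq ?proper_suffixes_uniq//.
  move=> v; rewrite mem_rem_uniq// inE => /andP[vu vJ].
  have [fv _] := initial_gt0 Wf (Jpos _ vJ).
  by apply: (word_tree_lt_size sep Wf) => //; exact: umax.
by move=> v; exact: word_tree_ge0 Wf.
Qed.

(** Read off at the shortest word [u] on which something is cut: at least [t - base f u] is kept
    there, and the other words of the list are not among [u] and its proper suffixes, so [nsum f]
    bounds all these heights together. *)
Lemma nsum_sub_initial_le f t : W f -> 0 <= t <= nsum f ->
  nsum (fun u => f u - initial f t u) <= nsum f - t.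
Proof.
move=> Wf /andP[t0 tf].
suff [] : summable0 (fun u => f u - initial f t u) /\
  nsum (fun u => f u - initial f t u) <= nsum f - t by [].
apply: nsum_ub => [u|J uJ Jpos].
  by rewrite subr_ge0; case/andP: (initial_itv t u Wf).
have [->|J0] := eqVneq J [::]; first by rewrite big_nil subr_ge0.
have [u uJ' umin] := seq_min_size J0.
rewrite (big_rem u)//=.
have tu : t - base f u <= initial f t u.
  have := Jpos _ uJ'; rewrite subr_gt0 /initial gt_min ltxx/= => h.
  by rewrite le_min le_max lexx orbT andbT; apply: ltW (le_lt_trans _ h); rewrite le_max lexx orbT.
have le2 : \sum_(v <- rem u J) (f v - initial f t v) <= \sum_(v <- rem u J) f v.
  by apply: ler_sum => v _; rewrite gerBl; case/andP: (initial_itv t v Wf).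
have : \sum_(v <- u :: proper_suffixes u ++ rem u J) f v <= nsum f.
  apply: nsum_ge; first exact: (word_tree_summable sep dec).
  rewrite cons_uniq cat_uniq proper_suffixes_uniq rem_uniq// mem_cat negb_or.
  have nu : u \notin proper_suffixes u.
    by apply/negP => /size_proper_suffix; rewrite ltnn.
  rewrite nu/= mem_rem_uniq// inE eqxx/= andbT; apply/hasPn => v.
  rewrite mem_rem_uniq// inE => /andP[_ /umin uv].
  by apply/negP => /size_proper_suffix; rewrite ltnNge uv.
rewrite big_cons big_cat/= -/(base f u).
by move: tu le2; set S1 := \sum_(v <- _) _; set S2 := \sum_(v <- _) _; lra.
Qed.

Lemma nsum_initial f t : W f -> 0 <= t <= nsum f -> nsum (initial f t) = t.
Proof.
move=> Wf tf; have t0 : 0 <= t by case/andP: tf.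
have Sf := word_tree_summable sep dec Wf.
have := nsum_initial_le Wf t0; have := nsum_sub_initial_le Wf tf.
suff : nsum f = nsum (initial f t) + nsum (fun u => f u - initial f t u) by lra.
rewrite -nsumD; first by congr nsum; apply/funext => u /=; lra.
  by apply: summable0_le Sf => u; exact: initial_itv.
by apply: summable0_le Sf => u; have /andP[i0 i1] := initial_itv t u Wf; lra.
Qed.

Lemma nsum_initial_dist f s t : W f -> 0 <= s <= nsum f -> 0 <= t <= nsum f ->
  nsum (fun u => `|initial f s u - initial f t u|) = `|s - t|.
Proof.
move=> Wf; wlog st : s t / s <= t => [H sf tf|sf tf].
  have [/H->//|/ltW/H h] := leP s t; rewrite distrC -h//; congr nsum.
  by apply/funext => u; rewrite distrC.
have Wt := word_tree_initial t Wf.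
have St := word_tree_summable sep dec Wt.
rewrite distrC ger0_norm ?subr_ge0// -[in RHS](nsum_initial Wf tf).
rewrite -[in RHS](nsum_initial Wf sf); apply/eqP; rewrite eq_sym subr_eq -nsumD.
- apply/eqP; congr nsum; apply/funext => u /=.
  by rewrite distrC ger0_norm ?subrK// subr_ge0 initial_mono.
- apply: summable0_le St => u; have := initial_mono f u st.
  have /andP[] := initial_itv s u Wf; rewrite distrC normr_ge0/= => *.
  by rewrite ger0_norm ?subr_ge0//; lra.
- apply: summable0_le St => u; rewrite initial_mono// andbT.
  by case/andP: (initial_itv s u Wf).
Qed.

(* [f] is below [g] if they branch on the segment of [u], on which [f] stops. *)
Lemma initialP f g u : W f -> W g -> 0 < g u -> f u <= g u ->
  (forall v, v \in proper_suffixes u -> f v = g v) ->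
  (forall v, v != u -> v \notin proper_suffixes u -> f v = 0) ->
  f = initial g (base g u + f u).
Proof.
move=> Wf Wg gu fgu fv f0; apply/funext => v.
have [->|vu] := eqVneq v u.
  rewrite /initial addrAC subrr add0r max_r ?(word_tree_ge0 _ Wf)//.
  by rewrite min_r.
have [vsu|vsu] := boolP (v \in proper_suffixes u).
  rewrite fv// initial_full//; apply: le_trans (base_le Wg vsu) _.
  by rewrite lerDl (word_tree_ge0 _ Wf).
rewrite f0//; apply/eqP; rewrite eq_le; have /andP[-> _] /= := initial_itv (base g u + f u) v Wg.
rewrite leNgt; apply/negP => /(initial_gt0 Wg)[gv]; apply/negP; rewrite -leNgt.
have [sz|sz] := leqP (size v) (size u).
  by have := word_tree_lt_size sep Wg gu gv sz vu; rewrite (negbTE vsu).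
have uv : u != v by rewrite eq_sym.
have /(base_le Wg) := word_tree_lt_size sep Wg gv gu (ltnW sz) uv.
by apply: le_trans; rewrite lerD2l.
Qed.

End initial_segments.

(** * Spaces identified with the set of height functions *)

Section embedded_tree.
Context {R : realType} {X : rootedMetricType R}.
Variables (len : seq nat -> R) (pos : seq nat -> nat -> R) (rho : R).
Hypotheses (sep : separating len pos) (dec : decaying rho len).
Local Notation W := (word_tree len pos).
Variable iota : X -> seq nat -> R.
Hypotheses (iota_dist : forall x y,
              mdist x y = nsum (fun u => `|iota x u - iota y u|))
           (iotaW : forall x, W (iota x))
           (iota_surj : forall f, W f -> exists x, iota x = f)
           (iota_root : iota (Defs.root X) = fun=> 0).

Lemma embedded_four_point : four_point X.
Proof.
by move=> x y z w; rewrite !iota_dist; exact: (word_tree_four_point sep dec).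
Qed.

Lemma iota_inj : injective iota.
Proof.
move=> x y xy; apply: mdist_positivity; rewrite iota_dist xy.
have [] := @nsum_finite_support R _ (fun u => `|iota y u - iota y u|) [::] => //.
  by move=> u _; rewrite subrr normr0.
by rewrite big_nil.
Qed.

Lemma mdist_root x : mdist (Defs.root X) x = nsum (iota x).
Proof.
rewrite iota_dist iota_root; congr nsum; apply/funext => u.
by rewrite sub0r normrN ger0_norm// (word_tree_ge0 _ (iotaW x)).
Qed.

Lemma embedded_unit_speed x : exists2 f, unit_speed (Defs.root X) x f &
  forall t, 0 <= t <= mdist (Defs.root X) x -> iota (f t) = initial (iota x) t.
Proof.
have ex t : exists y, iota y = initial (iota x) t.
  by apply: iota_surj; exact: word_tree_initial.
have [f fP] := choice ex.
exists f => //; split.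
- by apply: iota_inj; rewrite fP (initial0 (iotaW x)) iota_root.
- by apply: iota_inj; rewrite fP mdist_root (initial_nsum sep dec (iotaW x)).
- move=> s t; rewrite !in_itv/= mdist_root => sx tx.
  by rewrite iota_dist !fP (nsum_initial_dist sep dec (iotaW x)).
Qed.

(** Along an ultrafilter every coordinate converges in the compact interval [[0, len u]]. The
    pointwise limit is again a height function, and the uniform tail bound upgrades pointwise
    convergence to convergence in l1. *)
Lemma embedded_compact : compact [set: X].
Proof.
rewrite compact_ultra => F UF _.
have ex u : exists y : R, (fun x => iota x u) @ F --> y.
  have : compact `[0 : R, len u]%classic by exact: segment_compact.
  move=> /(_ ((fun x => iota x u) @ F)) [].
  - suff : F [set x | `[0 : R, len u]%classic (iota x u)] by [].
    by apply: (filterS _ (@filterT _ F _)) => x _ /=; rewrite in_itv/=;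
      have [] := iotaW x.
  - move=> z [_ zP]; exists z => B zB.
    have [//|nB] := in_ultra_setVsetC ((fun x => iota x u) @^-1` B) UF.
    by have [w []] := zP (~` B) B nB zB.
have [y yP] := choice ex.
have near_y u e : 0 < e -> \forall x \near F, `|y u - iota x u| < e.
  by move=> e0; have /cvgrPdist_lt := yP u; exact.
have Wy : W y.
  split=> [u|s i u ysu].
    apply/andP; split; rewrite leNgt; apply/negP => h.
      have e0 : 0 < - y u by rewrite oppr_gt0.
      have [x] := filter_ex (near_y u _ e0).
      have := word_tree_ge0 u (iotaW x); rewrite ltr_norml => ? /andP[]; lra.
    have e0 : 0 < y u - len u by rewrite subr_gt0.
    have [x] := filter_ex (near_y u _ e0).
    have [/(_ u) + _] := iotaW x; rewrite ltr_norml => /andP[? ?] /andP[]; lra.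
  (* Violating the attachment rule is an open condition on two coordinates, so some [iota x] close
     to [y] would violate it too. *)
  apply/eqP; rewrite -subr_eq0; apply/negPn/negP => yu.
  have e0 : 0 < `|y u - pos u i| by rewrite normr_gt0.
  have e1 : 0 < `|y (s ++ i :: u)| by rewrite normr_gt0.
  have /filter_ex[x [xu xv]] : \forall x \near F,
      `|y u - iota x u| < `|y u - pos u i| /\
      `|y (s ++ i :: u) - iota x (s ++ i :: u)| < `|y (s ++ i :: u)|.
    by apply: filterI; exact: near_y.
  have [_ /(_ s i u) xp] := iotaW x.
  have [xs0|xs0] := eqVneq (iota x (s ++ i :: u)) 0.
    by move: xv; rewrite xs0 subr0 ltxx.
  by move: xu; rewrite xp// ltxx.
have [p pE] := iota_surj Wy.
exists p; split=> //; apply/metricType_numDomainType.fcvgrPdist_lt => e e0.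
have [/andP[r0 r1] _] := dec.
have r10 : 0 < 1 - rho by rewrite subr_gt0.
(* Each of the two tails is at most [d / (1 - rho) = e / 4], and the finitely many words of [J]
   contribute at most another [e / 4]. *)
pose d := e * (1 - rho) / 4.
have d0 : 0 < d by rewrite /d divr_gt0 ?mulr_gt0.
have [K KP] := dec.2 _ d0.
pose J := [seq CodeSeq.decode k | k <- index_iota 0 K].
have uJ : uniq J.
  rewrite map_inj_in_uniq ?iota_uniq// => k l _ _ /(congr1 CodeSeq.code).
  by rewrite !CodeSeq.decodeK.
have JP u : u \notin J -> len u <= d * rho ^+ size u.
  move=> uJ'; apply: KP; rewrite leqNgt; apply: contra uJ' => uK.
  by apply/mapP; exists (CodeSeq.code u); rewrite ?mem_index_iota// CodeSeq.codeK.
have tail f : W f -> nsum (fun u => if u \notin J then f u else 0) <= e / 4.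
  move=> Wf; have [_] := word_tree_tail sep dec Wf (ltW d0) JP.
  by rewrite {1}/d (_ : _ / _ / _ = e / 4)//; field; rewrite gt_eqF.
pose h := e / 4 / K.+1%:R.
have h0 : 0 < h by rewrite /h !divr_gt0.
have : \forall x \near F, forall k : 'I_K, `|y (CodeSeq.decode k) - iota x (CodeSeq.decode k)| < h.
  by apply: filter_forall => k; exact: near_y.
apply: filterS => x xh; rewrite iota_dist pE.
apply: le_lt_trans (@nsum_dist_split _ _ _ _ J _ _ uJ _ _ _ _ (tail _ Wy) (tail _ (iotaW x))) _.
- by move=> u; exact: word_tree_ge0 Wy.
- by move=> u; exact: word_tree_ge0 (iotaW x).
- exact: (word_tree_summable sep dec).
- exact: (word_tree_summable sep dec (iotaW x)).
have : \sum_(u <- J) `|y u - iota x u| <= e / 4.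
  rewrite big_map big_mkord.
  apply: (@le_trans _ _ (\sum_(k < K) h)).
    by apply: ler_sum => k _; exact: ltW.
  rewrite sumr_const card_ord -[_ *+ K]mulr_natr /h mulrAC ler_pdivrMr//.
  by rewrite ler_wpM2l ?ler_nat// divr_ge0// ltW.
by lra.
Qed.

Lemma embedded_Rtree : Rtree X.
Proof.
apply: (@zero_hyperbolic_Rtree _ _ (Defs.root X)).
- exact: embedded_four_point.
- by move=> x; have [f ? _] := embedded_unit_speed x; exists f.
- exact/compact_separable/embedded_compact.
Qed.

End embedded_tree.

(** * The limit tree of a cascade of strings *)

Section cascade.
Context {R : realType}.
Variables (beta : R) (s : seq nat -> string_of_beads R).
Hypothesis beta0 : 0 < beta.
Implicit Types (u v : seq nat) (t : R).

Fixpoint cmass u : R := if u is i :: v then cmass v * bead_mass (s v) i else 1.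

Definition clen u : R := cmass u `^ beta * string_length (s u).

Definition cpos u i : R := cmass u `^ beta * bead_pos (s u) i.

Lemma cmass_ge0 u : 0 <= cmass u.
Proof. by elim: u => //= i u IH; rewrite mulr_ge0 ?bead_mass_ge0. Qed.

Lemma clen_ge0 u : 0 <= clen u.
Proof. by rewrite mulr_ge0 ?powR_ge0// ltW// string_length_gt0. Qed.

Lemma cpos_itv u i : 0 <= cpos u i <= clen u.
Proof.
have /andP[p0 p1] := bead_pos_itv (s u) i.
by rewrite /cpos /clen mulr_ge0 ?powR_ge0//= ler_wpM2l ?powR_ge0.
Qed.

Lemma clen_gt0 u : 0 < clen u -> 0 < cmass u.
Proof.
move=> h; rewrite lt_neqAle cmass_ge0 andbT eq_sym; apply/negP => /eqP u0.
by move: h; rewrite /clen u0 powR0 ?gt_eqF// mul0r ltxx.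
Qed.

Lemma cmass_gt0_cat v u : 0 < cmass (v ++ u) -> 0 < cmass u.
Proof.
elim: v => //= i v IH; rewrite lt_neqAle eq_sym => /andP[+ _].
rewrite mulf_eq0 negb_or => /andP[h _]; apply: IH.
by rewrite lt_neqAle eq_sym h cmass_ge0.
Qed.

Lemma cascade_separating : separating clen cpos.
Proof.
move=> u i j v v' /clen_gt0 vu _; have u0 : 0 < cmass u.
  by move: vu; rewrite -cat_rcons => /cmass_gt0_cat.
by move=> /mulfI h; apply/(@bead_pos_inj _ (s u))/h; rewrite gt_eqF ?powR_gt0.
Qed.

(** The length of a string is the supremum of the positions of its charged beads, so there is mass
    arbitrarily close to the end of each segment. This gives the positive mass above a point that is
    not a leaf. *)
Lemma bead_beyond u x : x < clen u ->
  0 < clen u -> exists2 i, x < cpos u i & 0 < cmass (i :: u).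
Proof.
move=> xu /clen_gt0 u0; have ub := powR_gt0 beta u0.
have xl : x / cmass u `^ beta < string_length (s u).
  by rewrite ltr_pdivrMr// mulrC.
rewrite string_length_sup in xl.
set S := [set bead_pos (s u) i | i in _] in xl.
have hS : has_sup S.
  split; last first.
    by exists (string_length (s u)) => _ [i _ <-]; case/andP: (bead_pos_itv (s u) i).
  apply/set0P/negP => /eqP S0.
  (* Without charged beads all masses would vanish, while they sum to 1. *)
  have m0 i : bead_mass (s u) i = 0.
    apply/eqP; rewrite eq_le bead_mass_ge0 andbT leNgt; apply/negP => i0.
    have : S (bead_pos (s u) i) by exists i.
    by rewrite S0.
  have := bead_mass_sum (s u).
  under eq_fun do rewrite big1 ?m0//.
  by move=> /(cvg_unique (@Rhausdorff R) (cvg_cst _))/eqP; rewrite eq_sym oner_eq0.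
have e0 : 0 < sup S - x / cmass u `^ beta by rewrite subr_gt0.
have [_ [i i0 <-]] := sup_adherent e0 hS; rewrite opprB addrC subrK => xi.
by exists i; rewrite /= ?mulr_gt0// /cpos mulrC -ltr_pdivrMr.
Qed.

Fixpoint cleft u : R := if u is i :: v then
  cleft v + cmass v * \sum_(0 <= j < i) bead_mass (s v) j else 0.

(* The mass is carried by Lebesgue measure on [0, 1[: the cells of the words of
   length [n] partition it, and a point selects the branch of the words whose
   cells contain it. *)
Definition cell u : set R := `[cleft u, cleft u + cmass u[%classic.

Lemma cellP u t : cell u t <-> cleft u <= t < cleft u + cmass u.
Proof. by rewrite /cell /= in_itv. Qed.

Lemma bead_sum_le1 u n : \sum_(0 <= j < n) bead_mass (s u) j <= 1.
Proof.
rewrite -(cvg_lim (@Rhausdorff R) (bead_mass_sum (s u))).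
apply: (@nondecreasing_cvgn_le _ (fun n => \sum_(0 <= i < n) bead_mass (s u) i)).
  apply/nondecreasing_seqP => m; rewrite big_nat_recr//= lerDl.
  exact: bead_mass_ge0.
by apply/cvg_ex; exists 1; exact: bead_mass_sum.
Qed.

Lemma cleft_cons_add i u : cleft (i :: u) + cmass (i :: u) =
  cleft u + cmass u * \sum_(0 <= j < i.+1) bead_mass (s u) j.
Proof. by rewrite /= big_nat_recr//= mulrDr addrA. Qed.

Lemma cell_cons_sub i u : cell (i :: u) `<=` cell u.
Proof.
move=> t /cellP; rewrite cleft_cons_add => /andP[h1 h2]; apply/cellP/andP; split.
  apply: le_trans h1; rewrite /= lerDl mulr_ge0 ?cmass_ge0// sumr_ge0// => *.
  exact: bead_mass_ge0.
apply: lt_le_trans h2 _; rewrite lerD2l ler_piMr ?cmass_ge0//.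
exact: bead_sum_le1.
Qed.

Lemma cell_next u t : cell u t -> exists i, cell (i :: u) t.
Proof.
move=> /cellP/andP[ut tu].
have u0 : 0 < cmass u by lra.
pose x := (t - cleft u) / cmass u.
have x0 : 0 <= x by rewrite divr_ge0 ?cmass_ge0// subr_ge0.
have x1 : x < 1 by rewrite ltr_pdivrMr// mul1r; lra.
have ex : exists n, x < \sum_(0 <= j < n) bead_mass (s u) j.
  have /cvgrPdist_lt := bead_mass_sum (s u).
  move=> /(_ (1 - x)); rewrite subr_gt0 => /(_ x1)[n _ /(_ n (leqnn n))] /=.
  have := bead_sum_le1 u n => h; rewrite ger0_norm ?subr_ge0//.
  by exists n; lra.
(* The least number of beads whose mass exceeds [x] is not 0, and its predecessor is the letter
   sought. *)
case: (ex_minnP ex) => -[|n]; first by rewrite big_geq// ltNge x0.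
move=> xn nmin; exists n; apply/cellP; rewrite cleft_cons_add /=.
have tE : t = cleft u + cmass u * x by rewrite /x mulrC divfK ?gt_eqF//; lra.
rewrite tE lerD2l ltrD2l ltr_pM2l// xn andbT ler_pM2l// leNgt.
by apply/negP => /nmin; rewrite ltnn.
Qed.

Lemma cell_disjoint i j u t : cell (i :: u) t -> cell (j :: u) t -> i = j.
Proof.
wlog ij : i j / (i < j)%N => [H it jt|].
  have [/H->//|/H h|//] := ltngtP i j; by rewrite h.
move=> /cellP; rewrite cleft_cons_add => /andP[_ it] /cellP/andP[jt _].
exfalso; have : cleft u + cmass u * \sum_(0 <= k < i.+1) bead_mass (s u) k <= cleft (j :: u).
  rewrite /= lerD2l ler_wpM2l ?cmass_ge0//.
  rewrite [leRHS](big_cat_nat (n := i.+1))//= lerDl sumr_ge0// => *.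
  exact: bead_mass_ge0.
by lra.
Qed.

Definition letter u t : nat := xget 0%N [set i | cell (i :: u) t].

Lemma cell_letter u t : cell u t -> cell (letter u t :: u) t.
Proof.
move=> /cell_next[i it].
by have := @xgetI _ 0%N [set i | cell (i :: u) t] i it.
Qed.

Fixpoint address t n : seq nat :=
  if n is n'.+1 then letter (address t n') t :: address t n' else [::].

Lemma size_address t n : size (address t n) = n.
Proof. by elim: n => //= n ->. Qed.

Lemma cell_address t n : 0 <= t < 1 -> cell (address t n) t.
Proof.
move=> t01; elim: n => [|n /cell_letter//].
by apply/cellP; rewrite /= add0r.
Qed.

Lemma cell_sub01 u t : cell u t -> 0 <= t < 1.
Proof.
elim: u => [/cellP|i u IH /cell_cons_sub/IH//]; by rewrite /= add0r.
Qed.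

Lemma address_cell u t : cell u t -> address t (size u) = u.
Proof.
elim: u => //= i u IH ut; rewrite IH; last exact: cell_cons_sub ut.
congr cons; apply: (cell_disjoint _ ut); apply: cell_letter.
exact: cell_cons_sub ut.
Qed.

Lemma drop_address t n m : drop m (address t (m + n)) = address t n.
Proof. by elim: m => [|m IH] /=; rewrite ?drop0. Qed.

Lemma drop_address_le t k n : (k <= n)%N ->
  drop (n - k) (address t n) = address t k.
Proof. by move=> kn; rewrite -{2}(subnK kn) drop_address. Qed.

Lemma address_suffix v i u t n : address t n = v ++ i :: u ->
  address t (size u).+1 = i :: u.
Proof.
move=> nE; have nsz : n = (size v + (size u).+1)%N.
  by rewrite -(size_address t n) nE size_cat.
by rewrite -(drop_address _ _ (size v)) -nsz nE drop_size_cat.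
Qed.

(** The branch of [t] is infinite: the segment of each of its words [u] is followed up to the bead
    given by the next letter, and then left. *)
Definition limit_coord t u : R :=
  if address t (size u) == u then cpos u (letter u t) else 0.

Lemma word_tree_limit t : word_tree clen cpos (limit_coord t).
Proof.
split=> [u|v i u]; rewrite /limit_coord.
  by case: ifP => _; rewrite ?cpos_itv// lexx clen_ge0.
case: (eqVneq (address t _) (v ++ i :: u)) => [/address_suffix/= [<- ->]|_];
  by rewrite ?eqxx.
Qed.

(* Coordinates of the [i]-th bead of the segment [u], for the word [i :: u]. *)
Fixpoint node u : seq nat -> R :=
  if u is i :: v then fun w => if w == v then cpos v i else node v w
  else fun=> 0.

Definition truncate n (f : seq nat -> R) u : R := if (size u <= n)%N then f u else 0.

Lemma node_size u v : (size u <= size v)%N -> node u v = 0.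
Proof.
elim: u => //= i u IH uv; case: eqVneq => [vE|_]; last by apply: IH; exact: ltnW.
by move: uv; rewrite vE ltnn.
Qed.

(** The atom of the n-th tree selected by [t] is the truncation of the limit point selected by the
    same [t]. This is the coupling of the mass measures. *)
Lemma node_address t n : node (address t n.+1) = truncate n (limit_coord t).
Proof.
apply/funext => u; rewrite /truncate /limit_coord; elim: n => [|n IH].
  by case: u => [|j u] /=; rewrite ?eqxx.
have -> : node (address t n.+2) u = if u == address t n.+1
  then cpos (address t n.+1) (letter (address t n.+1) t)
  else node (address t n.+1) u by [].
case: (eqVneq u (address t n.+1)) => [->|nu].
  by rewrite size_address leqnn eqxx.
rewrite IH; have [un|un] := leqP (size u) n; first by rewrite leqW.
have [un'|//] := leqP (size u) n.+1.
have -> : size u = n.+1 by apply/eqP; rewrite eqn_leq un' un.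
by rewrite eq_sym (negbTE nu).
Qed.

(** Setting the lengths beyond level [n] to 0 presents the n-th tree in the same formalism as the
    limit, so that all results on height functions apply to both. *)
Definition truncated_len n u : R := if (size u <= n)%N then clen u else 0.

Lemma truncated_separating n : separating (truncated_len n) cpos.
Proof.
move=> u i j v v'; rewrite /truncated_len.
case: ifP; rewrite ?ltxx// => _ vu; case: ifP; rewrite ?ltxx// => _ v'u.
exact: cascade_separating vu v'u.
Qed.

Lemma truncated_decaying rho n : decaying rho clen ->
  decaying rho (truncated_len n).
Proof.
move=> [r01 dec]; split=> // e e0; have [K KP] := dec e e0; exists K => u Ku.
rewrite /truncated_len; case: ifP => _; first exact: KP.
by rewrite mulr_ge0 ?exprn_ge0// ltW//; case/andP: r01.
Qed.

Lemma truncated_word_tree n f : word_tree (truncated_len n) cpos f ->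
  word_tree clen cpos f /\ forall u, (n < size u)%N -> f u = 0.
Proof.
move=> [fl fp]; split; first split=> // u.
  have /andP[-> /le_trans->//] := fl u; rewrite /truncated_len.
  by case: ifP => // _; exact: clen_ge0.
move=> u nu; apply/eqP; rewrite eq_le; have := fl u.
by rewrite /truncated_len leqNgt nu/= andbC.
Qed.

Lemma word_tree_truncated n f : word_tree clen cpos f ->
  (forall u, (n < size u)%N -> f u = 0) -> word_tree (truncated_len n) cpos f.
Proof.
move=> [fl fp] f0; split=> // u; rewrite /truncated_len.
by case: leqP => un; rewrite ?fl// f0// lexx.
Qed.

Lemma word_tree_truncate n f : word_tree clen cpos f ->
  word_tree (truncated_len n) cpos (truncate n f).
Proof.
move=> [fl fp]; split=> [u|v i u]; rewrite /truncate /truncated_len.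
  by case: ifP => _; rewrite ?fl// lexx.
case: ifPn => [vu|]; last by rewrite eqxx.
move=> /fp <-; rewrite ifT//; apply: leq_trans vu; rewrite size_cat.
exact: leq_trans (leqnSn _) (leq_addl _ _).
Qed.

End cascade.

Lemma code_ge_size K : exists n, forall u : seq nat,
  (n <= size u)%N -> (K <= CodeSeq.code u)%N.
Proof.
elim: K => [|K [n nP]]; first by exists 0%N.
exists (maxn n (size (CodeSeq.decode K)).+1) => u; rewrite geq_max => /andP[nu Ku].
rewrite ltn_neqAle nP// andbT; apply/eqP => KE.
by move: Ku; rewrite KE CodeSeq.codeK ltnn.
Qed.

Section limit_space.
Context {R : realType}.
Variables (beta : R) (s : seq nat -> string_of_beads R).

Definition limit_space := {x : l1 R (seq nat) |
  `[< word_tree (clen beta s) (cpos beta s) (coord x) >]}.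

HB.instance Definition _ := Choice.on limit_space.

Definition limit_dist (x y : limit_space) : R := mdist (val x) (val y).

Let distxx x : limit_dist x x = 0.
Proof. exact: mdistxx. Qed.

Let dist_pos x y : limit_dist x y = 0 -> x = y.
Proof. by move=> xy; apply/val_inj/mdist_positivity. Qed.

Let dist_sym x y : limit_dist x y = limit_dist y x.
Proof. exact: metric_sym. Qed.

Let dist_triangle y x z : limit_dist x z <= limit_dist x y + limit_dist y z.
Proof. exact: metric_triangle. Qed.

HB.instance Definition _ := @isMetric.Build R limit_space limit_dist
  distxx dist_pos dist_sym dist_triangle.

Lemma summable_zero : summable0 (fun u : seq nat => `|0 : R|).
Proof.
by have [] := @nsum_finite_support R _ (fun u : seq nat => `|0 : R|) [::]; rewrite ?normr0.
Qed.

Definition l1_zero : l1 R (seq nat) := mkl1 summable_zero.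

Lemma word_tree_zero : word_tree (clen beta s) (cpos beta s) (coord l1_zero).
Proof. by split=> [u|v i u]; rewrite /= ?lexx ?clen_ge0// eqxx. Qed.

HB.instance Definition _ := isPointed.Build limit_space
  (exist _ l1_zero (asboolT word_tree_zero)).

Definition limit_iota (x : limit_space) : seq nat -> R := coord (val x).

Lemma limit_iotaW x : word_tree (clen beta s) (cpos beta s) (limit_iota x).
Proof. by apply/asboolP; exact: (valP x). Qed.

Lemma limit_iota_dist x y :
  mdist x y = nsum (fun u => `|limit_iota x u - limit_iota y u|).
Proof. by []. Qed.

Lemma limit_iota_root : limit_iota (Defs.root limit_space) = fun=> 0.
Proof. by []. Qed.

End limit_space.

(** * Lebesgue measure and functions of the address *)

Section address_functions.
Context {R : realType}.
Variables (beta : R) (s : seq nat -> string_of_beads R).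
Local Notation address := (address s).
Local Notation mu := (@lebesgue_measure R).

Definition unit_itv : set R := `[0, 1[%classic.

Lemma unit_itvP t : unit_itv t <-> 0 <= t < 1.
Proof. by rewrite /unit_itv /= in_itv. Qed.

Lemma measurable_unit_itv : measurable unit_itv.
Proof. exact: measurable_itv. Qed.

Lemma unit_itv_measure : mu unit_itv = 1%E.
Proof. by rewrite /unit_itv lebesgue_measure_itv/= lte01 oppr0 adde0. Qed.

Lemma measurable_cell u : measurable (cell s u).
Proof. exact: measurable_itv. Qed.

Lemma cell_measure u : mu (cell s u) = (cmass s u)%:E.
Proof.
rewrite /cell lebesgue_measure_itv/= lte_fin ltrDl.
case: ltP => [_|u0]; first by rewrite -EFinB addrAC subrr add0r.
by congr EFin; apply/eqP; rewrite eq_le u0 cmass_ge0.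
Qed.

Lemma measurable_address n (A : set (seq nat)) :
  measurable (unit_itv `&` [set t | A (address t n)]).
Proof.
have -> : unit_itv `&` [set t | A (address t n)] =
    \bigcup_k (if `[< size (CodeSeq.decode k) = n /\ A (CodeSeq.decode k) >]
               then cell s (CodeSeq.decode k) else set0).
  apply/seteqP; split=> [t [/unit_itvP t01 At]|t [k _]].
    exists (CodeSeq.code (address t n)) => //; rewrite CodeSeq.codeK.
    rewrite asboolT; first exact: cell_address.
    by rewrite size_address.
  case: ifPn => // /asboolP[sz Ak] tk; split.
    by apply/unit_itvP; exact: cell_sub01 tk.
  by rewrite /= -sz address_cell.
apply: bigcupT_measurable => k; case: ifP => _ //; exact: measurable_cell.
Qed.

(** Uniform continuity with respect to addresses; it replaces continuity in [t], which may fail at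
    the ends of the cells. *)
Definition address_continuous (M : metricType R) (phi : R -> M) :=
  forall e, 0 < e -> exists n, forall t t', 0 <= t < 1 -> 0 <= t' < 1 ->
    address t n = address t' n -> mdist (phi t) (phi t') < e.

Lemma address_continuous_measurable (M : metricType R) (phi : R -> M) :
  address_continuous phi -> forall A, <<s @open M >> A ->
  measurable (unit_itv `&` phi @^-1` A).
Proof.
move=> ac; apply: smallest_sub; first split.
- by rewrite preimage_set0 setI0.
- move=> A mA; rewrite setTD preimage_setC.
  have -> : unit_itv `&` ~` (phi @^-1` A) =
      unit_itv `\` (unit_itv `&` (phi @^-1` A)).
    by rewrite setDIr setDv set0U.
  by apply: measurableD => //; exact: measurable_unit_itv.
- move=> F mF; rewrite preimage_bigcup setI_bigcupr.
  exact: bigcupT_measurable.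
move=> O oO.
(* An index [n] stands for the points whose whole cell of level [n] is mapped into [O]. *)
have -> : unit_itv `&` phi @^-1` O = \bigcup_n (unit_itv `&`
    [set t | [set u | forall t', 0 <= t' < 1 -> address t' n = u -> O (phi t')] (address t n)]).
  apply/seteqP; split=> [t [t01 Ot]|t [n _ [t01 /= Ot]]].
    have [e e0 eO] := open_mdist oO Ot; have [n nP] := ac e e0.
    exists n => //; split=> // t' t'01 tt'; apply: eO.
    by apply: (nP _ _ _ t'01 (esym tt')); exact/unit_itvP.
  by split=> //; apply: Ot => //; exact/unit_itvP.
by apply: bigcupT_measurable => n; exact: measurable_address.
Qed.

(** The easy half of Strassen's theorem: a point [t] that one map sends to [A] is sent by the other
    to the thickening of [A], unless it belongs to [N]. *)
Lemma prokhorov_coupling (M : metricType R) (mu1 mu2 : set M -> \bar R)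
    (phi psi : R -> M) (N : set R) (e : R) :
  (forall A, <<s @open M >> A -> measurable (unit_itv `&` phi @^-1` A)) ->
  (forall A, <<s @open M >> A -> measurable (unit_itv `&` psi @^-1` A)) ->
  (forall A, <<s @open M >> A -> mu1 A = mu (unit_itv `&` phi @^-1` A)) ->
  (forall A, <<s @open M >> A -> mu2 A = mu (unit_itv `&` psi @^-1` A)) ->
  0 < e -> measurable N -> (mu N <= e%:E)%E ->
  (forall t, 0 <= t < 1 -> ~ N t -> mdist (phi t) (psi t) < e) ->
  (prokhorov_dist mu1 mu2 <= e%:E)%E.
Proof.
move=> mphi mpsi mu1E mu2E e0 mN Ne phipsi; apply: ereal_inf_lbound.
exists e => //; split=> // A mA.
have mT : <<s @open M >> (thickening A e).
  by apply: sub_sigma_algebra; exact: thickening_open.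
have half (f g : R -> M) :
    measurable (unit_itv `&` f @^-1` A) ->
    measurable (unit_itv `&` g @^-1` thickening A e) ->
    (forall t, 0 <= t < 1 -> ~ N t -> mdist (f t) (g t) < e) ->
    (mu (unit_itv `&` f @^-1` A) <=
     mu (unit_itv `&` g @^-1` thickening A e) + e%:E)%E.
  move=> mf mg fg.
  apply: (@le_trans _ _ (mu ((unit_itv `&` g @^-1` thickening A e) `|` N))).
    apply: le_measure; rewrite ?inE.
    - exact: mf.
    - exact: measurableU.
    - move=> t [t01 At]; have [Nt|Nt] := pselect (N t); [by right|left].
      by split=> //; exists (f t) => //; apply: fg => //; exact/unit_itvP.
  apply: (@le_trans _ _ (mu (unit_itv `&` g @^-1` thickening A e) + mu N)%E).
    exact: measureU2.
  by rewrite leeD2l.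
rewrite !mu1E// !mu2E//.
split; apply: half => //; first exact: mphi; first exact: mpsi.
- exact: mpsi.
- exact: mphi.
by move=> t t01 Nt; rewrite metric_sym; exact: phipsi.
Qed.

End address_functions.

Section limit_measure.
Context {R : realType}.
Variables (beta rho : R) (s : seq nat -> string_of_beads R).
Hypotheses (beta0 : 0 < beta) (dec : decaying rho (clen beta s)).
Local Notation address := (address s).
Local Notation mu := (@lebesgue_measure R).
Local Notation W := (word_tree (clen beta s) (cpos beta s)).
Let sep := @cascade_separating R beta s beta0.

Lemma summable_word_tree f : W f -> summable0 (fun u => `|f u|).
Proof.
move=> Wf; have -> : (fun u => `|f u|) = f.
  by apply/funext => u; rewrite ger0_norm// (word_tree_ge0 _ Wf).
exact: (word_tree_summable sep dec Wf).
Qed.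

Definition limit_mk f (Wf : W f) : limit_space beta s :=
  exist _ (mkl1 (summable_word_tree Wf)) (asboolT Wf).

Lemma limit_iota_surj f : W f -> exists x : limit_space beta s, limit_iota x = f.
Proof. by move=> Wf; exists (limit_mk Wf). Qed.

Definition limit_pt t : limit_space beta s := limit_mk (word_tree_limit beta s t).

Lemma limit_iota_pt t : limit_iota (limit_pt t) = limit_coord beta s t.
Proof. by []. Qed.

Lemma level_tail e : 0 < e -> exists n, forall f, W f ->
  nsum (fun u => if (n <= size u)%N then f u else 0) < e.
Proof.
move=> e0; have [/andP[r0 r1] _] := dec.
have r10 : 0 < 1 - rho by rewrite subr_gt0.
have d0 : 0 < e * (1 - rho) / 2 by rewrite divr_gt0 ?mulr_gt0.
have [K KP] := dec.2 _ d0.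
have [n nP] := code_ge_size K; exists n => f Wf.
have h u : (n <= size u)%N -> clen beta s u <= e * (1 - rho) / 2 * rho ^+ size u.
  by move=> nu; apply: KP; exact: nP.
have [_ le] := word_tree_tail sep dec Wf (ltW d0) h.
apply: le_lt_trans le _; rewrite (_ : _ / _ = e / 2); last first.
  by field; rewrite gt_eqF.
by rewrite ltr_pdivrMr// ltr_pMr// ltr1n.
Qed.

Lemma dist_same_level n f g e : W f -> W g ->
  nsum (fun u => if (n <= size u)%N then f u else 0) < e ->
  nsum (fun u => if (n <= size u)%N then g u else 0) < e ->
  (forall u, (size u < n)%N -> f u = g u) ->
  nsum (fun u => `|f u - g u|) < e + e.
Proof.
move=> Wf Wg fe ge fg.
have Sc h (Wh : W h) : summable0 (fun u => if (n <= size u)%N then h u else 0).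
  apply: summable0_le (word_tree_summable sep dec Wh) => u.
  by case: ifP; rewrite ?lexx (word_tree_ge0 _ Wh).
apply: le_lt_trans (ltrD fe ge); rewrite -nsumD; try exact: Sc.
apply: nsum_le => [u|]; last by apply: summable0D; exact: Sc.
rewrite normr_ge0/=; case: leqP => un; last by rewrite fg// subrr normr0 addr0.
rewrite (le_trans (ler_normB _ _))// !ger0_norm//.
  exact: word_tree_ge0 Wg.
exact: word_tree_ge0 Wf.
Qed.

Lemma limit_coord_address n t t' u : (size u < n)%N ->
  address t n = address t' n -> limit_coord beta s t u = limit_coord beta s t' u.
Proof.
move=> un tt'.
have E k : (k <= n)%N -> address t k = address t' k.
  by move=> kn; rewrite -!(drop_address_le s _ kn) tt'.
rewrite /limit_coord E ?(ltnW un)//; case: eqP => // uE.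
by have := E _ un; rewrite /= E ?(ltnW un)// uE => -[->].
Qed.

Lemma limit_pt_continuous : address_continuous s limit_pt.
Proof.
move=> e e0; have e20 : 0 < e / 2 by rewrite divr_gt0.
have [n nP] := level_tail e20; exists n => t t' _ _ tt'.
rewrite limit_iota_dist !limit_iota_pt [e]splitr.
apply: dist_same_level => //; try exact: word_tree_limit.
- exact/nP/word_tree_limit.
- exact/nP/word_tree_limit.
- by move=> u un; exact: limit_coord_address un tt'.
Qed.

Definition limit_mass (A : set (borelType (limit_space beta s))) : \bar R :=
  mu (unit_itv `&` limit_pt @^-1` A).

Let limit_mass0 : limit_mass set0 = 0%E.
Proof. by rewrite /limit_mass preimage_set0 setI0 measure0. Qed.

Let limit_mass_ge0 A : (0 <= limit_mass A)%E.
Proof. exact: measure_ge0. Qed.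

Let limit_mass_sigma_additive : semi_sigma_additive limit_mass.
Proof.
move=> F mF tF mUF; rewrite /limit_mass preimage_bigcup setI_bigcupr.
have mF' n : measurable (unit_itv `&` limit_pt @^-1` F n).
  exact: address_continuous_measurable limit_pt_continuous _ (mF n).
apply: measure_semi_sigma_additive => //.
- apply/trivIsetP => /= i j _ _ ij; apply/seteqP; split=> // t [[_ it] [_ jt]].
  have : (F i `&` F j) (limit_pt t) by [].
  by move/trivIsetP : tF => /(_ i j I I ij) ->.
- exact: bigcupT_measurable.
Qed.

HB.instance Definition _ := isMeasure.Build _ _ _ limit_mass
  limit_mass0 limit_mass_ge0 limit_mass_sigma_additive.

Definition limit_weighted : weighted_space R :=
  @WeightedSpace R (limit_space beta s) limit_mass.

Lemma limit_compact_weighted_Rtree : compact_weighted_Rtree limit_weighted.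
Proof.
split.
- exact: (embedded_Rtree sep dec (limit_iota_dist (s := s)) (@limit_iotaW _ _ _)
    limit_iota_surj (limit_iota_root _ _)).
- exact: (embedded_compact sep dec (limit_iota_dist (s := s)) (@limit_iotaW _ _ _)
    limit_iota_surj).
- by rewrite /= /limit_mass preimage_setT setIT unit_itv_measure.
Qed.

End limit_measure.

(** * The limit tree is a continuum tree *)

Section continuum.
Context {R : realType}.
Variables (beta rho : R) (s : seq nat -> string_of_beads R).
Hypotheses (beta0 : 0 < beta) (dec : decaying rho (clen beta s)).
Local Notation address := (address s).
Local Notation mu := (@lebesgue_measure R).
Local Notation W := (word_tree (clen beta s) (cpos beta s)).
Local Notation X := (limit_weighted beta0 dec).
Let sep := @cascade_separating R beta s beta0.

(** From level [N] on, every letter is a bead at position 0, so the branch no longer moves away from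
    the root. *)
Fixpoint zero_tail N (u : seq nat) : bool := if u is i :: v then
  ((size v < N)%N || (bead_pos (s v) i == 0)) && zero_tail N v else true.

Definition zero_run N n : set R :=
  unit_itv `&` [set t | zero_tail N (address t n)].

Hypotheses (mass_small : forall e, 0 < e -> exists K, forall u,
              (K <= CodeSeq.code u)%N -> cmass s u <= e)
           (zero_run_small : forall N e, 0 < e ->
              exists n, (mu (zero_run N n) <= e%:E)%E).

(** The measure is an infimum over covers, hence monotone on all sets. It can thus be applied to the
    leaves and to the subtrees without proving them Borel. *)
Lemma le_lebesgue_measure (A B : set R) : A `<=` B -> (mu A <= mu B)%E.
Proof.
move=> AB; rewrite /lebesgue_measure /lebesgue_stieltjes_measure.
rewrite /measure_extension /mu_ext; apply: ereal_inf_le_tmp => _ [F [mF BF] <-].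
by exists F => //; split=> //; exact: subset_trans AB BF.
Qed.

Lemma nonroot_nonleaf_below (x : X) : x <> Defs.root X -> ~ leaves X x ->
  exists (y : X) t, y <> x /\ limit_iota x = initial (limit_iota y) t.
Proof.
move=> xr nx; apply: contrapT => nex; apply: nx; split=> //.
apply: (@connected_setC1 _ _ (Defs.root X)) => [/esym//|y yx].
have [f uf fP] := embedded_unit_speed sep dec (limit_iota_dist (s := s))
  (@limit_iotaW _ _ _) (limit_iota_surj beta0 dec) (limit_iota_root _ _) y.
exists f => // t tP ftx; apply: nex; exists y, t; split=> //.
by rewrite -fP// ftx.
Qed.

(** A strict initial segment stops on a single segment, that of a shortest word where the two
    differ: everything before is complete and nothing comes after. *)
Lemma initial_cut g t : W g -> initial g t <> g -> exists u,
  [/\ initial g t u < g u,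
      forall v, v \in proper_suffixes u -> initial g t v = g v &
      forall v, v != u -> v \notin proper_suffixes u -> initial g t v = 0].
Proof.
move=> Wg tg.
have [u0 u0P] : exists u, initial g t u < g u.
  apply: contrapT => /forallNP h; apply: tg; apply/funext => u.
  apply/eqP; rewrite eq_le; have /andP[_ ->/=] := initial_itv t u Wg.
  by rewrite leNgt; apply/negP/h.
have exn : exists n, `[< exists2 u, size u = n & initial g t u < g u >].
  by exists (size u0); apply/asboolP; exists u0.
case: (ex_minnP exn) => n /asboolP[u un ug] nmin.
have cut : t < base g u + g u.
  by rewrite ltNge; apply/negP => /initial_full h; move: ug; rewrite h ltxx.
have gu : 0 < g u.
  by apply: le_lt_trans ug; have /andP[] := initial_itv t u Wg.
exists u; split=> // v.
- move=> vu; apply/eqP; rewrite eq_le; have /andP[_ ->/=] := initial_itv t v Wg.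
  rewrite leNgt; apply/negP => vg; have := size_proper_suffix vu.
  by rewrite un ltnNge nmin//; apply/asboolP; exists v.
- move=> vu vsu; apply/eqP; rewrite eq_le; have /andP[-> _] := initial_itv t v Wg.
  rewrite andbT leNgt; apply/negP => /(initial_gt0 Wg)[gv vt].
  have [vsz|vsz] := leqP (size v) (size u).
    by move: vsu; rewrite (word_tree_lt_size sep Wg gu gv vsz vu).
  have uv : u != v by rewrite eq_sym.
  have := base_le Wg (word_tree_lt_size sep Wg gv gu (ltnW vsz) uv).
  by move: vt cut; lra.
Qed.

(** A point that is neither the root nor a leaf is strictly below another point, so its geodesic
    stops on the segment of some word and crosses no longer word. *)
Lemma nonleaf_finite_support (x : X) : ~ leaves X x ->
  exists N, forall u, (N <= size u)%N -> limit_iota x u = 0.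
Proof.
move=> nx; have [->|xr] := pselect (x = Defs.root X); first by exists 0%N.
have [y [t [yx xE]]] := nonroot_nonleaf_below xr nx.
have [u [_ _ u0]] : exists u, [/\ initial (limit_iota y) t u < limit_iota y u,
    forall v, v \in proper_suffixes u -> initial (limit_iota y) t v = limit_iota y v &
    forall v, v != u -> v \notin proper_suffixes u -> initial (limit_iota y) t v = 0].
  apply: initial_cut; first exact: limit_iotaW.
  rewrite -xE => xy; apply: yx; apply: (iota_inj (limit_iota_dist (s := s))).
  by rewrite xy.
exists (size u).+1 => v uv; rewrite xE u0//.
  by apply/negP => /eqP vu; move: uv; rewrite vu ltnn.
by apply/negP => /size_proper_suffix; rewrite ltnNge (ltnW uv).
Qed.

Lemma cmass_address_gt0 t n : 0 <= t < 1 -> 0 < cmass s (address t n).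
Proof. by move=> /(cell_address s n)/cellP; lra. Qed.

Lemma finite_support_zero_run N t n : 0 <= t < 1 ->
  (forall u, (N <= size u)%N -> limit_coord beta s t u = 0) -> zero_run N n t.
Proof.
move=> t01 h; split; first exact/unit_itvP.
elim: n => //= n ->; rewrite andbT size_address; case: leqP => //= Nn.
have := h (address t n); rewrite size_address /limit_coord size_address eqxx.
move=> /(_ Nn)/eqP; rewrite mulf_eq0 gt_eqF// powR_gt0//.
exact: cmass_address_gt0.
Qed.

(** If [limit_pt t] is not a leaf, its support is finite, so from some level on [t] selects only
    beads at position 0. For each starting level [N] such points form a null set. *)
Lemma limit_mass_nonleaves : mass X (~` leaves X) = 0%E.
Proof.
have neg N : mu.-negligible (\bigcap_n zero_run N n).
  have mZ : measurable (\bigcap_n zero_run N n).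
    by apply: bigcap_measurableType => n _; exact: (@measurable_address R s n (zero_tail N)).
  apply/negligibleP => //; apply/eqP; rewrite eq_le measure_ge0 andbT.
  apply/lee_addgt0Pr => e e0; rewrite add0e; have [n nP] := zero_run_small N e0.
  apply: le_trans (le_lebesgue_measure _) nP.
  by move=> t /(_ n I).
have [A [mA A0 AP]] := negligible_bigcup neg.
apply/eqP; rewrite eq_le; apply/andP; split; last first.
  exact: (measure_ge0 (mass X)).
rewrite -A0; apply: le_lebesgue_measure => t [/unit_itvP t01].
move=> /nonleaf_finite_support[N NP]; apply: AP; exists N => // n _.
exact: finite_support_zero_run.
Qed.

Lemma limit_pt_inj t t' n : 0 <= t < 1 -> 0 <= t' < 1 ->
  limit_coord beta s t = limit_coord beta s t' -> address t n = address t' n.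
Proof.
move=> t01 t'01 tt'; elim: n => //= n IH; rewrite IH; congr cons.
have := congr1 (@^~ (address t n)) tt'; rewrite /limit_coord size_address eqxx.
rewrite IH eqxx => /mulfI.
rewrite gt_eqF ?powR_gt0 ?cmass_address_gt0// => /(_ isT); exact: bead_pos_inj.
Qed.

(** Two parameters of the same point have the same address, because the beads of a string have
    distinct positions. The fibre of a point is thus inside cells of arbitrarily small mass. *)
Lemma limit_mass_atomless (x : X) : mass X [set x] = 0%E.
Proof.
have [[t0 [t01 t0x]]|nex] :=
  pselect (exists t, 0 <= t < 1 /\ limit_pt beta0 dec t = x); last first.
  rewrite /= /limit_mass (_ : _ `&` _ = set0) ?measure0//.
  by apply/seteqP; split=> // t [/unit_itvP t01 tx]; apply: nex; exists t.
apply/eqP; rewrite eq_le (measure_ge0 (mass X)) andbT.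
apply/lee_addgt0Pr => e e0; rewrite add0e.
have [K KP] := mass_small e0; have [n nP] := code_ge_size K.
have := KP _ (nP (address t0 n) _); rewrite size_address leqnn => /(_ isT).
rewrite -lee_fin -cell_measure; apply: le_trans; apply: le_lebesgue_measure.
move=> t [/unit_itvP t01' tx].
rewrite -(limit_pt_inj n t01' t01); first exact: cell_address.
by rewrite -!(limit_iota_pt beta0 dec) tx t0x.
Qed.

Lemma limit_coord_cell v i u t : cell s (v ++ i :: u) t ->
  limit_coord beta s t u = cpos beta s u i.
Proof.
move=> /address_cell/address_suffix uE; rewrite /limit_coord.
by move: uE => /= [<- ->]; rewrite eqxx.
Qed.

(** A point strictly below another one stops inside the segment of some [u], before its end. A
    charged bead [i] lies beyond, and the whole cell of [i :: u], which has positive length, is sent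
    above the point. *)
Lemma limit_mass_above (x : X) : ~ leaves X x ->
  (0 < mass X (subtree_above X x))%E.
Proof.
move=> nx.
have speed z := embedded_unit_speed sep dec (limit_iota_dist (s := s))
  (@limit_iotaW _ _ _) (limit_iota_surj beta0 dec) (limit_iota_root _ _) z.
have above (z : X) t : 0 <= t <= nsum (limit_iota z) ->
    limit_iota x = initial (limit_iota z) t -> subtree_above X x z.
  move=> tz xz; have [f uf fP] := speed z; have [ip _] := unit_speed_geodesic uf.
  have tz' : 0 <= t <= mdist (Defs.root X) z.
    by rewrite (mdist_root (limit_iota_dist (s := s)) (@limit_iotaW _ _ _)
      (limit_iota_root _ _)).
  exists (mdist (Defs.root X) z), f; split=> //; exists t; first by rewrite /= in_itv.
  by apply: (iota_inj (limit_iota_dist (s := s))); rewrite fP.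
have [xE|xr] := pselect (x = Defs.root X).
  have -> : subtree_above X x = [set: X].
    apply/seteqP; split=> // z _; apply: (above z 0).
      rewrite lexx nsum_ge0//; exact: (word_tree_summable sep dec (limit_iotaW z)).
    by rewrite (initial0 (limit_iotaW z)) xE.
  have [_ _ ->] := limit_compact_weighted_Rtree beta0 dec; exact: lte01.
have [y [t [yx xE]]] := nonroot_nonleaf_below xr nx.
have Wy := limit_iotaW y; set g := limit_iota y in xE Wy.
have [u [ug usuf u0]] : exists u, [/\ initial g t u < g u,
    forall v, v \in proper_suffixes u -> initial g t v = g v &
    forall v, v != u -> v \notin proper_suffixes u -> initial g t v = 0].
  apply: initial_cut => //; rewrite -xE => xy; apply: yx.
  by apply: (iota_inj (limit_iota_dist (s := s))); rewrite xy.
have gu : 0 < g u.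
  by apply: le_lt_trans ug; have /andP[] := initial_itv t u Wy.
have glen : g u <= clen beta s u by case: Wy => /(_ u)/andP[].
have [i xi mi] := bead_beyond beta0 (lt_le_trans ug glen) (lt_le_trans gu glen).
apply: (@lt_le_trans _ _ (mu (cell s (i :: u)))); first by rewrite cell_measure lte_fin.
apply: le_lebesgue_measure => r ri; split; first exact/unit_itvP/(cell_sub01 ri).
have Wr := word_tree_limit beta s r.
have ru : limit_coord beta s r u = cpos beta s u i.
  exact: (@limit_coord_cell [::]).
have x0 : 0 <= initial g t u by case/andP: (initial_itv t u Wy).
have xr' : limit_iota x = initial (limit_coord beta s r)
    (base (limit_coord beta s r) u + limit_iota x u).
  apply: (initialP sep) => //; first exact: limit_iotaW.
  - by rewrite ru; apply: le_lt_trans xi.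
  - by rewrite ru xE; exact: ltW.
  - move=> v vu; rewrite xE usuf//; have /proper_suffixesP[v' [j uE]] := vu.
    rewrite (@limit_coord_cell (i :: v') j); last by rewrite cat_cons -uE.
    by case: Wy => _ /(_ v' j v); rewrite -uE gt_eqF// => ->.
  - by move=> v vu vsu; rewrite xE u0.
apply: (above (limit_pt beta0 dec r) _ _ xr'); apply/andP; split.
  by rewrite addr_ge0 ?(base_ge0 _ Wr)// xE.
apply: le_trans (base_nsum_le sep dec u Wr); rewrite lerD2l ru xE; exact: ltW.
Qed.

Lemma limit_continuum_tree : continuum_tree X.
Proof.
split; [exact: limit_mass_nonleaves|exact: limit_mass_atomless|].
exact: limit_mass_above.
Qed.

End continuum.

(** * The approximating trees in the limit tree *)

Section address_measure.
Context {R : realType}.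
Variable s : seq nat -> string_of_beads R.
Local Notation mu := (@lebesgue_measure R).

Lemma address_measure n (A : set (seq nat)) :
  mu (unit_itv `&` [set t | A (address s t n)]) =
  (\esum_(u in [set u | size u = n /\ A u]) (cmass s u)%:E)%E.
Proof.
pose F k := if `[< size (CodeSeq.decode k) = n /\ A (CodeSeq.decode k) >]
  then cell s (CodeSeq.decode k) else set0.
have -> : unit_itv `&` [set t | A (address s t n)] = \bigcup_k F k.
  apply/seteqP; split=> [t [/unit_itvP t01 At]|t [k _]].
    exists (CodeSeq.code (address s t n)) => //; rewrite /F CodeSeq.codeK.
    rewrite asboolT; first exact: cell_address.
    by rewrite size_address.
  rewrite /F; case: ifPn => // /asboolP[sz Ak] tk; split.
    by apply/unit_itvP; exact: cell_sub01 tk.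
  by rewrite /= -sz address_cell.
have mF k : measurable (F k) by rewrite /F; case: ifP => // _; exact: measurable_cell.
have tF : trivIset setT F.
  apply/trivIsetP => i j _ _ ij; apply/seteqP; split=> // t [].
  rewrite /F; case: ifPn => // /asboolP[si _] ti; case: ifPn => // /asboolP[sj _] tj.
  move/eqP : ij; apply; rewrite -(CodeSeq.decodeK i) -(CodeSeq.decodeK j).
  by rewrite -(address_cell ti) -(address_cell tj) si sj.
rewrite measure_semi_bigcup//; last exact: bigcupT_measurable.
rewrite nneseries_esumT; last by move=> k; exact: measure_ge0.
rewrite [RHS]esum_mkcond (reindex_esum setT setT CodeSeq.decode)//; last first.
  split=> //; last first.
    by move=> u _; exists (CodeSeq.code u) => //; rewrite CodeSeq.codeK.
  by move=> i j _ _ /(congr1 CodeSeq.code); rewrite !CodeSeq.decodeK.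
apply: eq_esum => k _; rewrite /F; case: asboolP => h.
  by rewrite mem_set//= cell_measure.
by rewrite memNset//= measure0.
Qed.

Lemma address_total_mass n :
  (\esum_(u in [set u | size u = n]) (cmass s u)%:E)%E = 1%E.
Proof.
rewrite -(unit_itv_measure (R := R)); have := address_measure n setT.
rewrite (_ : [set t | [set: seq nat] _] = setT) ?setIT; last first.
  by apply/seteqP; split.
by move=> ->; congr esum; apply/seteqP; split=> u //= [].
Qed.

End address_measure.

Section nodes.
Context {R : realType}.
Variables (beta : R) (s : seq nat -> string_of_beads R).

Lemma node_suffix v i u : node beta s (v ++ i :: u) u = cpos beta s u i.
Proof.
elim: v => [|j v IH] /=; first by rewrite eqxx.
case: eqVneq => // uE; have := congr1 size uE; rewrite size_cat/=; lia.
Qed.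

Lemma node_nsuffix u v : v \notin proper_suffixes u -> node beta s u v = 0.
Proof.
elim: u => //= i u IH vu; case: eqVneq => [vE|_].
  by move: vu; rewrite vE (proper_suffixes_cat [::]).
apply: IH; apply: contra vu => vu; apply: proper_suffixes_trans vu _.
exact: (proper_suffixes_cat [::]).
Qed.

End nodes.

Lemma nsum_single {R : realType} (U : choiceType) (u : U) (c : R) : 0 <= c ->
  summable0 (fun w => if w == u then c else 0) /\
  nsum (fun w => if w == u then c else 0) = c.
Proof.
move=> c0; have [] := @nsum_finite_support R U (fun w => if w == u then c else 0) [:: u] isT.
- by move=> w; case: ifP.
- by move=> w; rewrite inE => /negbTE ->.
by rewrite big_seq1 eqxx.
Qed.

Section string_trees.
Context {R : realType}.
Variables (beta rho : R) (s : seq nat -> string_of_beads R).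
Hypotheses (beta0 : 0 < beta) (dec : decaying rho (clen beta s)).
Local Notation Wn n := (word_tree (truncated_len beta s n) (cpos beta s)).
Let sepn n := @truncated_separating R beta s beta0 n.
Let decn n := truncated_decaying n dec.

(** The invariant of the induction on [n]: an isometry onto the height functions truncated at level
    [n], under which the atoms are the words with [n.+1] letters. *)
Definition string_embedding n (X : beaded_space R)
    (iota : beaded_base X -> seq nat -> R) : Prop :=
  [/\ forall x y, mdist x y = nsum (fun u => `|iota x u - iota y u|),
      forall x, Wn n (iota x),
      forall f, Wn n f -> exists x, iota x = f,
      iota (Defs.root (beaded_base X)) = (fun=> 0) &
      forall u, size u = n.+1 -> 0 < cmass s u ->
        iota (atom_pos X u) = node beta s u] /\
  forall u, atom_mass X u = if size u == n.+1 then cmass s u else 0.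

Definition first_iota (t : beaded_base (first_tree s)) (u : seq nat) : R :=
  if u == [::] then val t else 0.

Lemma first_embedding : string_embedding 0 first_iota.
Proof.
have clen0 : clen beta s [::] = string_length (s [::]).
  by rewrite /clen powR1 mul1r.
split; last by move=> [|i [|j u]]; rewrite //= mul1r.
split.
- move=> x y; have [_ <-] := @nsum_single R _ ([::] : seq nat) (mdist x y) (mdist_ge0 x y).
  congr nsum; apply/funext => u; rewrite /first_iota; case: ifP => // _.
  by rewrite subrr normr0.
- move=> x; split=> [u|v i u]; rewrite /first_iota /truncated_len.
    case: eqVneq => [->|u0]; first by rewrite /= clen0; exact: (valP x).
    by case: ifP => _; rewrite ?lexx ?clen_ge0.
  by case: v => [|j v] /=; rewrite eqxx.
- move=> f Wf; have [fl _] := Wf.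
  have f0 : 0 <= f [::] <= string_length (s [::]).
    by rewrite -clen0; exact: (fl [::]).
  exists (exist _ (f [::]) f0); apply/funext => -[|i u] //=.
  by have [_ /(_ (i :: u)) fu] := truncated_word_tree Wf; rewrite fu.
- by apply/funext => u; rewrite /first_iota; case: ifP.
- move=> [|i [|j u]]//= _ _; apply/funext => u.
  by rewrite /first_iota /cpos powR1 mul1r.
Qed.

Section next_embedding.
Variables (n : nat) (X : beaded_space R) (iota : beaded_base X -> seq nat -> R).
Hypothesis emb : string_embedding n iota.

Definition next_rawiota (z : beaded_base X + seq nat * R) (w : seq nat) : R :=
  match z with
  | inl a => iota a w
  | inr (u, t) => if w == u then t else iota (atom_pos X u) w
  end.

Definition next_iota (z : beaded_base (next_tree beta s X)) : seq nat -> R :=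
  next_rawiota (val z).

Let copyP u t : 0 < t <= copy_length beta s X u ->
  [/\ size u = n.+1, 0 < cmass s u, t <= clen beta s u &
      iota (atom_pos X u) = node beta s u].
Proof.
have [[_ _ _ _ pos] mass] := emb.
rewrite /copy_length mass; case: eqP => [un|_ /andP[t0]]; last first.
  by rewrite powR0 ?gt_eqF// mul0r leNgt t0.
move=> /andP[t0 tl]; have u0 : 0 < cmass s u.
  exact: (clen_gt0 beta0 (lt_le_trans t0 tl)).
by split=> //; exact: pos.
Qed.

Let iota_big a u : (n < size u)%N -> iota a u = 0.
Proof.
by have [[_ W _ _ _] _] := emb; have [_] := truncated_word_tree (W a); apply.
Qed.

(** The coordinate of [u] vanishes on the old tree, since [u] has [n.+1] letters. The height on the
    copy is therefore orthogonal to the old distance and simply adds to it. *)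
Let next_iota_dist_mixed a (u : seq nat) t : 0 < t <= copy_length beta s X u ->
  nsum (fun w => `|iota a w - next_rawiota (inr (u, t)) w|) =
  mdist a (atom_pos X u) + t.
Proof.
move=> ut; have [un u0 tl uE] := copyP ut; have [[dist W _ _ _] _] := emb.
have t0 : 0 <= t by case/andP: ut => /ltW.
have [S1 E1] := nsum_single u t0.
rewrite dist -{2}E1 -nsumD//; last first.
  exact: (summable_norm_dist (@sepn n) (@decn n) (W a) (W (atom_pos X u))).
congr nsum; apply/funext => w /=; case: eqVneq => [->|_]; last by rewrite addr0.
by rewrite !iota_big ?un// subr0 sub0r normr0 normrN add0r ger0_norm.
Qed.

Lemma next_iota_dist (y z : beaded_base (next_tree beta s X)) :
  mdist y z = nsum (fun u => `|next_iota y u - next_iota z u|).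
Proof.
have [[dist W _ _ _] _] := emb.
rewrite [LHS](_ : _ = attach_dist y z)// /next_iota /attach_dist.
case: y z => [[a|[i r]] hy] [[b|[j t]] hz] /=.
- exact: dist.
- by rewrite -next_iota_dist_mixed.
- rewrite addrC metric_sym -next_iota_dist_mixed//; congr nsum; apply/funext => w.
  by rewrite distrC.
have [iN i0 rl iE] := copyP hy; have [jN j0 tl jE] := copyP hz.
case: eqVneq => [<-|ij].
  have [_ <-] := nsum_single i (normr_ge0 (r - t)); congr nsum; apply/funext => w.
  by case: eqP => // _; rewrite subrr normr0.
have r0 : 0 <= r by case/andP: hy => /ltW.
have t0 : 0 <= t by case/andP: hz => /ltW.
have [S1 E1] := nsum_single i r0; have [S2 E2] := nsum_single j t0.
have S3 : summable0 (fun w => `|iota (atom_pos X i) w - iota (atom_pos X j) w|).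
  exact: (summable_norm_dist (@sepn n) (@decn n) (W _) (W _)).
have E3 := nsumD S1 S3; have E4 := nsumD (summable0D S1 S3) S2.
rewrite dist; move: E4; rewrite E3 E1 E2 => <-.
congr nsum; apply/funext => w /=; case: (eqVneq w i) => [->|wi].
  rewrite (negbTE ij) !iota_big ?iN// !subr0 normr0 !addr0.
  by rewrite ger0_norm.
rewrite add0r; case: eqVneq => [->|_]; last by rewrite addr0.
by rewrite !iota_big ?jN// subrr normr0 sub0r normrN ger0_norm// add0r.
Qed.

Lemma next_iotaW (z : beaded_base (next_tree beta s X)) : Wn n.+1 (next_iota z).
Proof.
have [[dist W _ _ _] _] := emb.
have up f : Wn n f -> Wn n.+1 f.
  move=> /truncated_word_tree[Wf f0]; apply: word_tree_truncated => // u nu.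
  by apply: f0; exact: ltnW.
rewrite /next_iota; case: z => [[a|[u t]] hz] /=; first exact/up/W.
have [un u0 tl uE] := copyP hz.
have Wu : Wn n.+1 (node beta s u) by rewrite -uE; exact/up/W.
split=> [w|v i w]; rewrite /= uE.
  case: eqVneq => [->|_]; last by case: Wu.
  by rewrite /truncated_len un leqnn tl andbT; case/andP: hz => /ltW.
case: (eqVneq w u) => [->|wu].
  have sz : (size u < size (v ++ i :: u))%N by rewrite size_cat/=; lia.
  rewrite (_ : (v ++ i :: u == u) = false); last first.
    by apply/eqP => uE'; move: sz; rewrite uE' ltnn.
  by rewrite node_size ?eqxx// ltnW.
case: (eqVneq (v ++ i :: w) u) => [<- _|_]; first exact: node_suffix.
by case: Wu => _; apply.
Qed.

(** If [f] is positive at some word [u] of length [n.+1], its other coordinates are forced to be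
    those of the atom [u], and it lies on the copy attached there; otherwise it lies in the old
    tree. *)
Lemma next_iota_surj f : Wn n.+1 f -> exists z, next_iota z = f.
Proof.
move=> Wf; have [[_ W surj _ _] _] := emb.
have [Wf' f0] := truncated_word_tree Wf.
have [[u [un fu]]|nex] := pselect (exists u, size u = n.+1 /\ 0 < f u); last first.
  have [x xE] : exists x, iota x = f.
    apply/surj/word_tree_truncated => // u; rewrite leq_eqVlt => /orP[/eqP un|]; last exact: f0.
    apply/eqP; rewrite eq_le (word_tree_ge0 _ Wf) andbT leNgt; apply/negP => fu.
    by apply: nex; exists u.
  by exists (attach_base _ _ x).
have ful : f u <= clen beta s u by case: Wf' => /(_ u)/andP[].
have hz : 0 < f u <= copy_length beta s X u.
  by rewrite fu; have [_ mass] := emb; rewrite /copy_length mass un eqxx.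
have [_ u0 _ uE] := copyP hz.
have hz' : attach_mem (copy_length beta s X) (inr (u, f u) : beaded_base X + seq nat * R) by [].
exists (exist _ (inr (u, f u)) hz'); apply/funext => w.
rewrite /next_iota /= uE; case: eqVneq => [->//|wu].
have [wsu|wsu] := boolP (w \in proper_suffixes u).
  have /proper_suffixesP[v [i uE']] := wsu; rewrite uE' node_suffix.
  by case: Wf => _ /(_ v i w) ->//; rewrite -uE' gt_eqF.
rewrite node_nsuffix//; apply/esym/eqP; rewrite eq_le (word_tree_ge0 _ Wf) andbT leNgt.
apply/negP => fw; move/negP : wsu; apply.
apply: (word_tree_lt_size (@sepn n.+1) Wf) => //.
by rewrite leqNgt un; apply/negP => /f0 fw0; move: fw; rewrite fw0 ltxx.
Qed.

Lemma next_embedding : string_embedding n.+1 next_iota.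
Proof.
have [[dist W surj root0 pos] mass] := emb.
split; last first.
  case=> //= i u; rewrite mass eqSS; case: ifP => _ //; by rewrite mul0r.
split.
- exact: next_iota_dist.
- exact: next_iotaW.
- exact: next_iota_surj.
- exact: root0.
- case=> //= i v [vn]; rewrite -/(cmass s) => iv0.
  have v0 : 0 < cmass s v by exact: (@cmass_gt0_cat _ s [:: i]).
  have vE := pos _ vn v0; apply/funext => w.
  have tE : atom_mass X v `^ beta * bead_pos (s v) i = cpos beta s v i.
    by rewrite mass vn eqxx.
  rewrite tE /next_iota /attach_point val_insubd /=.
  have /andP[c0 cl] := cpos_itv beta s v i.
  case: ifPn => [_|]; first by rewrite /= vE.
  (* The remaining case is the default value of [insubd], the atom [v] itself. It occurs only for a
     bead at height 0, where the coordinate of [v] is 0 as well. *)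
  rewrite /copy_length mass vn eqxx -/(clen beta s v) cl andbT -leNgt => c0'.
  rewrite /= vE; case: eqVneq => // ->; rewrite node_size//.
  by apply/eqP; rewrite eq_le c0.
Qed.

End next_embedding.

Lemma string_embedding_exists n :
  exists iota, @string_embedding n (beaded_tree beta s n) iota.
Proof.
elim: n => [|n [iota emb]]; first by exists first_iota; exact: first_embedding.
by exists (next_iota iota); exact: next_embedding.
Qed.

Section string_tree_n.
Variables (n : nat) (iota : beaded_base (beaded_tree beta s n) -> seq nat -> R).
Hypothesis emb : string_embedding n iota.

(** The mass of an atom is the length of the cell of its word, and the cells of words with [n.+1]
    letters partition the unit interval. *)
Lemma string_tree_massE (A : set (string_tree beta s n)) :
  mass (string_tree beta s n) A =
  lebesgue_measure (unit_itv `&`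
    [set t | A (atom_pos (beaded_tree beta s n) (address s t n.+1))]).
Proof.
have [_ mass] := emb.
rewrite (address_measure s n.+1 (fun u => A (atom_pos (beaded_tree beta s n) u))).
rewrite /= /atomic_measure esum_mkcond [RHS]esum_mkcond; apply: eq_esum => u _.
rewrite mass; case: ifPn => [/set_mem/= Au|/negP Au].
  by case: eqP => un; [rewrite mem_set|rewrite memNset// => -[]].
by rewrite memNset// => -[_ Au']; apply: Au; rewrite inE.
Qed.

Lemma iota_string_atom t : 0 <= t < 1 ->
  iota (atom_pos (beaded_tree beta s n) (address s t n.+1)) =
  truncate n (limit_coord beta s t).
Proof.
move=> t01; have [[_ _ _ _ pos] _] := emb; rewrite -node_address.
by rewrite pos ?size_address//; exact: cmass_address_gt0.
Qed.

Lemma string_tree_compact_weighted_Rtree :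
  compact_weighted_Rtree (string_tree beta s n).
Proof.
have [[dist W surj root0 pos] mass] := emb; split.
- exact: (embedded_Rtree (@sepn n) (@decn n) dist W surj root0).
- exact: (embedded_compact (@sepn n) (@decn n) dist W surj).
- rewrite string_tree_massE -(unit_itv_measure (R := R)); congr lebesgue_measure.
  by apply/seteqP; split=> t // [].
Qed.

End string_tree_n.
End string_trees.

(** * Gromov-Hausdorff-Prokhorov bounds *)

Section ghp_bounds.
Context {R : realType}.

Lemma ghp_dist_le (X Y : weighted_space R) (M : metricType R) (f : X -> M)
    (g : Y -> M) (e : R) : 0 < e -> isometric f -> isometric g ->
  mdist (f (Defs.root X)) (g (Defs.root Y)) <= e ->
  range f `<=` thickening (range g) e -> range g `<=` thickening (range f) e ->
  (prokhorov_dist (fun A => mass X (f @^-1` A)) (fun A => mass Y (g @^-1` A))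
    <= e%:E)%E ->
  (ghp_dist X Y <= e%:E)%E.
Proof.
move=> e0 isof isog rootfg fg gf pr.
set r := maxe (mdist (f (Defs.root X)) (g (Defs.root Y)))%:E
         (maxe (hausdorff_dist (range f) (range g))
               (prokhorov_dist (fun A => mass X (f @^-1` A))
                               (fun A => mass Y (g @^-1` A)))).
apply: (@le_trans _ _ r).
  by apply: ereal_inf_lbound; exists M, f, g.
rewrite /r !ge_max lee_fin rootfg pr andbT/=.
by apply: ereal_inf_lbound; exists e.
Qed.

Lemma ghp_dist_ge0 (X Y : weighted_space R) : (0 <= ghp_dist X Y)%E.
Proof.
apply: le_ereal_inf_tmp => _ [M [f [g [_ _ ->]]]].
by rewrite le_max lee_fin mdist_ge0.
Qed.

End ghp_bounds.

Section ghp_convergence.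
Context {R : realType}.
Variables (beta rho : R) (s : seq nat -> string_of_beads R).
Hypotheses (beta0 : 0 < beta) (dec : decaying rho (clen beta s)).
Let sep := @cascade_separating R beta s beta0.

Definition limit_val (x : limit_weighted beta0 dec) : l1 R (seq nat) := val x.

Lemma limit_val_continuous :
  address_continuous s (fun t => limit_val (limit_pt beta0 dec t)).
Proof. exact: limit_pt_continuous. Qed.

(** Both trees sit in the same l1, and truncation at level [n] moves every point by less than [e].
    It maps the limit onto the n-th tree and limit points to atoms, so no exceptional set is needed
    in the coupling. *)
Lemma ghp_dist_string_tree n e : 0 < e ->
  (forall f, word_tree (clen beta s) (cpos beta s) f ->
    nsum (fun u => if (n < size u)%N then f u else 0) < e) ->
  (ghp_dist (string_tree beta s n) (limit_weighted beta0 dec) <= e%:E)%E.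
Proof.
move=> e0 tail; have [iota emb] := string_embedding_exists beta0 dec n.
have [[dist W surj root0 pos] _] := emb.
have W' x : word_tree (clen beta s) (cpos beta s) (iota x).
  by have [] := truncated_word_tree (W x).
pose f x : l1 R (seq nat) := mkl1 (summable_word_tree beta0 dec (W' x)).
have truncate_dist g : word_tree (clen beta s) (cpos beta s) g ->
    nsum (fun u => `|truncate n g u - g u|) < e.
  move=> Wg; apply: le_lt_trans (tail g Wg); rewrite le_eqVlt; apply/orP; left.
  apply/eqP; congr nsum; apply/funext => u; rewrite /truncate ltnNge.
  by case: ifP => _ /=; rewrite ?subrr ?normr0// sub0r normrN ger0_norm// (word_tree_ge0 _ Wg).
apply: (@ghp_dist_le R (string_tree beta s n) (limit_weighted beta0 dec) _ f
  limit_val) => //.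
- rewrite l1_mdistE (_ : (fun u => _) = fun u => if (fun=> false) u then 0 else 0); last first.
    apply/funext => u /=; rewrite [coord _ _](_ : _ = 0) ?sub0r ?normrN.
      by rewrite [coord _ _](_ : _ = 0) ?normr0.
    by rewrite /coord /= root0.
  have [_ ->] := @nsum_finite_support R _
    (fun u : seq nat => if (fun=> false) u then 0 else 0) [::] isT
    (fun=> lexx _) (fun _ _ => erefl).
  by rewrite big_nil ltW.
- move=> _ [x _ <-]; exists (f x).
    have [y yE] := limit_iota_surj beta0 dec (W' x).
    by exists y => //; apply: l1_ext => u; rewrite -[LHS]/(limit_iota y u) yE.
  by rewrite mdistxx.
- move=> _ [y _ <-].
  have [x xE] := surj _ (word_tree_truncate n (limit_iotaW y)).
  exists (f x); first by exists x.
  rewrite l1_mdistE [X in nsum X](_ : _ =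
    fun u => `|truncate n (limit_iota y) u - limit_iota y u|).
    exact/truncate_dist/limit_iotaW.
  by apply/funext => u; rewrite -xE.
- apply: (@prokhorov_coupling _ _ _ _
    (fun t => f (atom_pos (beaded_tree beta s n) (address s t n.+1)))
    (fun t => limit_val (limit_pt beta0 dec t)) set0) => //.
  + apply: (@address_continuous_measurable _ s) => d d0.
    by exists n.+1 => t t' _ _ ->; rewrite mdistxx.
  + exact: (address_continuous_measurable limit_val_continuous).
  + by move=> A _; exact: (string_tree_massE emb).
  + by rewrite measure0 lee_fin ltW.
  + move=> t t01 _; rewrite l1_mdistE [X in nsum X](_ : _ =
      fun u => `|truncate n (limit_coord beta s t) u - limit_coord beta s t u|).
      exact/truncate_dist/word_tree_limit.
    by apply/funext => u; rewrite -(iota_string_atom emb t01).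
Qed.

Lemma ghp_cvg_string_tree :
  ghp_dist (string_tree beta s n) (limit_weighted beta0 dec) @[n --> \oo] --> 0%E.
Proof.
have near_le e : 0 < e -> \forall n \near \oo,
    (ghp_dist (string_tree beta s n) (limit_weighted beta0 dec) <= e%:E)%E.
  move=> e0; have [m mP] := level_tail beta0 dec e0.
  exists m => // n /= mn; apply: ghp_dist_string_tree => // f Wf.
  apply: le_lt_trans (mP f Wf); apply: nsum_le => [u|].
    have fu : 0 <= f u by exact: (word_tree_ge0 _ Wf).
    case: (ltnP n (size u)) => un; last by rewrite lexx /=; case: ifP.
    by rewrite (leq_trans mn (ltnW un)) lexx fu.
  apply: summable0_le (word_tree_summable sep dec Wf) => u.
  by case: ifP => _; rewrite ?lexx (word_tree_ge0 _ Wf).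
apply/fine_cvgP; split.
  apply: filterS (near_le 1 ltr01) => n n1; rewrite ge0_fin_numE ?ghp_dist_ge0//.
  exact: le_lt_trans n1 (ltry _).
apply/cvgrPdist_le => e e0; apply: filterS (near_le e e0) => n ne /=.
rewrite sub0r normrN ger0_norm ?fine_ge0 ?ghp_dist_ge0//.
rewrite -lee_fin fineK// ge0_fin_numE ?ghp_dist_ge0//.
exact: le_lt_trans ne (ltry _).
Qed.

End ghp_convergence.

(** * Trees with nearby parameters *)

Section transfer.
Context {R : realType}.
Variables (len len' : seq nat -> R) (pos pos' : seq nat -> nat -> R).
Variables (rho delta eta : R) (F : seq (seq nat)).
Hypotheses (sep : separating len pos) (dec : decaying rho len).
Hypotheses (pos'_itv : forall u i, 0 <= pos' u i <= len' u).
Hypotheses (delta0 : 0 <= delta) (eta0 : 0 <= eta) (uF : uniq F)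
  (sufF : forall u v, u \in F -> v \in proper_suffixes u -> v \in F)
  (smallF : forall u, u \notin F -> len u <= delta * rho ^+ size u)
  (lenF : forall u, u \in F -> `|len u - len' u| <= eta)
  (posF : forall (i : nat) (u : seq nat), i :: u \in F -> `|pos u i - pos' u i| <= eta).

(* The branch of [f] is followed with the attachment heights of the other
   tree, as far as the words of [F] reach. *)
Let ext (f : seq nat -> R) (u : seq nat) (i : nat) :=
  exists2 v, v ++ i :: u \in F & 0 < f (v ++ i :: u).

Let ext_letter (f : seq nat -> R) (u : seq nat) : nat := xget 0%N [set i | ext f u i].

Definition transfer (f : seq nat -> R) (u : seq nat) : R :=
  if `[< exists i, ext f u i >] then pos' u (ext_letter f u)
  else if u \in F then Num.min (f u) (len' u) else 0.

Let ext_unique f u i : word_tree len pos f -> ext f u i -> ext_letter f u = i.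
Proof.
move=> [fl fp] [v vF fv].
have [v' v'F fv'] : ext f u (ext_letter f u).
  by apply: (@xgetI _ 0%N [set i | ext f u i] i); exists v.
apply: (@sep u _ _ v' v).
- by apply: lt_le_trans fv' _; case/andP: (fl (v' ++ ext_letter f u :: u)).
- by apply: lt_le_trans fv _; case/andP: (fl (v ++ i :: u)).
- by rewrite -(fp _ _ _ (lt0r_neq0 fv')) -(fp _ _ _ (lt0r_neq0 fv)).
Qed.

Let ext_mem f u i : ext f u i -> i :: u \in F /\ u \in F.
Proof.
move=> [v vF _]; have iuF : i :: u \in F.
  case: v vF => //= j v vF; apply: sufF vF _.
  apply/proper_suffixesP; elim/last_ind: v => [|v k _]; first by exists [::], j.
  by exists (j :: v), k; rewrite /= cat_rcons.
by split=> //; apply: sufF iuF _; exact: (proper_suffixes_cat [::]).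
Qed.

Lemma transfer_word_tree f : word_tree len pos f -> word_tree len' pos' (transfer f).
Proof.
move=> Wf; have [fl fp] := Wf.
have len'0 u : 0 <= len' u.
  by have /andP[p0 /(le_trans p0)] := pos'_itv u 0%N.
split=> [u|v i u]; rewrite /transfer.
  case: ifP => _; first exact: pos'_itv.
  case: ifP => _; last by rewrite lexx len'0.
  by rewrite le_min ge_min lexx orbT len'0 andbT andbT (word_tree_ge0 _ Wf).
move=> h; have exti : ext f u i.
  move: h; case: asboolP => [[j [v' v'F fv']] _|_].
    by exists (v' ++ j :: v); rewrite -catA.
  case: ifP; last by rewrite eqxx.
  move=> vF h; exists v => //; rewrite lt_neqAle eq_sym (word_tree_ge0 _ Wf) andbT.
  by apply: contraNneq h => ->; rewrite min_l.
by rewrite asboolT; [rewrite (ext_unique Wf exti)|exists i].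
Qed.

(** On a word of [F] either both heights are attachment heights of the same letter, or the height is
    only capped by the other length; each costs at most [eta]. Outside [F] the transfer is 0 and the
    tail bound applies. *)
Lemma transfer_dist f : word_tree len pos f ->
  nsum (fun u => `|f u - transfer f u|) <=
  (size F)%:R * eta + delta / (1 - rho).
Proof.
move=> Wf; have [fl fp] := Wf.
have tF u : u \notin F -> transfer f u = 0.
  move=> uF'; rewrite /transfer (negbTE uF'); case: asboolP => // -[i /ext_mem[_]].
  by rewrite (negbTE uF').
have close u : u \in F -> `|f u - transfer f u| <= eta.
  move=> uF'; rewrite /transfer uF'; case: asboolP => [[i exti]|_].
    rewrite (ext_unique Wf exti); have [iF _] := ext_mem exti.
    by case: exti => v _ /lt0r_neq0 /fp ->; exact: posF.
  have := lenF uF'; have /andP[f0 fu] := fl u.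
  rewrite ler_norml => /andP[? ?]; case: (lerP (f u) (len' u)) => ?.
    by rewrite subrr normr0.
  by rewrite gtr0_norm ?subr_gt0//; lra.
have [_ tail] := word_tree_tail sep dec Wf delta0 smallF.
have [Sf _] : summable0 (transfer f) /\ nsum (transfer f) = \sum_(u <- F) transfer f u.
  apply: nsum_finite_support => //.
  move=> u; rewrite /transfer; case: ifP => _; first by case/andP: (pos'_itv u (ext_letter f u)).
  case: ifP => // _; rewrite le_min (word_tree_ge0 _ Wf).
  by have /andP[p0 /(le_trans p0)] := pos'_itv u 0%N.
have tail' : nsum (fun u => if u \notin F then transfer f u else 0) <= 0.
  rewrite [X in nsum X](_ : _ = fun=> 0); last first.
    by apply/funext => u; case: ifP => // /tF ->.
  have [_ ->] := @nsum_finite_support R _ (fun _ : seq nat => 0) [::] isT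
    (fun=> lexx _) (fun _ _ => erefl).
  by rewrite big_nil.
have Sf' := word_tree_summable sep dec Wf.
apply: le_trans (nsum_dist_split uF _ _ Sf' Sf tail tail') _.
- by case: Sf'.
- by case: Sf.
rewrite addr0 lerD2r -[leRHS](_ : \sum_(u <- F) eta = _); last first.
  by rewrite big_const_seq count_predT iter_addr_0 mulr_natl.
by rewrite big_seq [leRHS]big_seq; exact: ler_sum.
Qed.

End transfer.

Lemma measure_bigsetU_le {R : realType} (T : eqType) (J : seq T)
    (F : T -> set (measurableTypeR R)) (c : R) :
  (forall u, measurable (F u)) -> (forall u, (lebesgue_measure (F u) <= c%:E)%E) ->
  (lebesgue_measure (\big[setU/set0]_(u <- J) F u) <= ((size J)%:R * c)%:E)%E.
Proof.
move=> mF Fc; elim: J => [|u J IH]; first by rewrite big_nil measure0 mul0r.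
rewrite big_cons; apply: (@le_trans _ _ (lebesgue_measure (F u) +
    lebesgue_measure (\big[setU/set0]_(u <- J) F u))%E).
  by apply: measureU2; [exact: mF|apply: bigsetU_measurable => v _; exact: mF].
by rewrite /= -natr1 mulrDl mul1r addrC EFinD leeD.
Qed.

Section comparison.
Context {R : realType}.
Variables (beta rho delta eta : R) (s s' : seq nat -> string_of_beads R).
Hypotheses (beta0 : 0 < beta) (dec : decaying rho (clen beta s))
  (dec' : decaying rho (clen beta s')).
Variables (N : nat) (F E : seq (seq nat)).
Local Notation mu := (@lebesgue_measure R).

Definition suffix_closed (J : seq (seq nat)) : Prop :=
  forall u v, u \in J -> v \in proper_suffixes u -> v \in J.

Hypotheses (delta0 : 0 <= delta) (eta0 : 0 <= eta) (uF : uniq F)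
  (sufF : suffix_closed F) (sizeF : forall u, u \in F -> (size u < N)%N)
  (sizeE : forall u, u \in E -> size u = N)
  (sufE : forall u v, u \in E -> v \in proper_suffixes u -> v \in F)
  (smallF : forall u, u \notin F -> clen beta s u <= delta * rho ^+ size u)
  (smallF' : forall u, u \notin F -> clen beta s' u <= delta * rho ^+ size u)
  (lenF : forall u, u \in F -> `|clen beta s u - clen beta s' u| <= eta)
  (posF : forall (i : nat) (u : seq nat), i :: u \in F ++ E ->
            `|cpos beta s u i - cpos beta s' u i| <= eta)
  (uE : uniq E) (massE : 1 - delta <= \sum_(u <- E) cmass s u)
  (leftE : forall u, u \in E -> `|cleft s u - cleft s' u| <= eta)
  (cmassE : forall u, u \in E -> `|cmass s u - cmass s' u| <= eta).

Let sep := @cascade_separating R beta s beta0.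
Let sep' := @cascade_separating R beta s' beta0.

(** The left end of a cell moves by at most [eta], and its right end, a sum of two parameters, by at
    most [eta + eta]. Off these two strips the cells of [u] in both cascades agree. *)
Definition cell_boundary u : set R :=
  `[cleft s u, cleft s u + eta[%classic `|`
  `[cleft s u + cmass s u - (eta + eta), cleft s u + cmass s u[%classic.

Lemma cell_boundary_measure u :
  measurable (cell_boundary u) /\ (mu (cell_boundary u) <= (3 * eta)%:E)%E.
Proof.
have mI (a b : R) : a <= b -> mu `[a, b[%classic = (b - a)%:E.
  move=> ab; rewrite lebesgue_measure_itv/= lte_fin.
  by case: ltP => // ba; rewrite (_ : a = b) ?subrr//; apply/eqP; rewrite eq_le ab.
split; first by apply: measurableU; exact: measurable_itv.
rewrite /cell_boundary; set I1 := `[_, cleft s u + eta[%classic; set I2 := `[_, _[%classic.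
apply: (@le_trans _ _ (mu I1 + mu I2)%E).
  by apply: measureU2; exact: measurable_itv.
rewrite /I1 mI ?lerDl// /I2 mI; last by rewrite gerBl addr_ge0.
by rewrite -EFinD lee_fin; lra.
Qed.

Lemma cell_close u t : u \in E -> cell s u t -> ~ cell_boundary u t -> cell s' u t.
Proof.
move=> uE' /cellP/andP[ut tu] nb; have := leftE uE'; have := cmassE uE'.
rewrite !ler_norml => /andP[? ?] /andP[? ?]; apply/cellP.
have h1 : ~~ (t < cleft s u + eta).
  by apply/negP => h; apply: nb; left; rewrite /= in_itv/= ut.
have h2 : ~~ (cleft s u + cmass s u - (eta + eta) <= t).
  by apply/negP => h; apply: nb; right; rewrite /= in_itv/= tu h.
by move: h1 h2; rewrite -leNgt -ltNge => ? ?; apply/andP; split; lra.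
Qed.

Definition bad_set : set R :=
  (unit_itv `&` [set t | address s t N \notin E]) `|`
  \big[setU/set0]_(u <- E) cell_boundary u.

Lemma bad_set_measure :
  measurable bad_set /\ (mu bad_set <= (delta + (size E)%:R * (3 * eta))%:E)%E.
Proof.
have mu1 : measurable (unit_itv `&` [set t | address s t N \notin E]).
  exact: (@measurable_address R s N [set u | u \notin E]).
have mu2 : measurable (\big[setU/set0]_(u <- E) cell_boundary u).
  by apply: bigsetU_measurable => u _; have [h1 _] := cell_boundary_measure u; exact: h1.
split; first exact: measurableU.
apply: (@le_trans _ _ (mu (unit_itv `&` [set t | address s t N \notin E]) +
   mu (\big[setU/set0]_(u <- E) cell_boundary u))%E); first exact: measureU2.
rewrite EFinD; apply: leeD; last first.
  by apply: measure_bigsetU_le => u; have [h1 h2] := cell_boundary_measure u;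
    [exact: h1|exact: h2].
rewrite (address_measure s N (fun u => u \notin E)).
have := address_total_mass s N.
rewrite (esumID [set` E]); last by move=> u _; rewrite lee_fin cmass_ge0.
have -> : [set u | size u = N] `&` [set` E] = [set` E].
  by apply/seteqP; split=> u /= => [[]|uE'] //; rewrite sizeE.
rewrite (_ : [set u | size u = N] `&` ~` [set` E] =
  [set u | size u = N /\ u \notin E]); last first.
  by apply/seteqP; split=> u /= [-> /negP].
rewrite esum_fset; [|exact: finite_seq|by move=> u _; rewrite lee_fin cmass_ge0].
rewrite -fsbig_seq// sumEFin; set x := esum _ _ => xE.
have xfin : x \is a fin_num.
  by move: xE; case: x.
move: xE; rewrite -(fineK xfin) -EFinD => -[xE]; rewrite lee_fin.
by move: xE massE; set S := \sum_(u <- E) _; lra.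
Qed.

(** A good [t] has the same first [N] letters in both cascades. On [F], whose words are shorter than
    [N], the two limit points then differ only by attachment heights. *)
Lemma limit_coord_close t : 0 <= t < 1 -> ~ bad_set t ->
  nsum (fun u => `|limit_coord beta s t u - limit_coord beta s' t u|) <=
  (size F)%:R * eta + (delta / (1 - rho) + delta / (1 - rho)).
Proof.
move=> t01 nb; pose u := address s t N.
have uE' : u \in E.
  by apply/negPn/negP => h; apply: nb; left; split=> //; exact/unit_itvP.
have us : cell s u t by exact: cell_address.
have us' : cell s' u t.
  apply: cell_close => // h; apply: nb; right.
  by rewrite -bigcup_seq; exists u.
have Ws := word_tree_limit beta s t; have Ws' := word_tree_limit beta s' t.
have [_ tail] := word_tree_tail sep dec Ws delta0 smallF.
have [_ tail'] := word_tree_tail sep' dec' Ws' delta0 smallF'.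
have Ss := word_tree_summable sep dec Ws; have Ss' := word_tree_summable sep' dec' Ws'.
apply: le_trans (nsum_dist_split uF _ _ Ss Ss' tail tail') _.
- by case: Ss.
- by case: Ss'.
rewrite lerD2r -[leRHS](_ : \sum_(u <- F) eta = _); last first.
  by rewrite big_const_seq count_predT iter_addr_0 mulr_natl.
rewrite big_seq [leRHS]big_seq; apply: ler_sum => v vF.
have [vu|vu] := boolP (v \in proper_suffixes u).
  have /proper_suffixesP[w [i uwi]] := vu.
  rewrite (@limit_coord_cell R beta s w i) -?uwi//.
  rewrite (@limit_coord_cell R beta s' w i) -?uwi//; apply: posF.
  rewrite mem_cat; case: w uwi => [/= <-|j w uwi]; first by rewrite uE' orbT.
  rewrite (@sufE u)//; apply/proper_suffixesP.
  elim/last_ind: w {uwi} (uwi) => [|w k _] uwi; first by exists [::], j.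
  by exists (j :: w), k; rewrite uwi /= cat_rcons.
have zero r : cell r u t -> limit_coord beta r t v = 0.
  move=> ur; rewrite /limit_coord; case: eqP => // vE; move/negP : vu; case.
  have vN : (size v < size u)%N by rewrite (sizeE uE') sizeF.
  have uE2 : address r t (size u) = u by exact: address_cell.
  apply: suffix_proper; last by apply/negP => /eqP vu; move: vN; rewrite vu ltnn.
  by rewrite -vE -uE2 -(drop_address_le r t (ltnW vN)) suffix_drop.
by rewrite !zero// subrr normr0.
Qed.

Lemma ghp_dist_limit e :
  (size F)%:R * eta + (delta / (1 - rho) + delta / (1 - rho)) < e ->
  delta + (size E)%:R * (3 * eta) <= e ->
  (ghp_dist (limit_weighted beta0 dec) (limit_weighted beta0 dec') <= e%:E)%E.
Proof.
move=> e1 e2; have [/andP[r0 r1] _] := dec.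
have d0 : 0 <= delta / (1 - rho) by rewrite divr_ge0// subr_ge0 ltW.
have e0 : 0 < e.
  by apply: le_lt_trans e1; rewrite !addr_ge0// mulr_ge0.
pose f := @limit_val R beta rho s beta0 dec; pose g := @limit_val R beta rho s' beta0 dec'.
(* Stated for a generic ordered pair, as the Hausdorff distance needs transfers in both
   directions. *)
have tr (r r' : seq nat -> string_of_beads R) (Wx : decaying rho (clen beta r))
    (h1 : forall u, u \notin F -> clen beta r u <= delta * rho ^+ size u)
    (h2 : forall u, u \in F -> `|clen beta r u - clen beta r' u| <= eta)
    (h3 : forall (i : nat) (u : seq nat), i :: u \in F ->
      `|cpos beta r u i - cpos beta r' u i| <= eta)
    h : word_tree (clen beta r) (cpos beta r) h ->
    exists2 h', word_tree (clen beta r') (cpos beta r') h' &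
      nsum (fun u => `|h u - h' u|) < e.
  move=> Wh; have sepr := @cascade_separating R beta r beta0.
  exists (transfer (clen beta r') (cpos beta r') F h).
    exact: (transfer_word_tree F sepr (cpos_itv beta r') Wh).
  apply: le_lt_trans e1.
  apply: le_trans (transfer_dist sepr Wx (cpos_itv beta r') delta0 eta0 uF sufF h1 h2 h3 Wh) _.
  by rewrite addrA lerDl.
apply: (@ghp_dist_le R (limit_weighted beta0 dec) (limit_weighted beta0 dec') _ f g) => //.
- rewrite l1_mdistE (_ : (fun u => _) = fun=> 0); last first.
    by apply/funext => u /=; rewrite subrr normr0.
  have [_ ->] := @nsum_finite_support R _ (fun _ : seq nat => 0) [::] isT
    (fun=> lexx _) (fun _ _ => erefl).
  by rewrite big_nil ltW.
- move=> _ [x _ <-].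
  have [i u iuF|h' Wh' hh'] := tr s s' dec smallF lenF _ _ (limit_iotaW x).
    by apply: posF; rewrite mem_cat iuF.
  have [y yE] := limit_iota_surj beta0 dec' Wh'.
  exists (g y); first by exists y.
  rewrite metric_sym l1_mdistE; move: hh'; rewrite -yE; exact.
- move=> _ [x _ <-].
  have [u uF'|i u iuF|h' Wh' hh'] := tr s' s dec' smallF' _ _ _ (limit_iotaW x).
  - by rewrite distrC lenF.
  - by rewrite distrC; apply: posF; rewrite mem_cat iuF.
  have [y yE] := limit_iota_surj beta0 dec Wh'.
  exists (f y); first by exists y.
  rewrite metric_sym l1_mdistE; move: hh'; rewrite -yE; exact.
have [mbad bad] := bad_set_measure.
apply: (@prokhorov_coupling _ _ _ _ (fun t => f (limit_pt beta0 dec t))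
    (fun t => g (limit_pt beta0 dec' t)) bad_set) => //.
- exact: (address_continuous_measurable (limit_val_continuous beta0 dec)).
- exact: (address_continuous_measurable (limit_val_continuous beta0 dec')).
- by apply: le_trans bad _; rewrite lee_fin.
- by move=> t t01 nb; apply: le_lt_trans (limit_coord_close t01 nb) e1.
Qed.

End comparison.

(** * Sums over the words of a random cascade *)

Section independent_products.
Context {R : realType} d (Omega : measurableType d) (P : probability Omega R).
Context d' (S : measurableType d').
Import HBNNSimple.
Local Open Scope ereal_scope.

(** From indicators to simple functions by linearity, then to [f] by monotone convergence.
    Finiteness of the integral of [W] lets the product pass to the limit. *)
Lemma integral_comp_mul (X : Omega -> S) (W : Omega -> R) (f : S -> R) :
  measurable_fun setT X -> measurable_fun setT W -> (forall w, 0 <= W w)%R ->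
  measurable_fun setT f -> (forall x, 0 <= f x)%R ->
  \int[P]_w (W w)%:E \is a fin_num ->
  (forall A, measurable A ->
     \int[P]_w (\1_A (X w) * W w)%:E = P (X @^-1` A) * \int[P]_w (W w)%:E) ->
  \int[P]_w (f (X w) * W w)%:E = \int[P]_w (f (X w))%:E * \int[P]_w (W w)%:E.
Proof.
move=> mX mW W0 mf f0 Wfin hA.
have mWE : measurable_fun setT (fun w => (W w)%:E) by exact/measurable_EFinP.
pose g := nnsfun_approx measurableT ((measurable_EFinP _ _).2 mf).
have mgX n : measurable_fun setT (fun w => (g n (X w))%:E).
  by apply/measurable_EFinP; exact: measurableT_comp mX.
have simple n : \int[P]_w ((g n (X w))%:E * (W w)%:E) =
    \int[P]_w (g n (X w))%:E * \int[P]_w (W w)%:E.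
  set r := fset_set (range (g n)).
  have r0 (i : 'I_#|` r|) : (0 <= r`_i)%R.
    have : r`_i \in r by exact: mem_nth.
    by rewrite /r in_fset_set// inE => -[x _ <-]; exact: fun_ge0.
  have mA (i : 'I_#|` r|) : measurable (g n @^-1` [set r`_i]).
    exact: measurable_sfunP.
  have m1 (i : 'I_#|` r|) :
      measurable_fun setT (fun w => (\1_(g n @^-1` [set r`_i]) (X w))%:E : \bar R).
    by apply/measurable_EFinP; apply: measurableT_comp mX; exact: measurable_indic.
  have E w : (g n (X w))%:E =
      \sum_(i < #|` r|) (r`_i)%:E * (\1_(g n @^-1` [set r`_i]) (X w))%:E.
    by rewrite fimfunEord -sumEFin.
  have t0 (i : 'I_#|` r|) w : 0 <= (r`_i)%:E * (\1_(g n @^-1` [set r`_i]) (X w))%:E.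
    by rewrite mule_ge0// lee_fin.
  under eq_integral do rewrite E ge0_sume_distrl//.
  under [in RHS]eq_integral do rewrite E.
  rewrite ge0_integral_sum//; last 2 first.
  - move=> i; apply: emeasurable_funM => //; exact: measurable_funeM.
  - by move=> i w _; rewrite mule_ge0// lee_fin.
  rewrite ge0_integral_sum//; last by move=> i; exact: measurable_funeM.
  rewrite ge0_sume_distrl; last by move=> i _; exact: integral_ge0.
  apply: eq_bigr => i _.
  under eq_integral do rewrite -muleA.
  rewrite ge0_integralZl; [|exact: measurableT|exact: m1|
    by move=> w _; rewrite lee_fin|by rewrite lee_fin].
  rewrite ge0_integralZl; [|exact: measurableT|
    by apply: emeasurable_funM; [exact: m1|exact: mWE]|
    by move=> w _; rewrite mule_ge0// lee_fin|by rewrite lee_fin].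
  rewrite -muleA; congr (_ * _).
  under eq_integral do rewrite -EFinM.
  rewrite hA//; congr (_ * _).
  rewrite -[X @^-1` _]setIT -(integral_indic P measurableT)//.
  by rewrite -[X in measurable X]setTI; exact: mX.
have gcvg x : (g n x)%:E @[n --> \oo] --> (f x)%:E.
  by apply: (cvg_nnsfun_approx measurableT) => // z _; rewrite lee_fin.
have gnd x : nondecreasing_seq (fun n => (g n x)%:E).
  by move=> m n mn; rewrite lee_fin; exact/lefP/nd_nnsfun_approx.
have lim1 : \int[P]_w ((g n (X w))%:E * (W w)%:E) @[n --> \oo] -->
    \int[P]_w (f (X w) * W w)%:E.
  rewrite [X in _ --> X](_ : _ =
      \int[P]_w limn (fun n => (g n (X w))%:E * (W w)%:E)).
    apply: cvg_monotone_convergence => //.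
    - by move=> n; exact: emeasurable_funM.
    - by move=> n w _; rewrite mule_ge0// lee_fin.
    - by move=> w _ m n mn; rewrite lee_wpmul2r ?lee_fin//; exact: gnd.
  apply: eq_integral => w _; apply/esym/cvg_lim => //; rewrite EFinM.
  by apply: cvgeZr => //; exact: gcvg.
have lim2 : \int[P]_w (g n (X w))%:E @[n --> \oo] --> \int[P]_w (f (X w))%:E.
  rewrite [X in _ --> X](_ : _ = \int[P]_w limn (fun n => (g n (X w))%:E)).
    by apply: cvg_monotone_convergence => // n w _; rewrite lee_fin.
  by apply: eq_integral => w _; apply/esym/cvg_lim => //; exact: gcvg.
have /(cvg_unique (@ereal_hausdorff R) lim1) -> // :
  \int[P]_w ((g n (X w))%:E * (W w)%:E) @[n --> \oo] -->
  \int[P]_w (f (X w))%:E * \int[P]_w (W w)%:E.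
under eq_fun do rewrite simple.
exact: cvgeZr.
Qed.

Section products.
Context (I : choiceType) (X : I -> Omega -> S).
Hypotheses (mX : forall u, measurable_fun setT (X u)) (indX : independent P X).

Lemma measurable_prod_seq (J : seq I) (f : I -> Omega -> R) :
  (forall u, measurable_fun setT (f u)) ->
  measurable_fun setT (fun w => \prod_(u <- J) f u w)%R.
Proof.
move=> mf; elim: J => [|u J IH].
  by under eq_fun do rewrite big_nil; exact: measurable_cst.
by under eq_fun do rewrite big_cons; exact: measurable_funM.
Qed.

(** Indices move one at a time from indicators to general functions. For empty [J1] this is the
    definition of independence; the step needs the induction hypothesis with an extra indicator at
    [u], hence the mixed products. *)
Lemma integral_prod_independent_aux (J1 J2 : seq I) (f : I -> S -> R)
    (A : I -> set S) : uniq (J1 ++ J2) ->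
  (forall u, measurable_fun setT (f u)) -> (forall u x, 0 <= f u x)%R ->
  (forall u, u \in J1 -> \int[P]_w (f u (X u w))%:E < +oo) ->
  (forall u, measurable (A u)) ->
  \int[P]_w ((\prod_(u <- J1) f u (X u w)) * \prod_(u <- J2) \1_(A u) (X u w))%:E =
  (\big[*%E/1]_(u <- J1) \int[P]_w (f u (X u w))%:E) *
  \big[*%E/1]_(u <- J2) P (X u @^-1` A u).
Proof.
move=> uJ mf f0 foo; elim: J1 J2 A uJ foo => [|u J1 IH] J2 A uJ foo mA.
  under eq_integral do rewrite big_nil mul1r.
  rewrite big_nil mul1e.
  have memJ : [fset u in J2]%fset =i J2 by move=> u; rewrite inE.
  have pJ : perm_eq [fset u in J2]%fset J2 by exact: uniq_perm.
  rewrite -(perm_big _ pJ) -indX// -[in RHS](setIT (\bigcap_(i in _) _)).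
  rewrite -(integral_indic P measurableT); last first.
    apply: fin_bigcap_measurable; first exact: finite_fset.
    by move=> i _; rewrite -[X in measurable X]setTI; exact: mX.
  apply: eq_integral => w _; congr EFin; rewrite indicE.
  case: (boolP (w \in _)) => [/set_mem h|/negP h].
    rewrite big_seq big1// => u uJ2; rewrite indicE mem_set//.
    by apply: h => /=; rewrite memJ.
  apply/eqP/negPn/negP => h1; apply: h; rewrite inE => u /=; rewrite memJ => uJ2.
  apply: contrapT => nA; move/negP : h1; apply.
  by rewrite (big_rem u)//= indicE memNset ?mul0r.
have [uJ1 uJ'] : u \notin J1 ++ J2 /\ uniq (J1 ++ J2) by apply/andP.
have foo' v : v \in J1 -> \int[P]_w (f v (X v w))%:E < +oo.
  by move=> vJ; apply: foo; rewrite inE vJ orbT.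
pose W w := ((\prod_(v <- J1) f v (X v w)) * \prod_(v <- J2) \1_(A v) (X v w))%R.
have WE : \int[P]_w (W w)%:E = _ := IH J2 A uJ' foo' mA.
under eq_integral do rewrite big_cons -mulrA -/(W _).
rewrite big_cons -muleA -WE; apply: integral_comp_mul => //.
- apply: measurable_funM; apply: measurable_prod_seq => v.
    exact: measurableT_comp.
  by apply: measurableT_comp => //; exact: measurable_indic.
- move=> w; apply: mulr_ge0; apply: prodr_ge0 => v _ //.
- have finprod (J : seq I) (h : I -> \bar R) : (forall v, v \in J -> h v \is a fin_num) ->
      \big[*%E/1]_(v <- J) h v \is a fin_num.
    move=> hJ; rewrite big_seq; elim/big_ind : _ => //; exact: fin_numM.
  rewrite WE fin_numM//; apply: finprod => v vJ.
    rewrite ge0_fin_numE ?foo'//; apply: integral_ge0 => w _; rewrite lee_fin//.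
  by apply: fin_num_measure; rewrite -[X in measurable X]setTI; exact: mX.
move=> B mB; pose A' v := if v == u then B else A v.
have uJ2 : uniq (J1 ++ u :: J2) by rewrite -cat1s uniq_catCA.
have nu v : v \in J2 -> (v == u) = false.
  by move=> vJ; apply/eqP => vu; move: uJ1; rewrite mem_cat -vu vJ orbT.
have mA' v : measurable (A' v) by rewrite /A'; case: ifP.
have := IH (u :: J2) A' uJ2 foo' mA'.
have PE : \big[*%E/1]_(v <- J2) P (X v @^-1` A' v) =
    \big[*%E/1]_(v <- J2) P (X v @^-1` A v).
  by apply: eq_big_seq => v vJ; rewrite /A' nu.
rewrite big_cons PE [A' u]/A' eqxx.
rewrite muleCA -WE => <-; apply: eq_integral => w _; congr EFin.
rewrite big_cons [A' u]/A' eqxx mulrCA; congr (_ * (_ * _))%R.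
by apply: eq_big_seq => v vJ; rewrite /A' nu.
Qed.

Lemma integral_prod_independent (J : seq I) (f : I -> S -> R) : uniq J ->
  (forall u, measurable_fun setT (f u)) -> (forall u x, 0 <= f u x)%R ->
  (forall u, u \in J -> \int[P]_w (f u (X u w))%:E < +oo) ->
  \int[P]_w (\prod_(u <- J) f u (X u w))%:E =
  \big[*%E/1]_(u <- J) \int[P]_w (f u (X u w))%:E.
Proof.
move=> uJ mf f0 foo.
have := @integral_prod_independent_aux J [::] f (fun=> setT).
rewrite cats0 big_nil mule1 => <- //.
by apply: eq_integral => w _; rewrite big_nil mulr1.
Qed.

End products.
End independent_products.

Lemma same_law_integral {R : realType} d (Omega : measurableType d)
    (P : probability Omega R) d' (S : measurableType d') (X Y : Omega -> S)
    (f : S -> R) :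
  measurable_fun setT X -> measurable_fun setT Y -> same_law P X Y ->
  measurable_fun setT f -> (forall x, 0 <= f x) ->
  (\int[P]_w (f (X w))%:E = \int[P]_w (f (Y w))%:E)%E.
Proof.
move=> mX mY XY mf f0.
have h (Z : Omega -> S) : measurable_fun setT Z ->
    (\int[pushforward P Z]_x (f x)%:E = \int[P]_w (f (Z w))%:E)%E.
  move=> mZ; rewrite (ge0_integral_pushforward mZ)//.
  - exact/measurable_EFinP.
  - by move=> x _; rewrite lee_fin.
rewrite -!h//; apply: eq_measure_integral => A mA _; exact: XY.
Qed.

Lemma esum_mul_le {R : realType} (T : choiceType) (A : set T) (c : \bar R)
    (a : T -> \bar R) : (0 <= c)%E -> (forall i, 0 <= a i)%E ->
  (\esum_(i in A) (c * a i) <= c * \esum_(i in A) a i)%E.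
Proof.
move=> c0 a0; apply: ge_ereal_sup => _ [B [finB BA] <-].
rewrite fsbig_finite//= -ge0_sume_distrr//; apply: lee_wpmul2l => //.
rewrite -fsbig_finite//; apply: esum_ge; exists B => //.
Qed.

Section word_sums.
Context {R : realType} d (Omega : measurableType d) (P : probability Omega R).
Context d' (S : measurableType d').
Variables (X : seq nat -> Omega -> S) (f : nat -> nat -> S -> R) (g : S -> R).
Hypotheses (mX : forall u, measurable_fun setT (X u)) (iidX : iid P X).
Hypotheses (mf : forall k i, measurable_fun setT (f k i))
  (f0 : forall k i x, 0 <= f k i x)
  (mg : measurable_fun setT g) (g0 : forall x, 0 <= g x).
Local Open Scope ereal_scope.

(** Covers both multiplicative sums to come: scaled powers of bead masses, and masses of beads at
    position 0. The latter count only from a given level on, which is why factors depend on the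
    level. *)
Fixpoint weight (x : seq nat -> S) (u : seq nat) : R :=
  if u is i :: v then (weight x v * f (size v) i (x v))%R else 1%R.

Let mean k i := \int[P]_w (f k i (X [::] w))%:E.

Fixpoint mean_weight (u : seq nat) : \bar R :=
  if u is i :: v then mean_weight v * mean (size v) i else 1.

Variables (N : nat) (q : R).
Hypotheses (q01 : (0 < q < 1)%R)
  (mean_le1 : forall k, \esum_(i in [set: nat]) mean k i <= 1)
  (mean_leq : forall k, (N <= k)%N -> \esum_(i in [set: nat]) mean k i <= q%:E)
  (goo : \int[P]_w (g (X [::] w))%:E < +oo).

Let mean_ge0 k i : 0 <= mean k i.
Proof. by apply: integral_ge0 => w _; rewrite lee_fin. Qed.

Let mean_fin k i : mean k i < +oo.
Proof.
apply: le_lt_trans (ltry 1); apply: le_trans (mean_le1 k).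
apply: esum_ge; exists [set i]; first by split=> //; exact: finite_set1.
by rewrite fsbig_set1.
Qed.

Lemma weight_ge0 x u : (0 <= weight x u)%R.
Proof. by elim: u => //= i u IH; rewrite mulr_ge0. Qed.

Lemma measurable_weight u : measurable_fun setT (fun w => weight (X^~ w) u).
Proof.
elim: u => [|i u IH] /=; first exact: measurable_cst.
by apply: measurable_funM => //; exact: measurableT_comp.
Qed.

Lemma mean_weight_ge0 u : 0 <= mean_weight u.
Proof. by elim: u => //= i u IH; rewrite mule_ge0. Qed.

Let law_integral (h : S -> R) u v : measurable_fun setT h ->
  (forall x, 0 <= h x)%R ->
  \int[P]_w (h (X u w))%:E = \int[P]_w (h (X v w))%:E.
Proof. by move=> mh h0; apply: same_law_integral => //; exact: iidX.2. Qed.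

(** The weight of [u] involves only the strings at proper suffixes of [u]. The extra product over
    other words lets the induction absorb the last factor of the weight. *)
Lemma integral_weight_aux u (J : seq (seq nat)) (h : seq nat -> S -> R) :
  uniq J -> (forall v, v \in J -> v \notin proper_suffixes u) ->
  (forall v, measurable_fun setT (h v)) -> (forall v x, 0 <= h v x)%R ->
  (forall v, v \in J -> \int[P]_w (h v (X v w))%:E < +oo) ->
  \int[P]_w (weight (X^~ w) u * \prod_(v <- J) h v (X v w))%:E =
  mean_weight u * \big[*%E/1]_(v <- J) \int[P]_w (h v (X v w))%:E.
Proof.
elim: u J h => [|i u IH] J h uJ Ju mh h0 hoo /=.
  under eq_integral do rewrite mul1r; rewrite mul1e.
  exact: (integral_prod_independent mX iidX.1).
have uu : u \in proper_suffixes (i :: u) by exact: (proper_suffixes_cat [::]).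
have nuJ : u \notin J by apply/negP => /Ju; rewrite uu.
have nu v : v \in J -> (v == u) = false.
  by move=> vJ; apply/eqP => vu; move: nuJ; rewrite -vu vJ.
pose h' v := if v == u then f (size u) i else h v.
have hoo' v : v \in u :: J -> \int[P]_w (h' v (X v w))%:E < +oo.
  rewrite inE /h' => /predU1P[->|vJ]; last by rewrite nu//; exact: hoo.
  by rewrite eqxx (law_integral u [::])//; exact: mean_fin.
have := IH (u :: J) h' _ _ _ _ hoo'; rewrite /= nuJ uJ => /(_ isT) H.
transitivity (\int[P]_w (weight (X^~ w) u * \prod_(v <- u :: J) h' v (X v w))%:E).
  apply: eq_integral => w _; rewrite big_cons [h' u]/h' eqxx mulrA.
  congr (_ * _)%:E; apply: eq_big_seq => v vJ; by rewrite /h' nu.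
rewrite H.
- rewrite big_cons [h' u]/h' eqxx -muleA (law_integral u [::])//.
  congr (_ * (_ * _)); apply: eq_big_seq => v vJ; by rewrite /h' nu.
- move=> v; rewrite inE => /predU1P[->|vJ]; apply/negP => vu.
    by have := size_proper_suffix vu; rewrite ltnn.
  by move/negP : (Ju _ vJ); apply; exact: proper_suffixes_trans vu uu.
- by move=> v; rewrite /h'; case: ifP.
- by move=> v x; rewrite /h'; case: ifP.
Qed.

Lemma integral_weight u :
  \int[P]_w (weight (X^~ w) u * g (X u w))%:E =
  mean_weight u * \int[P]_w (g (X [::] w))%:E.
Proof.
have := @integral_weight_aux u [:: u] (fun=> g).
rewrite big_seq1 (law_integral u [::])// => <- //.
- by apply: eq_integral => w _; rewrite big_seq1.
- by move=> v; rewrite inE => /eqP ->; apply/negP => /size_proper_suffix; rewrite ltnn.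
- by move=> v _; rewrite (law_integral v [::]).
Qed.

Definition level_mean n := \esum_(u in [set u | size u = n]) mean_weight u.

Lemma level_meanS n :
  level_mean n.+1 <= level_mean n * \esum_(i in [set: nat]) mean n i.
Proof.
have -> : level_mean n.+1 =
    \esum_(u in [set u | size u = n]) \esum_(i in [set: nat]) mean_weight u * mean n i.
  rewrite esum_esum; last by move=> u i _ _; rewrite mule_ge0 ?mean_weight_ge0.
  rewrite /level_mean (reindex_esum ([set u | size u = n] `*`` fun=> setT)
    [set u | size u = n.+1] (fun p : seq nat * nat => p.2 :: p.1)).
    by apply: eq_esum => -[u i] /= [<- _].
  split=> [[u i] [/= -> _]|[u i] [v j] _ _ [-> ->]|[//|i u] /= [un]] //.
  by exists (u, i).
set Q := \esum_(i in setT) mean n i.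
have Q0 : 0 <= Q by exact: esum_ge0.
apply: (@le_trans _ _ (\esum_(u in [set u | size u = n]) (Q * mean_weight u))).
  apply: le_esum => u _; rewrite (muleC Q).
  by apply: esum_mul_le => //; exact: mean_weight_ge0.
by rewrite (muleC _ Q); apply: esum_mul_le => //; exact: mean_weight_ge0.
Qed.

Lemma level_mean_ge0 n : 0 <= level_mean n.
Proof. by apply: esum_ge0 => u _; exact: mean_weight_ge0. Qed.

Lemma level_mean_le n : level_mean n <= (q ^- N * q ^+ n)%:E.
Proof.
have /andP[q0 q1] := q01.
(* The first [N] levels need not contract and are only bounded by 1; contraction by [q] starts at
   level [N], whence the constant [q ^- N]. *)
have le1 k : level_mean k <= 1.
  elim: k => [|k IH].
    rewrite /level_mean (_ : [set u | size u = 0%N] = [set [::]]) ?esum_set1//.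
    by apply/seteqP; split=> [u /size0nil ->|u ->].
  apply: le_trans (level_meanS k) _; rewrite -[leRHS]mule1.
  by apply: lee_pmul => //; [exact: level_mean_ge0|exact: esum_ge0].
have geN k : level_mean (k + N) <= (q ^+ k)%:E.
  elim: k => [|k IH]; first exact: le1.
  rewrite addSn; apply: le_trans (level_meanS _) _; rewrite exprSr EFinM.
  apply: lee_pmul => //; [exact: level_mean_ge0|exact: esum_ge0|].
  by apply: mean_leq; rewrite leq_addl.
have [nN|Nn] := leqP N n.
  rewrite -(subnK nN); apply: le_trans (geN _) _.
  by rewrite lee_fin exprD mulrCA mulVf ?mulr1// expf_neq0// gt_eqF.
apply: le_trans (le1 n) _; rewrite lee_fin mulrC ler_pdivlMr ?exprn_gt0// mul1r.
by apply: ler_wiXn2l; [exact: ltW|exact: ltW|exact: ltnW].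
Qed.

(** By Tonelli the expectation of the sum is a sum over levels that decays geometrically; a finite
    expectation makes the sum finite almost surely. *)
Lemma weight_sum_finite : {ae P, forall w,
  \esum_(u in [set: seq nat]) (weight (X^~ w) u * g (X u w))%:E < +oo}.
Proof.
have /andP[q0 q1] := q01.
pose a u w := (weight (X^~ w) u * g (X u w))%R.
have a0 u w : (0 <= a u w)%R by rewrite mulr_ge0 ?weight_ge0.
have ma u : measurable_fun setT (a u).
  by apply: measurable_funM; [exact: measurable_weight|exact: measurableT_comp].
have bij : set_bij setT setT CodeSeq.decode.
  split=> //; last by move=> u _; exists (CodeSeq.code u) => //; rewrite CodeSeq.codeK.
  by move=> i j _ _ /(congr1 CodeSeq.code); rewrite !CodeSeq.decodeK.
pose F w := \sum_(k <oo) (a (CodeSeq.decode k) w)%:E.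
have FE w : \esum_(u in setT) (a u w)%:E = F w.
  rewrite (reindex_esum setT setT CodeSeq.decode)// -nneseries_esumT//.
  by move=> k; rewrite lee_fin.
have F0 w : 0 <= F w by apply: nneseries_ge0 => k _ _; rewrite lee_fin.
have mF : measurable_fun setT F.
  apply: (ge0_emeasurable_sum (P := xpredT)) => [k w _ _|k _].
    by rewrite lee_fin.
  exact/measurable_EFinP.
have total : \esum_(u in [set: seq nat]) mean_weight u <= (q ^- N * (1 - q)^-1)%:E.
  have -> : [set: seq nat] = \bigcup_n [set u | size u = n].
    by apply/seteqP; split=> // u _; exists (size u).
  rewrite nneseries_sum_bigcup; last 2 first.
  - apply/trivIsetP => i j _ _ /eqP ij; apply/seteqP; split=> // u [/= ui uj].
    by apply: ij; rewrite -ui -uj.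
  - exact: mean_weight_ge0.
  apply: lime_le; first by apply: is_cvg_nneseries => n _ _; exact: level_mean_ge0.
  apply: nearW => n; apply: (@le_trans _ _ (\sum_(0 <= k < n) (q ^- N * q ^+ k)%:E)).
    by apply: lee_sum => k _; exact: level_mean_le.
  rewrite sumEFin lee_fin -mulr_sumr; apply: ler_wpM2l.
    by rewrite invr_ge0 exprn_ge0// ltW.
  exact: (geometric_sum_le q01 (iota_uniq _ _)).
have intF : \int[P]_w F w < +oo.
  rewrite integral_nneseries//; last 2 first.
  - by move=> k; exact/measurable_EFinP.
  - by move=> k w _; rewrite lee_fin.
  under eq_eseriesr do rewrite integral_weight.
  have Goo := goo; set G := \int[P]_w _ in Goo *.
  have G0 : 0 <= G by apply: integral_ge0 => w _; rewrite lee_fin.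
  rewrite nneseries_esumT; last by move=> k; rewrite mule_ge0// mean_weight_ge0.
  rewrite -(reindex_esum setT setT CodeSeq.decode (fun u => mean_weight u * G))//.
  under eq_esum do rewrite muleC.
  apply: le_lt_trans (esum_mul_le _ G0 mean_weight_ge0) _.
  apply: (@le_lt_trans _ _ (G * (q ^- N * (1 - q)^-1)%:E)); first exact: lee_wpmul2l.
  have Gf : G \is a fin_num by rewrite ge0_fin_numE.
  by rewrite -(fineK Gf) -EFinM ltry.
have : P.-integrable setT F.
  apply/integrableP; split=> //; under eq_integral do rewrite gee0_abs//.
  exact: intF.
move=> /integrable_ae => /(_ measurableT); apply: filterS => w /(_ I).
by rewrite FE ge0_fin_numE.
Qed.

End word_sums.

Section summable_words.
Context {R : realType}.

Lemma summable0_small (a : seq nat -> R) (e : R) : summable0 a -> 0 < e ->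
  exists K, forall u, (K <= CodeSeq.code u)%N -> a u <= e.
Proof.
move=> Sa e0; apply: contrapT => /forallNP h.
have build n : exists J : seq (seq nat), [/\ uniq J, size J = n &
    forall u, u \in J -> e < a u].
  elim: n => [|n [J [uJ sJ Ja]]]; first by exists [::].
  have /existsNP[u /not_implyP[uK /negP ua]] := h (\sum_(v <- J) CodeSeq.code v).+1.
  exists (u :: J); split=> /=; last 2 first.
  - by rewrite sJ.
  - by move=> v; rewrite inE => /predU1P[->|/Ja//]; rewrite ltNge.
  rewrite uJ andbT; apply/negP => uJ'; move: uK.
  by rewrite (big_rem u)//= ltnNge leq_addr.
have a0 : 0 <= nsum a by exact: nsum_ge0.
have [J [uJ sJ Ja]] := build (Num.truncn (nsum a / e)).+1.
have := nsum_ge Sa uJ; rewrite leNgt => /negP; apply.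
apply: (@lt_le_trans _ _ (\sum_(u <- J) e)).
  rewrite big_const_seq count_predT iter_addr_0 sJ -mulr_natl -ltr_pdivrMr//.
  by rewrite truncnS_gt.
by rewrite big_seq [leRHS]big_seq; apply: ler_sum => u /Ja /ltW.
Qed.

Lemma level_sum_small (a : seq nat -> R) (e : R) : summable0 a -> 0 < e ->
  exists n, (\esum_(u in [set u | size u = n]) (a u)%:E <= e%:E)%E.
Proof.
move=> [a0 aoo] e0; apply: contrapT => /forallNP h.
have L0 n : (0 <= \esum_(u in [set u | size u = n]) (a u)%:E)%E.
  by apply: esum_ge0 => u _; rewrite lee_fin.
have total : (\esum_(u in [set: seq nat]) (a u)%:E =
    \sum_(n <oo) \esum_(u in [set u | size u = n]) (a u)%:E)%E.
  have -> : [set: seq nat] = \bigcup_n [set u | size u = n].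
    by apply/seteqP; split=> // u _; exists (size u).
  rewrite nneseries_sum_bigcup//.
  apply/trivIsetP => i j _ _ /eqP ij; apply/seteqP; split=> // u [/= ui uj].
  by apply: ij; rewrite -ui -uj.
have ge m : ((m%:R * e)%:E <= \esum_(u in [set: seq nat]) (a u)%:E)%E.
  rewrite total; apply: le_trans (nneseries_lim_ge m _); last by move=> n _ _.
  elim: m => [|m IH]; first by rewrite mul0r big_geq.
  rewrite big_nat_recr//= -natr1 mulrDl mul1r EFinD; apply: leeD => //.
  by rewrite leNgt; apply/negP => /ltW; exact: h.
have afin : (\esum_(u in [set: seq nat]) (a u)%:E)%E \is a fin_num.
  by rewrite ge0_fin_numE//; apply: esum_ge0 => u _; rewrite lee_fin.
have := ge (Num.truncn (fine (\esum_(u in [set: seq nat]) (a u)%:E)%E / e)).+1.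
rewrite -{2}(fineK afin) lee_fin -ler_pdivlMr// leNgt => /negP; apply.
by rewrite truncnS_gt.
Qed.

End summable_words.

Section string_measurability.
Context {R : realType}.
Local Notation S := (string_of_beads R).

Lemma measurable_string_coordinate (f : S -> R) :
  [\/ f = @string_length R,
      exists i, f = (fun s => bead_pos s i) |
      exists i, f = (fun s => bead_mass s i)] ->
  measurable_fun [set: S] f.
Proof.
move=> fP _ B mB; rewrite setTI; apply: sub_sigma_algebra.
by exists f, B; split.
Qed.

Lemma measurable_string_length : measurable_fun [set: S] (@string_length R).
Proof. by apply: measurable_string_coordinate; constructor 1. Qed.

Lemma measurable_bead_pos i : measurable_fun [set: S] (fun s => bead_pos s i).
Proof. by apply: measurable_string_coordinate; constructor 2; exists i. Qed.

Lemma measurable_bead_mass i : measurable_fun [set: S] (fun s => bead_mass s i).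
Proof. by apply: measurable_string_coordinate; constructor 3; exists i. Qed.

Lemma bead_mass_le0 (s : S) i : bead_mass s i <= bead_mass s 0%N.
Proof. exact: bead_mass_noninc. Qed.

Lemma bead_mass_sum_le1 (s : S) n : \sum_(0 <= i < n) bead_mass s i <= 1.
Proof. exact: (@bead_sum_le1 _ (fun=> s) [::]). Qed.

End string_measurability.

(** * The three almost sure conditions *)

Section almost_sure_conditions.
Context {R : realType} d (Omega : measurableType d) (P : probability Omega R).
Local Open Scope ereal_scope.

Lemma integral_lt1 (h : Omega -> R) : measurable_fun setT h ->
  (forall w, 0 <= h w < 1)%R -> exists2 q, (0 < q < 1)%R & \int[P]_w (h w)%:E <= q%:E.
Proof.
move=> mh h01.
have h0 w : (0 <= h w)%R by case/andP: (h01 w).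
have h1 w : (h w < 1)%R by case/andP: (h01 w).
have mhE : measurable_fun setT (fun w => (h w)%:E) by exact/measurable_EFinP.
have mh' : measurable_fun setT (fun w => (1 - h w)%:E).
  by apply/measurable_EFinP; exact: measurable_funB.
have I1 : \int[P]_w (h w)%:E + \int[P]_w (1 - h w)%:E = 1.
  rewrite -ge0_integralD//; last 2 first.
  - by move=> w _; rewrite lee_fin.
  - by move=> w _; rewrite lee_fin subr_ge0 ltW.
  under eq_integral do rewrite -EFinD addrC subrK.
  by rewrite integral_cst// mul1e; exact: probability_setT.
have J0 : 0 <= \int[P]_w (1 - h w)%:E.
  by apply: integral_ge0 => w _; rewrite lee_fin subr_ge0 ltW.
have I0 : 0 <= \int[P]_w (h w)%:E by apply: integral_ge0 => w _; rewrite lee_fin.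
have Jn0 : \int[P]_w (1 - h w)%:E != 0.
  apply/eqP => J00; have : \int[P]_w `|(1 - h w)%:E| = 0.
    rewrite -[RHS]J00; apply: eq_integral => w _.
    by rewrite gee0_abs// lee_fin subr_ge0 ltW.
  move=> /(ae_eq_integral_abs P measurableT mh')[A [mA A0 AP]].
  have AT : A = setT.
    apply/seteqP; split=> // w _; apply: AP => /= /(_ I) [] /eqP.
    by rewrite subr_eq0 gt_eqF.
  have PA : P A = 1 by rewrite AT; exact: probability_setT.
  by have /eqP := eq_trans (esym PA) A0; rewrite onee_eq0.
move: I1 J0 I0 Jn0.
case: (\int[P]_w (h w)%:E) => [x| |]; case: (\int[P]_w (1 - h w)%:E) => [y| |] //.
rewrite -EFinD => -[xy]; rewrite !lee_fin eqe => y0 x0 yn0.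
have y1 : (0 < y)%R by rewrite lt_neqAle eq_sym yn0.
(* The midpoint between the integral and 1 is positive even if the integral is 0. *)
by exists ((x + 1) / 2)%R; [apply/andP; split; lra|rewrite lee_fin; lra].
Qed.

Lemma mean_sum_le d' (S : measurableType d') (X : Omega -> S)
    (f : nat -> S -> R) (h : S -> R) :
  measurable_fun setT X -> (forall i, measurable_fun setT (f i)) ->
  (forall i x, 0 <= f i x)%R -> measurable_fun setT h ->
  (forall n x, \sum_(0 <= i < n) f i x <= h x)%R ->
  \esum_(i in [set: nat]) \int[P]_w (f i (X w))%:E <= \int[P]_w (h (X w))%:E.
Proof.
move=> mX mf f0 mh fh.
have h0 x : (0 <= h x)%R by have := fh 0%N x; rewrite big_geq.
have mfX i : measurable_fun setT (fun w => (f i (X w))%:E).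
  by apply/measurable_EFinP; exact: measurableT_comp.
rewrite -nneseries_esumT; last first.
  by move=> i; apply: integral_ge0 => w _; rewrite lee_fin.
rewrite -integral_nneseries//; last by move=> i w _; rewrite lee_fin.
apply: ge0_le_integral => //.
- by move=> w _; apply: nneseries_ge0 => i _ _; rewrite lee_fin.
- apply: (ge0_emeasurable_sum (P := xpredT)) => [k w _ _|k _]; last exact: mfX.
  by rewrite lee_fin.
- by apply/measurable_EFinP; exact: measurableT_comp.
move=> w _; apply: lime_le; first by apply: is_cvg_nneseries => i _ _; rewrite lee_fin.
by apply: nearW => n; rewrite sumEFin lee_fin.
Qed.

Local Notation S := (string_of_beads R).
Variables (p beta : R) (xi : seq nat -> Omega -> S).
Hypotheses (p1 : (1 <= p)%R) (bp : (1 / p < beta)%R)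
  (mxi : forall u, measurable_fun [set: Omega] (xi u)) (iidxi : iid P xi)
  (moment : 'E_P[fun w => (string_length (xi [::] w) `^ p)%R] < +oo).

Lemma beta_p_gt1 : (1 < beta * p)%R.
Proof. by rewrite -ltr_pdivrMr// (lt_le_trans ltr01). Qed.

Lemma beta_gt0 : (0 < beta)%R.
Proof. by apply: lt_trans bp; rewrite divr_gt0// (lt_le_trans ltr01). Qed.

Let power (k : nat) i (s : S) : R := (bead_mass s i `^ (beta * p))%R.

Let measurable_power k i : measurable_fun setT (power k i).
Proof. by apply: (measurableT_comp (measurable_powR _)); exact: measurable_bead_mass. Qed.

(** One factor of each mass is kept to sum to at most 1, and the remaining power, of positive
    exponent, is bounded by that of the heaviest bead, which is less than 1. *)
Let power_sum_le k n s :
  (\sum_(0 <= i < n) power k i s <= bead_mass s 0%N `^ (beta * p - 1))%R.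
Proof.
have b1 := beta_p_gt1.
apply: (@le_trans _ _ (\sum_(0 <= i < n) bead_mass s i * bead_mass s 0%N `^ (beta * p - 1))%R).
  apply: ler_sum => i _; rewrite /power -mulr_powRB1 ?bead_mass_ge0 ?(lt_trans ltr01)//.
  rewrite ler_wpM2l ?bead_mass_ge0// ge0_ler_powR ?subr_ge0 ?(ltW b1)//.
  - by rewrite nnegrE bead_mass_ge0.
  - by rewrite nnegrE bead_mass_ge0.
  - exact: bead_mass_le0.
by rewrite -mulr_suml ler_piMl ?powR_ge0// bead_mass_sum_le1.
Qed.

Let measurable_first_power a : measurable_fun setT (fun s : S => bead_mass s 0%N `^ a)%R.
Proof. by apply: (measurableT_comp (measurable_powR _)); exact: measurable_bead_mass. Qed.

Lemma power_mean_lt1 : exists2 q, (0 < q < 1)%R & forall k,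
  \esum_(i in [set: nat]) \int[P]_w (power k i (xi [::] w))%:E <= q%:E.
Proof.
have b1 := beta_p_gt1.
have [|w|q q01 qP] := @integral_lt1
  (fun w => bead_mass (xi [::] w) 0%N `^ (beta * p - 1))%R.
- exact: (measurableT_comp (measurable_first_power _)).
- rewrite powR_ge0/=.
  have := @gt0_ltr_powR R (beta * p - 1)%R; rewrite subr_gt0 => /(_ b1).
  move=> /(_ (bead_mass (xi [::] w) 0%N) 1%R); rewrite !nnegrE powR1.
  by apply => //; [exact: bead_mass_ge0|exact: bead_mass_lt1].
exists q => // k; apply: le_trans qP.
apply: (mean_sum_le (h := fun s => bead_mass s 0%N `^ (beta * p - 1))%R) => //.
by move=> i x; exact: powR_ge0.
Qed.

Let weight_power (x : seq nat -> S) (c : R) u :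
  weight (fun k i s => c * power k i s)%R x u =
  (c ^+ size u * cmass x u `^ (beta * p))%R.
Proof.
elim: u => /= [|i u ->]; first by rewrite powR1 mulr1.
by rewrite powRM ?cmass_ge0 ?bead_mass_ge0// exprSr mulrACA.
Qed.

Lemma ae_mass_small : {ae P, forall w, forall e, (0 < e)%R -> exists K, forall u,
  (K <= CodeSeq.code u)%N -> (cmass (xi^~ w) u <= e)%R}.
Proof.
have b1 := beta_p_gt1; have [q q01 qP] := power_mean_lt1.
have q1 k : \esum_(i in [set: nat]) \int[P]_w (1 * power k i (xi [::] w))%:E <= q%:E.
  by under eq_esum do under eq_integral do rewrite mul1r.
have mf k i : measurable_fun setT (fun s => 1 * power k i s)%R.
  by apply: measurable_funM => //; exact: measurable_cst.
have f0 k i s : (0 <= 1 * power k i s)%R by rewrite mul1r powR_ge0.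
have le1 k : \esum_(i in [set: nat]) \int[P]_w (1 * power k i (xi [::] w))%:E <= 1.
  by apply: le_trans (q1 k) _; rewrite lee_fin ltW//; case/andP: q01.
have goo : \int[P]_w (1 : R)%:E < +oo.
  rewrite integral_cst// mul1e.
  by apply: (@le_lt_trans _ _ 1); [exact: probability_le1|exact: ltry].
have := weight_sum_finite (g := fun=> 1%R) mxi iidxi mf f0 (measurable_cst _)
  (fun=> ler01) (N := 0) q01 le1 (fun k _ => q1 k) goo.
apply: filterS => w fin e e0.
have Sa : summable0 (fun u => cmass (xi^~ w) u `^ (beta * p))%R.
  split=> [u|]; first exact: powR_ge0.
  apply: le_lt_trans fin; apply: le_esum => u _.
  by rewrite weight_power expr1n mul1r mulr1.
have [|K KP] := summable0_small (e := (e `^ (beta * p))%R) Sa; first exact: powR_gt0.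
exists K => u /KP; rewrite !leNgt; apply: contra => eu.
apply: gt0_ltr_powR => //; rewrite ?nnegrE ?cmass_ge0 ?(ltW e0)//.
exact: lt_trans b1.
Qed.

Lemma ae_decaying : exists rho, {ae P, forall w, decaying rho (clen beta (xi^~ w))}.
Proof.
have b1 := beta_p_gt1; have [q /andP[q0 q1] qP] := power_mean_lt1.
have p0 : (0 < p)%R by exact: lt_le_trans p1.
(* Any [r] strictly between [q] and 1 would do: the means multiplied by [r^-1] still sum to at most
   [r^-1 * q < 1]. Taking p-th roots turns [r ^+ size u] into [rho ^+ size u]. *)
pose r := ((1 + q) / 2)%R; have r0 : (0 < r)%R by rewrite /r; lra.
have r1 : (r < 1)%R by rewrite /r; lra.
have qr : (q < r)%R by rewrite /r; lra.
pose rho := (r `^ (p^-1))%R.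
have rho0 : (0 < rho)%R by exact: powR_gt0.
have rhop : (rho `^ p = r)%R by rewrite -powRrM mulVf ?powRr1 ?gt_eqF// ltW.
have rho1 : (rho < 1)%R.
  rewrite ltNge; apply/negP => h; have := @ge0_ler_powR R p (ltW p0) 1%R rho.
  rewrite !nnegrE ler01 (ltW rho0) h powR1 rhop => /(_ isT isT isT); lra.
have qr01 : (0 < r^-1 * q < 1)%R.
  by rewrite mulr_gt0 ?invr_gt0//= mulrC ltr_pdivrMr// mul1r.
have qr1 k : \esum_(i in [set: nat]) \int[P]_w (r^-1 * power k i (xi [::] w))%:E
    <= (r^-1 * q)%:E.
  have ri : 0 <= (r^-1)%:E by rewrite lee_fin invr_ge0 ltW.
  have E i : \int[P]_w (r^-1 * power k i (xi [::] w))%:E =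
      (r^-1)%:E * \int[P]_w (power k i (xi [::] w))%:E.
    under eq_integral do rewrite EFinM.
    rewrite ge0_integralZl//.
    - by apply/measurable_EFinP; exact: measurableT_comp.
    - by move=> w _; rewrite lee_fin powR_ge0.
  under eq_esum do rewrite E.
  apply: le_trans (esum_mul_le _ ri _) _.
    by move=> i; apply: integral_ge0 => w _; rewrite lee_fin powR_ge0.
  by rewrite EFinM; apply: lee_wpmul2l => //; exact: qP.
have mf k i : measurable_fun setT (fun s => r^-1 * power k i s)%R.
  by apply: measurable_funM => //; exact: measurable_cst.
have f0 k i s : (0 <= r^-1 * power k i s)%R by rewrite mulr_ge0 ?invr_ge0 ?powR_ge0// ltW.
have le1 k : \esum_(i in [set: nat]) \int[P]_w (r^-1 * power k i (xi [::] w))%:E <= 1.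
  by apply: le_trans (qr1 k) _; rewrite lee_fin ltW//; case/andP: qr01.
have mg : measurable_fun setT (fun s : S => string_length s `^ p)%R.
  by apply: (measurableT_comp (measurable_powR _)); exact: measurable_string_length.
have goo : \int[P]_w (string_length (xi [::] w) `^ p)%:E < +oo.
  by move: moment; rewrite unlock.
exists rho.
have := weight_sum_finite mxi iidxi mf f0 mg (fun s => powR_ge0 (string_length s) p)
  (N := 0) qr01 le1 (fun k _ => qr1 k) goo.
apply: filterS => w fin; split; first by rewrite rho0.
move=> e e0.
pose a u := (r^-1 ^+ size u * cmass (xi^~ w) u `^ (beta * p) *
             string_length (xi u w) `^ p)%R.
have Sa : summable0 a.
  split=> [u|].
    by rewrite /a !mulr_ge0 ?powR_ge0// exprn_ge0// invr_ge0 ltW.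
  by apply: le_lt_trans fin; apply: le_esum => u _; rewrite weight_power.
have [|K KP] := summable0_small (e := (e `^ p)%R) Sa; first exact: powR_gt0.
exists K => u /KP aue.
have cl : (clen beta (xi^~ w) u `^ p = r ^+ size u * a u)%R.
  rewrite /clen powRM ?powR_ge0 ?ltW ?string_length_gt0// -powRrM /a.
  by rewrite !mulrA -exprMn mulfV ?gt_eqF// expr1n mul1r.
have er : ((e * rho ^+ size u) `^ p = r ^+ size u * e `^ p)%R.
  rewrite powRM ?exprn_ge0 ?ltW// mulrC -powR_mulrn ?ltW// powRAC rhop.
  by rewrite powR_mulrn ?ltW.
have le : (clen beta (xi^~ w) u `^ p <= (e * rho ^+ size u) `^ p)%R.
  by rewrite cl er ler_wpM2l// exprn_ge0// ltW.
rewrite leNgt; apply/negP => lt.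
have : ((e * rho ^+ size u) `^ p < clen beta (xi^~ w) u `^ p)%R.
  apply: gt0_ltr_powR => //; rewrite nnegrE ?clen_ge0// mulr_ge0 ?exprn_ge0 ?ltW//.
by rewrite ltNge le.
Qed.

Let zero_factor N (k : nat) i (s : S) : R :=
  (bead_mass s i * ((k < N)%N || (bead_pos s i == 0))%:R)%R.

Let zero_factor_ge0 N k i s : (0 <= zero_factor N k i s)%R.
Proof. by rewrite mulr_ge0 ?bead_mass_ge0. Qed.

Let measurable_zero_factor N k i : measurable_fun setT (zero_factor N k i).
Proof.
apply: measurable_funM; first exact: measurable_bead_mass.
have [kN|kN] := boolP (k < N)%N; first exact: measurable_cst.
rewrite (_ : (fun s => _) = \1_((fun s : S => bead_pos s i) @^-1` [set 0%R])) /=.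
  apply: measurable_indic; rewrite -[X in measurable X]setTI.
  exact: measurable_bead_pos.
apply/funext => s; rewrite indicE /=; have [h|h] := eqVneq (bead_pos s i) 0%R.
  by rewrite mem_set.
by rewrite memNset//=; apply/eqP.
Qed.

Let weight_zero_factor N (x : seq nat -> S) u :
  weight (zero_factor N) x u = (cmass x u * (zero_tail x N u)%:R)%R.
Proof.
elim: u => /= [|i u ->]; first by rewrite mulr1.
by rewrite /zero_factor mulrACA -natrM mulnb andbC.
Qed.

(* At most one bead of a string sits at its root, so the mass at the root is at
   most that of the heaviest bead. *)
Let zero_factor_sum_le N k n s : (N <= k)%N ->
  (\sum_(0 <= i < n) zero_factor N k i s <= bead_mass s 0%N)%R.
Proof.
move=> Nk; have kN : (k < N)%N = false by rewrite ltnNge Nk.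
have [[j j0]|nex] := pselect (exists j, bead_pos s j = 0%R); last first.
  rewrite big1 ?bead_mass_ge0// => i _; rewrite /zero_factor kN/=.
  by have [h|_] := eqVneq (bead_pos s i) 0%R; rewrite ?mulr0//; exfalso; apply: nex; exists i.
have z i : zero_factor N k i s = if i == j then bead_mass s j else 0%R.
  rewrite /zero_factor kN/=; have [->|ij] := eqVneq i j; first by rewrite j0 eqxx mulr1.
  have [i0|_] := eqVneq (bead_pos s i) 0%R; last by rewrite mulr0.
  by exfalso; move/eqP : ij; apply; apply: (@bead_pos_inj _ s); rewrite i0 j0.
under eq_bigr do rewrite z.
rewrite -big_mkcond/= big_nat1_eq.
by case: ifP => _; [exact: bead_mass_le0|exact: bead_mass_ge0].
Qed.

(** The measure of a zero run is the sum over a level of the masses of words with zero tail. The sum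
    over all levels is almost surely finite, so some level has a small sum. *)
Lemma ae_zero_run_small : {ae P, forall w, forall N e, (0 < e)%R ->
  exists n, lebesgue_measure (zero_run (xi^~ w) N n) <= e%:E}.
Proof.
have [|w|q q01 qP] := @integral_lt1 (fun w => bead_mass (xi [::] w) 0%N) => //.
- exact: (measurableT_comp (measurable_bead_mass 0%N) (mxi [::])).
- by rewrite bead_mass_ge0 bead_mass_lt1.
have leq N k : (N <= k)%N ->
    \esum_(i in [set: nat]) \int[P]_w (zero_factor N k i (xi [::] w))%:E <= q%:E.
  move=> Nk; apply: le_trans qP.
  apply: (mean_sum_le (h := fun s => bead_mass s 0%N)) => //.
    exact: measurable_bead_mass.
  by move=> n x; exact: zero_factor_sum_le.
have goo : \int[P]_w (1 : R)%:E < +oo.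
  rewrite integral_cst// mul1e.
  by apply: (@le_lt_trans _ _ 1); [exact: probability_le1|exact: ltry].
have le1 N k : \esum_(i in [set: nat]) \int[P]_w (zero_factor N k i (xi [::] w))%:E <= 1.
  apply: (@le_trans _ _ (\int[P]_w (1 : R)%:E)); last first.
    by rewrite integral_cst// mul1e; exact: probability_le1.
  apply: (mean_sum_le (h := fun=> 1%R)) => //.
  move=> n x; apply: le_trans (bead_mass_sum_le1 x n); apply: ler_sum => i _.
  by rewrite ler_piMr ?bead_mass_ge0// lern1 leq_b1.
have key N : {ae P, forall w, forall e, (0 < e)%R ->
    exists n, lebesgue_measure (zero_run (xi^~ w) N n) <= e%:E}.
  have := weight_sum_finite (g := fun=> 1%R) mxi iidxi (measurable_zero_factor N)
    (zero_factor_ge0 N) (measurable_cst _) (fun=> ler01) (N := N) q01 (le1 N)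
    (leq N) goo.
  apply: filterS => w fin e e0.
  have Sa : summable0 (fun u => cmass (xi^~ w) u * (zero_tail (xi^~ w) N u)%:R)%R.
    split=> [u|]; first by rewrite mulr_ge0 ?cmass_ge0.
    by apply: le_lt_trans fin; apply: le_esum => u _; rewrite weight_zero_factor mulr1.
  have [n nP] := level_sum_small Sa e0; exists n; apply: le_trans nP.
  rewrite (address_measure (xi^~ w) n (fun u => zero_tail (xi^~ w) N u)).
  rewrite esum_mkcond [leRHS]esum_mkcond; apply: le_esum => u _.
  case: ifPn => [/set_mem/= [un uz]|_]; first by rewrite mem_set// uz mulr1.
  by case: ifP => // _; rewrite lee_fin mulr_ge0 ?cmass_ge0.
have [A [mA A0 AP]] := negligible_bigcup key.
exists A; split=> // w /existsNP[N h]; apply: AP; exists N => //.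
Qed.

End almost_sure_conditions.

(** * Measurability of the limit tree *)

Section borel_trees.
Context {R : realType} d (Omega : measurableType d).

Lemma measurable_ler_set (f g : Omega -> R) : measurable_fun setT f ->
  measurable_fun setT g -> measurable [set w | f w <= g w].
Proof.
move=> mf mg; rewrite -[X in measurable X]setTI.
exact: (measurable_fun_ler mf mg measurableT (Y := [set true])).
Qed.

Lemma measurable_constant_set (Q : Prop) : measurable [set _ : Omega | Q].
Proof.
have [q|q] := pselect Q; [rewrite (_ : mkset _ = setT)|rewrite (_ : mkset _ = set0)] => //.
  by apply/seteqP; split.
by apply/seteqP; split.
Qed.

Lemma measurable_map_eq (X Y : eqType) (f : Omega -> X -> Y) (W : seq X) (z : seq Y) :
  (forall x y, measurable [set w | f w x = y]) ->
  measurable [set w | map (f w) W = z].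
Proof.
move=> mf; elim: W z => [|x W IH] [|y z] /=;
    [exact: measurable_constant_set|exact: measurable_constant_set| |].
  by rewrite (_ : mkset _ = set0)//; apply/seteqP; split.
rewrite (_ : mkset _ = [set w | f w x = y] `&` [set w | map (f w) W = z]).
  exact: measurableI.
by apply/seteqP; split => w /= [-> ->].
Qed.

(* Any two trees of a cell are close, so an open set that contains the tree of
   some point contains, for fine enough cells, the trees of its whole cell. *)
Lemma random_tree_cells (G : set Omega) (T : Omega -> Tw R) (T0 : Tw R) (I : countType)
    (C : R -> I -> set Omega) :
  measurable G -> (forall w, ~ G w -> T w = T0) ->
  (forall e i, 0 < e -> measurable (C e i)) ->
  (forall e w, 0 < e -> G w -> exists i, C e i w) ->
  (forall e i w w', 0 < e -> G w -> G w' -> C e i w -> C e i w' ->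
    (ghp_dist (T w) (T w') <= e%:E)%E) ->
  random_tree T.
Proof.
move=> mG TG mC CG CT U oU.
pose e (m : nat) : R := m.+1%:R^-1; have e0 m : 0 < e m by rewrite invr_gt0.
pose B (m : nat) (i : I) := G `&` C (e m) i.
pose good m i := B m i `<=` [set w | U (T w)].
have -> : [set w | U (T w)] =
    (~` G `&` [set _ | U T0]) `|`
    \bigcup_m \bigcup_(i in good m) B m i.
  apply/seteqP; split=> [w Uw|w [[Gw Uw]|[m _ [i gi Bw]]]]; first last.
  - exact: gi.
  - by rewrite /= TG.
  have [Gw|Gw] := pselect (G w); last by left; split => //; rewrite /= -(TG w).
  right; have [r r0 rU] := oU _ Uw.
  have [m mr] : exists m, e m < r.
    have /cvgrPdist_lt/(_ r r0)[m _ /(_ m (leqnn m))] := @cvg_harmonic R.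
    by rewrite /= sub0r normrN ger0_norm ?invr_ge0// => h; exists m.
  have [i Ci] := CG _ _ (e0 m) Gw.
  exists m => //; exists i => // w' [Gw' Ciw']; apply: rU.
  by apply: le_lt_trans (CT _ _ _ _ (e0 m) Gw Gw' Ci Ciw') _; rewrite lte_fin.
apply: measurableU.
  by apply: measurableI; [exact: measurableC|exact: measurable_constant_set].
apply: bigcupT_measurable => m; rewrite bigcup_mkcond.
apply: countable_bigcupT_measurable => // i; case: ifP => // _.
by apply: measurableI => //; exact: mC.
Qed.

End borel_trees.

Section random_limit.
Context {R : realType} d (Omega : measurableType d).
Variables (beta : R) (xi : seq nat -> Omega -> string_of_beads R).
Hypotheses (beta0 : 0 < beta) (mxi : forall u, measurable_fun [set: Omega] (xi u)).

Lemma measurable_cmass u : measurable_fun [set: Omega] (fun w => cmass (xi^~ w) u).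
Proof.
elim: u => [|i u IH] /=; first exact: measurable_cst.
apply: measurable_funM => //.
exact: (measurableT_comp (measurable_bead_mass i) (mxi u)).
Qed.

Let measurable_cmass_pow u :
  measurable_fun [set: Omega] (fun w => cmass (xi^~ w) u `^ beta).
Proof. exact: (measurableT_comp (measurable_powR _) (measurable_cmass u)). Qed.

Lemma measurable_clen u : measurable_fun [set: Omega] (fun w => clen beta (xi^~ w) u).
Proof.
apply: measurable_funM => //.
exact: (measurableT_comp measurable_string_length (mxi u)).
Qed.

Lemma measurable_cpos u i :
  measurable_fun [set: Omega] (fun w => cpos beta (xi^~ w) u i).
Proof.
apply: measurable_funM => //.
exact: (measurableT_comp (measurable_bead_pos i) (mxi u)).
Qed.

Lemma measurable_cleft u : measurable_fun [set: Omega] (fun w => cleft (xi^~ w) u).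
Proof.
elim: u => [|i u IH] /=; first exact: measurable_cst.
apply: measurable_funD => //; apply: measurable_funM; first exact: measurable_cmass.
apply: measurable_sum => j.
exact: (measurableT_comp (measurable_bead_mass j) (mxi u)).
Qed.

Definition decay_event rho := [set w | decaying rho (clen beta (xi^~ w))].

Lemma measurable_decay_event rho : measurable (decay_event rho).
Proof.
have [r01|r01] := pselect (0 < rho < 1); last first.
  by rewrite (_ : decay_event rho = set0)//; apply/seteqP; split=> // w [].
pose D j k := [set w | clen beta (xi^~ w) (CodeSeq.decode k) <=
   j.+1%:R^-1 * rho ^+ size (CodeSeq.decode k)].
have -> : decay_event rho = \bigcap_j \bigcup_K \bigcap_(k in [set k | (K <= k)%N]) D j k.
  apply/seteqP; split=> [w [_ dec] j _|w h]; last split=> // e e0.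
    have [|K KP] := dec j.+1%:R^-1; first by rewrite invr_gt0.
    by exists K => // k /= Kk; apply: KP; rewrite CodeSeq.decodeK.
  have /cvgrPdist_lt/(_ e e0)[j _ /(_ j (leqnn j))] := @cvg_harmonic R.
  rewrite /= sub0r normrN ger0_norm ?invr_ge0// => je.
  have [K _ KP] := h j I; exists K => u Ku; have := KP (CodeSeq.code u) Ku.
  rewrite /D /= CodeSeq.codeK => /le_trans; apply.
  case/andP: r01 => r0 _.
  by rewrite ler_wpM2r ?exprn_ge0 ?ltW.
apply: bigcapT_measurable => j; apply: bigcupT_measurable => K.
apply: bigcap_measurableType => k _.
by apply: measurable_ler_set; [exact: measurable_clen|exact: measurable_cst].
Qed.

Let measurable_floor_eq (f : Omega -> R) (eta : R) (m : int) :
  measurable_fun setT f -> measurable [set w | Num.floor (f w / eta) = m].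
Proof.
move=> mf.
have mg : measurable_fun setT (fun w => f w / eta).
  by apply: measurable_funM => //; exact: measurable_cst.
have := mg measurableT _ (measurable_itv `[m%:~R, (m + 1)%:~R[).
rewrite setTI; congr (measurable _); apply/seteqP; split=> w /=; rewrite in_itv/=.
  by rewrite -floor_eq => /eqP.
by move=> /eqP; rewrite floor_eq.
Qed.

Let floor_eq_close (x y eta : R) : 0 < eta ->
  Num.floor (x / eta) = Num.floor (y / eta) -> `|x - y| <= eta.
Proof.
move=> eta0 xy; have /andP[] := floor_itv (x / eta); have /andP[] := floor_itv (y / eta).
rewrite -xy !ler_pdivlMr// !ltr_pdivrMr// !intrD !mulrDl !mul1r => a b c e.
by rewrite ler_norml; apply/andP; split; lra.
Qed.

(** Rounded parameters take countably many values, and equal roundings leave the parameters within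
    [eta > 0]. The second component at [i :: u] is the height of its attachment to [u]. *)
Let grid (eta : R) w (v : seq nat) : int * int * int * int :=
  (Num.floor (clen beta (xi^~ w) v / eta),
   Num.floor (cpos beta (xi^~ w) (behead v) (head 0%N v) / eta),
   Num.floor (cleft (xi^~ w) v / eta),
   Num.floor (cmass (xi^~ w) v / eta)).

Let measurable_grid eta v z : measurable [set w | grid eta w v = z].
Proof.
case: z => [[[a b] c] e].
rewrite (_ : mkset _ = [set w | Num.floor (clen beta (xi^~ w) v / eta) = a] `&`
   [set w | Num.floor (cpos beta (xi^~ w) (behead v) (head 0%N v) / eta) = b] `&`
   [set w | Num.floor (cleft (xi^~ w) v / eta) = c] `&`
   [set w | Num.floor (cmass (xi^~ w) v / eta) = e]); last first.
  by apply/seteqP; split => w /= => [[-> -> -> ->]|[[[<- <-] <-] <-]].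
by do 3 ?apply: measurableI; apply: measurable_floor_eq;
  [exact: measurable_clen|exact: measurable_cpos|exact: measurable_cleft|
   exact: measurable_cmass].
Qed.

Variables (rho : R) (rho01 : 0 < rho < 1).

(** Constants for [ghp_dist_limit]: [slack e / (1 - rho)] is [e / 8], and so is [mesh e F E] times
    the sum in its denominator, which keeps both error terms below [e]. The summand 1 there avoids a
    zero denominator. *)
Let slack (e : R) : R := e * (1 - rho) / 8.

Let mesh (e : R) (F E : seq (seq nat)) : R :=
  e / (8 * ((size F)%:R + (size E)%:R * 3 + 1)).

Let admissible (N : nat) (F E : seq (seq nat)) :=
  [/\ uniq F, suffix_closed F, forall u, u \in F -> (size u < N)%N,
      uniq E & (forall u, u \in E -> size u = N) /\
      (forall u v, u \in E -> v \in proper_suffixes u -> v \in F)].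

Let small_outside (e : R) (F : seq (seq nat)) := [set w | forall u, u \notin F ->
  clen beta (xi^~ w) u <= slack e * rho ^+ size u].

Let heavy (e : R) (E : seq (seq nat)) := [set w | 1 - slack e <= \sum_(u <- E) cmass (xi^~ w) u].

(* In a cell, finitely many parameters are known up to [mesh]; the other lengths
   and masses change the tree by a multiple of [slack] only. *)
Let tree_cell (e : R) (i : nat * seq (seq nat) * seq (seq nat) * seq (int * int * int * int)) :=
  let: (N, F, E, z) := i in
  [set _ : Omega | admissible N F E] `&` small_outside e F `&` heavy e E `&`
  [set w | map (grid (mesh e F E) w) (F ++ E) = z].

Let measurable_tree_cell e i : measurable (tree_cell e i).
Proof.
case: i => [[[N F] E] z]; do 3 ?apply: measurableI.
- exact: measurable_constant_set.
- rewrite (_ : small_outside e F = \bigcap_(k in [set k | CodeSeq.decode k \notin F])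
    [set w | clen beta (xi^~ w) (CodeSeq.decode k) <=
             slack e * rho ^+ size (CodeSeq.decode k)]).
    apply: bigcap_measurableType => k _.
    by apply: measurable_ler_set; [exact: measurable_clen|exact: measurable_cst].
  apply/seteqP; split=> [w h k /= kF|w h u uF]; first exact: h.
  have /= := h (CodeSeq.code u); rewrite CodeSeq.codeK; exact.
- apply: measurable_ler_set; first exact: measurable_cst.
  by apply: measurable_sum => u; exact: measurable_cmass.
- by apply: measurable_map_eq => v y; exact: measurable_grid.
Qed.

Let slack_gt0 e : 0 < e -> 0 < slack e.
Proof. by move=> e0; case/andP: rho01 => _ r1; rewrite divr_gt0// mulr_gt0// subr_gt0. Qed.

Let tree_cell_exists e w : 0 < e -> decay_event rho w -> exists i, tree_cell e i w.
Proof.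
move=> e0 [_ dec]; have s0 := slack_gt0 e0.
have [K KP] := dec _ s0; have [N NP] := code_ge_size K.
have [E [uE sE hE]] : exists E, [/\ uniq E, forall u, u \in E -> size u = N &
    1 - slack e <= \sum_(u <- E) cmass (xi^~ w) u].
  have : ((1 - slack e)%:E < \esum_(u in [set u | size u = N]) (cmass (xi^~ w) u)%:E)%E.
    by rewrite address_total_mass lte_fin; lra.
  move=> /ereal_sup_gt[_ [A [fA AN] <-]]; rewrite fsbig_finite//= sumEFin lte_fin => h.
  exists (fset_set A); split; [exact: fset_uniq| |exact: ltW].
  by move=> u; rewrite in_fset_set// inE => /AN.
(* [L] holds the words that the decay does not control; they are shorter than [N] by the choice of
   [N]. Adding the proper suffixes of [L] and [E] closes [F] under suffixes and supplies the
   branches to [E]. *)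
pose L := [seq CodeSeq.decode k | k <- iota 0 K].
pose F := undup (L ++ flatten [seq proper_suffixes u | u <- L ++ E]).
have FP v u : u \in L ++ E -> v \in proper_suffixes u -> v \in F.
  move=> uLE vu; rewrite mem_undup mem_cat; apply/orP; right.
  by apply/flattenP; exists (proper_suffixes u) => //; apply/mapP; exists u.
have LN u : u \in L -> (size u < N)%N.
  move=> /mapP[k]; rewrite mem_iota add0n => /= kK ->; rewrite ltnNge; apply/negP => /NP.
  by rewrite CodeSeq.decodeK leqNgt kK.
exists (N, F, E, map (grid (mesh e F E) w) (F ++ E)); split=> //; split=> //; split.
  split=> //; first exact: undup_uniq.
  - move=> u v; rewrite mem_undup mem_cat => /orP[uL|].
      by apply: FP; rewrite mem_cat uL.
    move=> /flattenP[_ /mapP[t tLE ->] ut] vu.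
    by apply: (FP v t tLE); exact: proper_suffixes_trans vu ut.
  - move=> u; rewrite mem_undup mem_cat => /orP[/LN//|].
    move=> /flattenP[_ /mapP[t + ->] /size_proper_suffix ut].
    by rewrite mem_cat => /orP[/LN|/sE tN]; [exact: ltn_trans|rewrite -tN].
  - by split=> // u v uE'; apply: FP; rewrite mem_cat uE' orbT.
move=> u uF; apply: KP; rewrite leqNgt; apply/negP => uK; move/negP : uF; apply.
rewrite mem_undup mem_cat; apply/orP; left; apply/mapP; exists (CodeSeq.code u).
  by rewrite mem_iota.
by rewrite CodeSeq.codeK.
Qed.

Let tree_cell_close e i w w' (dw : decay_event rho w) (dw' : decay_event rho w') :
  0 < e -> tree_cell e i w -> tree_cell e i w' ->
  (ghp_dist (limit_weighted beta0 dw) (limit_weighted beta0 dw') <= e%:E)%E.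
Proof.
case: i => [[[N F] E] z] e0 [[[adm sw] hw] gw] [[[_ sw'] _] gw'].
move: adm => /= [uF sF FN uE [EN EF]].
have s0 := slack_gt0 e0.
have D0 : 0 < (size F)%:R + (size E)%:R * 3 + 1 :> R by rewrite ltr_wpDl// addr_ge0// mulr_ge0.
have eta0 : 0 < mesh e F E by rewrite divr_gt0// mulr_gt0.
have meshE : mesh e F E * ((size F)%:R + (size E)%:R * 3 + 1) = e / 8.
  by rewrite /mesh invfM mulrA mulfVK// gt_eqF.
have gg : map (grid (mesh e F E) w) (F ++ E) = map (grid (mesh e F E) w') (F ++ E).
  by rewrite gw gw'.
have grids v : v \in F ++ E -> [/\ `|clen beta (xi^~ w) v - clen beta (xi^~ w') v| <= mesh e F E,
    `|cpos beta (xi^~ w) (behead v) (head 0%N v) -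
      cpos beta (xi^~ w') (behead v) (head 0%N v)| <= mesh e F E,
    `|cleft (xi^~ w) v - cleft (xi^~ w') v| <= mesh e F E &
    `|cmass (xi^~ w) v - cmass (xi^~ w') v| <= mesh e F E].
  by move/eq_in_map : gg => /[apply]; rewrite /grid => -[] *; split; exact: floor_eq_close.
have Fl u : u \in F -> u \in F ++ E by rewrite mem_cat => ->.
have Er u : u \in E -> u \in F ++ E by rewrite mem_cat orbC => ->.
have Fm : 0 <= (size F)%:R * mesh e F E by rewrite mulr_ge0 ?(ltW eta0).
have Em : 0 <= (size E)%:R * mesh e F E by rewrite mulr_ge0 ?(ltW eta0).
apply: (@ghp_dist_limit R beta rho (slack e) (mesh e F E) (xi^~ w) (xi^~ w') beta0
  dw dw' N F E) => //; try exact: ltW.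
- by move=> u uF'; have [] := grids _ (Fl _ uF').
- by move=> i u iu; have [] := grids _ iu.
- by move=> u uE'; have [] := grids _ (Er _ uE').
- by move=> u uE'; have [] := grids _ (Er _ uE').
- case/andP: rho01 => r0 r1; have -> : slack e / (1 - rho) = e / 8.
    by rewrite /slack mulrAC mulfK// gt_eqF// subr_gt0.
  by move: Fm Em meshE eta0 e0; set m := mesh _ _ _; set f := _%:R; set g := _%:R;
    move=> *; lra.
- have : slack e <= e / 8.
    case/andP: rho01 => r0 r1; rewrite /slack ler_pM2r ?invr_gt0//.
    by rewrite ler_piMr ?(ltW e0)// gerBl ltW.
  by move: Fm Em meshE eta0 e0; set m := mesh _ _ _; set f := _%:R; set g := _%:R;
    move=> *; lra.
Qed.

Definition limit_tree (T0 : Tw R) (w : Omega) : Tw R :=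
  if pselect (decay_event rho w) is left dec then
    MkTw (limit_compact_weighted_Rtree beta0 dec)
  else T0.

(** The proof of decay is part of the tree, so it is returned rather than identified with the given
    one. *)
Lemma limit_treeE T0 w : decay_event rho w -> exists dec : decaying rho (clen beta (xi^~ w)),
  limit_tree T0 w = MkTw (limit_compact_weighted_Rtree beta0 dec).
Proof. by rewrite /limit_tree; case: pselect => // dec _; exists dec. Qed.

Lemma limit_tree_random T0 : random_tree (limit_tree T0).
Proof.
apply: (random_tree_cells (G := decay_event rho) (T0 := T0) (C := tree_cell)).
- exact: measurable_decay_event.
- by move=> w Gw; rewrite /limit_tree; case: pselect.
- by move=> e i _; exact: measurable_tree_cell.
- by move=> e w; exact: tree_cell_exists.
- move=> e i w w' e0 Gw Gw' Cw Cw'.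
  have [dw ->] := limit_treeE T0 Gw; have [dw' ->] := limit_treeE T0 Gw'.
  exact: tree_cell_close Cw Cw'.
Qed.

End random_limit.

Theorem theorem1p1 (R : realType) (d : measure_display)
    (Omega : measurableType d) (P : probability Omega R) (p beta : R)
    (xi : seq nat -> Omega -> string_of_beads R) :
  1 <= p -> 1 / p < beta ->
  (forall u, measurable_fun [set: Omega] (xi u)) ->
  iid P xi ->
  ('E_P[fun w => (string_length (xi [::] w) `^ p)%R] < +oo)%E ->
  exists T : Omega -> Tw R, compact_CRT P T /\
    {ae P, forall w,
      (forall n, compact_weighted_Rtree (string_tree beta (xi^~ w) n)) /\
      ghp_dist (string_tree beta (xi^~ w) n) (T w) @[n --> \oo] --> 0%E}.

Proof.
move=> p1 bp mxi iidxi moment.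
have beta0 := beta_gt0 p1 bp.
have [rho aedec] := ae_decaying p1 bp mxi iidxi moment.
(* An event of probability 1 is not empty; the limit at one of its points serves as the value of the
   random tree off the event. *)
have [w0 dec0] : exists w, decaying rho (clen beta (xi^~ w)).
  apply/not_existsP => none; have [A [mA A0 AP]] := aedec.
  have AT : A = [set: Omega] by apply/seteqP; split=> // w _; apply: AP; exact: none.
  by move: A0; rewrite AT probability_setT => /eqP; rewrite onee_eq0.
have [rho01 _] := dec0.
pose T0 := MkTw (limit_compact_weighted_Rtree beta0 dec0).
exists (@limit_tree R d Omega beta xi beta0 rho T0); split; first split.
- exact: limit_tree_random.
- apply: filterS3 aedec (ae_mass_small p1 bp mxi iidxi) (ae_zero_run_small mxi iidxi).
  move=> w dw ms zs; have [dec ->] := @limit_treeE R d Omega beta xi beta0 rho T0 w dw.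
  exact: (limit_continuum_tree beta0 dec ms zs).
- apply: filterS aedec => w dw.
  have [dec ->] := @limit_treeE R d Omega beta xi beta0 rho T0 w dw.
  split=> [n|]; last exact: (ghp_cvg_string_tree beta0 dec).
  have [iota emb] := string_embedding_exists beta0 dec n.
  exact: (string_tree_compact_weighted_Rtree beta0 dec emb).
Qed.
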